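(* Let $n\ge 2$, let $M$ be either the unit sphere $\mathbb{S}^n$ or the real hyperbolic space $\mathbb{H}^n$, with geodesic distance $d$ and Riemannian measure $|\cdot|$. Let $K:(0,\infty)\to(0,\infty)$ be non-increasing and such that, for $x\in M$, the function $y\mapsto K(d(x,y))$ is locally integrable on $M$ (equivalently integrable, if $M=\mathbb{S}^n$). For a nonempty bounded open set $\Omega\subset M$ let $$\mathcal{K}_\Omega:L^2(\Omega)\to L^2(\Omega),\qquad \mathcal{K}_\Omega f(x)=\int_\Omega K(d(x,y))f(y)\,dy,$$ and assume these operators are compact. Let $\lambda_1(\Omega)$ denote the eigenvalue of $\mathcal{K}_\Omega$ of largest modulus. Then, for every nonempty bounded open set $\Omega\subset M$ and every open geodesic ball $\Omega^*\subset M$ with $|\Omega^*|=|\Omega|$, $$0<\lambda_1(\Omega)\le\lambda_1(\Omega^* ).$$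
   Context: Here $dy$ denotes the Riemannian measure on $M$, and $|\Omega|$ is the Riemannian measure of $\Omega$. An open geodesic ball is a set $\{x\in M: d(x,x_0)<r\}$ with $x_0\in M$, $r>0$. Since the kernel $K(d(x,y))$ is real and symmetric, $\mathcal{K}_\Omega$ is a self-adjoint operator, so its eigenvalues are real; they are enumerated with multiplicity in descending order of moduli, $|\lambda_1(\Omega)|\ge|\lambda_2(\Omega)|\ge\cdots$. *)

(* Defs.v *)
From HB Require Import structures.
From mathcomp Require Import all_boot all_order all_algebra.
From mathcomp Require Import all_classical all_reals all_analysis.
From mathcomp Require Import measurable_realfun.
Set Implicit Arguments.
Unset Strict Implicit.
Unset Printing Implicit Defensive.
Import Order.TTheory GRing.Theory Num.Theory.
Import numFieldNormedType.Exports.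
Local Open Scope classical_set_scope.
Local Open Scope ring_scope.

Section measurable_rV.
Context {R : realType} {n : nat}.

Let coors : 'I_n -> 'rV[R]_n -> R := fun i u => u ord0 i.

Let rV_set0 : g_sigma_preimage coors set0.
Proof. exact: sigma_algebra0. Qed.

Let rV_setC A : g_sigma_preimage coors A -> g_sigma_preimage coors (~` A).
Proof. exact: sigma_algebraC. Qed.

Let rV_bigcup (F : _^nat) : (forall i, g_sigma_preimage coors (F i)) ->
  g_sigma_preimage coors (\bigcup_i (F i)).
Proof. exact: sigma_algebra_bigcup. Qed.

(* The product sigma-algebra, as on [n.-tuple R]. *)
HB.instance Definition _ :=
  @isMeasurable.Build (measure_tuple_display default_measure_display)
  'rV[R]_n (g_sigma_preimage coors) rV_set0 rV_setC rV_bigcup.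

Lemma measurable_coord (i : 'I_n) :
  measurable_fun [set: 'rV[R]_n] (fun u : 'rV[R]_n => u ord0 i).
Proof.
move=> _ Y mY; rewrite setTI; apply: sub_sigma_algebra => /=.
rewrite -bigcup_seq/=; exists i => /=; first by rewrite mem_index_enum.
by exists Y => //; rewrite setTI.
Qed.

Lemma measurable_fun_coordP d (T : measurableType d) (f : T -> 'rV[R]_n) :
  (forall i, measurable_fun [set: T] (fun x => f x ord0 i)) ->
  measurable_fun [set: T] f.
Proof.
move=> mf.
suff : g_sigma_preimage (fun i => coors i \o f) `<=` measurable.
  rewrite g_sigma_preimage_comp => prefS _ A mA.
  by apply: prefS; exists A.
apply: smallest_sub; first exact: sigma_algebra_measurable.
elim/big_ind : _ => //= [B C BS CS A [/BS|/CS]//|i _ A [B mB <-]].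
exact: mf.
Qed.

End measurable_rV.

Definition cons_rV {R : Type} {n : nat} (t : R) (u : 'rV[R]_n) : 'rV[R]_n.+1 :=
  \row_i oapp (u ord0) t (unlift ord0 i).

Lemma measurable_cons_rV d (T : measurableType d) {R : realType} {n : nat}
    (t : T -> R) (u : T -> 'rV[R]_n) :
  measurable_fun [set: T] t -> measurable_fun [set: T] u ->
  measurable_fun [set: T] (fun x => cons_rV (t x) (u x)).
Proof.
move=> mt mu; apply: measurable_fun_coordP => i.
under eq_fun do rewrite mxE.
case: unliftP => [j _|_] //=.
exact: (measurableT_comp (measurable_coord j)).
Qed.

Section image_measure.
Context d1 d2 (T1 : measurableType d1) (T2 : measurableType d2) (R : realType).
Variables (m : {measure set T1 -> \bar R}) (f : T1 -> T2).

(* [pushforward], carrying the measurability proof so that the measure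
   structure can be inferred. *)
Definition image_measure of measurable_fun [set: T1] f := pushforward m f.

Hypothesis mf : measurable_fun [set: T1] f.

Let image_measure0 : image_measure mf set0 = 0%E.
Proof. by rewrite /image_measure /pushforward preimage_set0 measure0. Qed.

Let image_measure_ge0 A : (0 <= image_measure mf A)%E.
Proof. exact: measure_ge0. Qed.

Let image_measure_sigma_additive : semi_sigma_additive (image_measure mf).
Proof. exact: measure_semi_sigma_additive. Qed.

HB.instance Definition _ := isMeasure.Build _ _ _ (image_measure mf)
  image_measure0 image_measure_ge0 image_measure_sigma_additive.

End image_measure.

Lemma measurable_snd_cons_fst {R : realType} n : measurable_fun
  [set: 'rV[R]_n * R] (fun p : 'rV[R]_n * R => cons_rV p.2 p.1).
Proof. exact: measurable_cons_rV. Qed.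

Fixpoint lebesgue_rV (R : realType) (n : nat) :
    {measure set 'rV[R]_n -> \bar R} :=
  match n with
  | 0 => [the measure _ _ of dirac (0 : 'rV[R]_0)]
  | n'.+1 => [the measure _ _ of
      image_measure
        [the measure _ _ of (lebesgue_rV R n' \x (@lebesgue_measure R))%E]
        (@measurable_snd_cons_fst R n')]
  end.

Inductive space_form := Sphere | Hyperbolic.

Section space_form.
Context {R : realType} (M : space_form) {n : nat}.
Implicit Types (x y : 'rV[R]_n.+1) (u v : 'rV[R]_n).

Definition curvature : R := if M is Sphere then 1 else - 1.

Definition dotmul u v : R := \sum_(i < n) u ord0 i * v ord0 i.

(* On R^{n+1}, with [x 0] the first coordinate: the Euclidean inner product
   x_0 y_0 + sum_i x_i y_i for the sphere, and x_0 y_0 - sum_i x_i y_i (minus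
   the Lorentzian product) for hyperbolic space. *)
Definition ambient_form x y : R :=
  x ord0 ord0 * y ord0 ord0 +
  curvature * \sum_(i < n) x ord0 (lift ord0 i) * y ord0 (lift ord0 i).

(* The unit sphere in R^{n+1}, resp. the upper sheet of the hyperboloid. *)
Definition space_points : set 'rV[R]_n.+1 :=
  match M with
  | Sphere => [set x | ambient_form x x = 1]
  | Hyperbolic => [set x | ambient_form x x = 1 /\ 0 < x ord0 ord0]
  end.

Definition arcosh (t : R) : R := ln (t + Num.sqrt (t ^+ 2 - 1)).

(* Geodesic distance, only meaningful on [space_points]. *)
Definition gdist x y : R :=
  match M with
  | Sphere => acos (ambient_form x y)
  | Hyperbolic => arcosh (ambient_form x y)
  end.

Definition gball x (r : R) : set 'rV[R]_n.+1 :=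
  [set y | space_points y /\ gdist y x < r].

Definition gopen (O : set 'rV[R]_n.+1) : Prop :=
  O `<=` space_points /\
  forall x, O x -> exists2 r : R, 0 < r & gball x r `<=` O.

Definition gbounded (O : set 'rV[R]_n.+1) : Prop :=
  exists x (r : R), space_points x /\ O `<=` gball x r.

(* Hyperbolic space is the graph x_0 = sqrt (1 + |u|^2) over R^n; the sphere,
   minus the equator x_0 = 0, is the union of the graphs
   x_0 = +- sqrt (1 - |u|^2) over the open unit ball. *)
Definition chart_domain : set 'rV[R]_n :=
  [set u | 0 < 1 - curvature * dotmul u u].

Definition chart (e : R) u : 'rV[R]_n.+1 :=
  cons_rV (e * Num.sqrt (1 - curvature * dotmul u u)) u.

(* The Riemannian metric in these coordinates: the tangential inner product
   is curvature * dx_0^2 + sum_i dx_i^2, and on the graph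
   dx_0 = -+ curvature * (sum_i u_i du_i) / sqrt (1 - curvature * |u|^2). *)
Definition metric_tensor u : 'M[R]_n :=
  1%:M + (curvature / (1 - curvature * dotmul u u)) *: (u^T *m u).

Definition volume_density : 'rV[R]_n -> \bar R :=
  (fun u => (Num.sqrt (\det (metric_tensor u)))%:E) \_ chart_domain.

Lemma measurable_invr : measurable_fun [set: R] (@GRing.inv R).
Proof.
have -> : [set: R] = [set 0] `|` ~` [set 0] by rewrite setUv.
apply/measurable_funU => //; first exact: measurableC.
split.
- exact: measurable_fun_set1.
- apply: open_continuous_measurable_fun.
    by apply: closed_openC; exact: closed_eq.
  by move=> x; rewrite inE/= => /eqP x0; exact: inv_continuous.
Qed.

Lemma measurable_radial :
  measurable_fun [set: 'rV[R]_n] (fun u => 1 - curvature * dotmul u u).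
Proof.
apply: measurable_funB => //; apply: measurable_funM => //.
apply: measurable_sum => i; apply: measurable_funM; exact: measurable_coord.
Qed.

Lemma measurable_chart_domain : measurable chart_domain.
Proof.
rewrite -[chart_domain]setTI.
have -> : chart_domain =
    (fun u => 1 - curvature * dotmul u u) @^-1` `]0, +oo[%classic.
  by apply/seteqP; split => u /=; rewrite in_itv/= andbT.
exact: measurable_radial.
Qed.

Lemma measurable_chart (e : R) : measurable_fun [set: 'rV[R]_n] (chart e).
Proof.
apply: measurable_cons_rV => //; apply: measurable_funM => //.
apply: (measurableT_comp _ measurable_radial).
apply: continuous_measurable_fun; exact: sqrt_continuous.
Qed.

Lemma measurable_metric_tensor i j :
  measurable_fun [set: 'rV[R]_n] (fun u => metric_tensor u i j).
Proof.
under eq_fun do rewrite !mxE.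
apply: measurable_funD => //; apply: measurable_funM.
  apply: measurable_funM => //.
  exact: (measurableT_comp measurable_invr measurable_radial).
apply: measurable_sum => k; under eq_fun do rewrite mxE.
by rewrite (ord1 k); apply: measurable_funM; exact: measurable_coord.
Qed.

Lemma measurable_volume_density :
  measurable_fun [set: 'rV[R]_n] volume_density.
Proof.
apply/(measurable_restrict _ measurable_chart_domain) => //.
rewrite setTI; apply: measurable_funTS; apply/measurable_EFinP.
apply: (@measurableT_comp _ _ _ _ _ _ (@Num.sqrt R : R -> R) _
  (fun u => \det (metric_tensor u))).
  by apply: continuous_measurable_fun; exact: sqrt_continuous.
apply: measurable_sum => s; apply: measurable_funM => //.
apply: measurable_prod => i _; exact: measurable_metric_tensor.
Qed.

Lemma volume_density_ge0 u : (0 <= volume_density u)%E.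
Proof.
by rewrite /volume_density patchE; case: ifP => _ //; rewrite lee_fin sqrtr_ge0.
Qed.

Definition chart_volume (A : set 'rV[R]_n) : \bar R :=
  (\int[lebesgue_rV R n]_(u in A) volume_density u)%E.

Let chart_volume0 : chart_volume set0 = 0%E.
Proof. by rewrite /chart_volume integral_set0. Qed.

Let chart_volume_ge0 A : (0 <= chart_volume A)%E.
Proof. by apply: integral_ge0 => u _; exact: volume_density_ge0. Qed.

Let chart_volume_sigma_additive : semi_sigma_additive chart_volume.
Proof.
apply: semi_sigma_additive_nng_induced; first exact: measurable_volume_density.
exact: volume_density_ge0.
Qed.

HB.instance Definition _ := isMeasure.Build _ _ _ chart_volume
  chart_volume0 chart_volume_ge0 chart_volume_sigma_additive.

(* The equator of the sphere, which the two charts miss, is a null set. *)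
Definition riemannian_measure : {measure set 'rV[R]_n.+1 -> \bar R} :=
  match M with
  | Sphere => [the measure _ _ of measure_add
      [the measure _ _ of image_measure chart_volume (measurable_chart 1)]
      [the measure _ _ of image_measure chart_volume (measurable_chart (- 1))]]
  | Hyperbolic =>
      [the measure _ _ of image_measure chart_volume (measurable_chart 1)]
  end.

End space_form.

Section L2.
Context d (T : measurableType d) (R : realType).
Variables (mu : {measure set T -> \bar R}) (O : set T).
Implicit Types (f g : T -> R) (F : (T -> R) -> (T -> R)).

(* A class in L^2(O) is represented by any function T -> R whose restriction to
   O belongs to it; values outside O are ignored. *)
Definition in_L2 f : Prop := f \_ O \in Lfun mu 2%:E.

Definition L2norm f : \bar R := ('N[mu]_2%:E [EFin \o (f \_ O)])%E.

Definition compact_operator F : Prop :=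
  (forall f, in_L2 f -> in_L2 (F f)) /\
  (forall f_ : nat -> T -> R, (forall k, in_L2 (f_ k)) ->
    (exists C : R, forall k, (L2norm (f_ k) <= C%:E)%E) ->
    exists (s : nat -> nat) (g : T -> R),
      [/\ {homo s : i j / (i < j)%N}, in_L2 g &
          L2norm (F (f_ (s k)) \- g) @[k --> \oo] --> 0%E]).

Definition L2_eigenvalue F (l : R) : Prop :=
  exists f, [/\ in_L2 f,
    ~ {ae mu, forall x, O x -> f x = 0} &
    {ae mu, forall x, O x -> F f x = l * f x}].

Definition largest_eigenvalue F (l : R) : Prop :=
  L2_eigenvalue F l /\ forall m, L2_eigenvalue F m -> `|m| <= `|l|.

End L2.

Section kernel_operator.
Context {R : realType} (M : space_form) {n : nat} (K : R -> R).
Local Notation mu := (@riemannian_measure R M n).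

(* Only the values of [K] on (0, oo) matter: the diagonal is a null set. *)
Definition kernel_operator (O : set 'rV[R]_n.+1) (f : 'rV[R]_n.+1 -> R) :
    'rV[R]_n.+1 -> R :=
  fun x => \int[mu]_(y in O) (K (gdist M x y) * f y).

Definition glocally_integrable (f : 'rV[R]_n.+1 -> R) : Prop :=
  forall x, space_points M x ->
    exists2 r : R, 0 < r & mu.-integrable (gball M x r) (EFin \o f).

End kernel_operator.

(* Main.v *)
Require Import Defs.
From HB Require Import structures.
From mathcomp Require Import all_boot all_order all_algebra.
From mathcomp Require Import all_classical all_reals all_analysis.
From mathcomp Require Import measurable_realfun lra ring.
Set Implicit Arguments.
Unset Strict Implicit.
Unset Printing Implicit Defensive.
Import Order.TTheory GRing.Theory Num.Theory.
Import numFieldNormedType.Exports.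
Local Open Scope classical_set_scope.
Local Open Scope ring_scope.

(** A two-point symmetrization (polarization) argument. The operator is compact
    with a positive kernel, so its eigenvalue of largest modulus is the supremum of the
    energy \int\int K(d(x,y)) f(x) f(y) dx dy over f >= 0 with ||f||_2 <= 1;
    minus this supremum is not an eigenvalue because the kernel is positive.

    Given two points x and y, the isometry s exchanging them splits M into two
    halves; polarizing f puts max (f z) (f (s z)) in the half containing x and
    the minimum in the other one. This preserves the distribution of f and, K
    being non-increasing, does not decrease its energy.

    Start from a nearly extremal f on the open set and let phi be a height
    function of the interior of its support. Among all the pairs obtained by
    polarizations that fix the side of the centre x0 of the ball, take one that
    nearly minimizes \int phi(z) d(x0,z) dz. If its support had a non-negligible
    part outside the ball, then phi would vanish somewhere well inside the ball
    and be maximal somewhere outside, and a polarization exchanging these two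
    points would lower the potential by a definite amount. So the support is
    almost contained in the ball. As the part of f living on a set of small
    measure has small energy, the ball carries almost the same energy. *)

(** * Lebesgue measure on row vectors *)

(** No optimal rearrangement is constructed and no sequence of polarizations is shown to converge.
    What replaces this is a gain that is uniform over all admissible pairs, and it is the reason for
    carrying a height function along: the values of an L^2 function give no lower bound on what one
    swap moves, whereas [phi] varies by at most 1 over a fixed distance, and polarization preserves
    this. Height 3 leaves the room needed: near a point of height 0 and a point of height 3 the
    values stay at most 1 and at least 2, so the swap gains at least 1 on a whole ball of fixed
    radius. The other obstacle is the invariance of the Riemannian measure, which is defined by
    charts that reflections do not respect. A polar substitution over the charts shows that the
    measure of [A] is [n + 1] times the Lebesgue measure of the truncated solid cone over [A].
    Reflections extend to linear involutions of the ambient space that preserve the form and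
    Lebesgue measure, hence the cones and their volumes. Multiplying the ambient form by [curvature]
    makes its sign agree in the two geometries, so that most arguments are common to both. *)

Section lebesgue_affine.
Context {R : realType}.
Local Notation leb := (@lebesgue_measure R).

Lemma measurable_affine (a b : R) :
  measurable_fun [set: R] (fun t : R => a * t + b).
Proof. by apply: measurable_funD => //; apply: measurable_funM. Qed.

(** The image of Lebesgue measure under the affine map, scaled by [a], agrees with Lebesgue measure
    on half-open intervals, hence everywhere. *)
Lemma ge0_integral_affine (a b : R) (f : R -> \bar R) : 0 < a ->
  measurable_fun [set: R] f -> (forall t, 0 <= f t)%E ->
  (\int[leb]_t f t = a%:E * \int[leb]_t f (a * t + b)%R)%E.
Proof.
move=> a0 mf f0.
pose phi : measurableTypeR R -> measurableTypeR R := fun t => a * t + b.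
have mphi : measurable_fun [set: measurableTypeR R] phi.
  exact: measurable_affine.
pose m := [the measure _ _ of
  mscale (NngNum (ltW a0)) (image_measure leb mphi)].
have lebE A : measurable A -> leb A = m A.
  apply: lebesgue_measure_unique => _ [[x y]] _ <-.
  rewrite /m/= /mscale/= /image_measure/= /pushforward.
  have -> : phi @^-1` `]x, y] = `](x - b) / a, (y - b) / a]%classic.
    apply/seteqP; split => t /=; rewrite /phi !in_itv/= ltr_pdivrMr//.
      by rewrite ler_pdivlMr// mulrC ltrBlDr lerBrDr.
    by rewrite ler_pdivlMr// mulrC ltrBlDr lerBrDr.
  rewrite !lebesgue_measure_itv/= !lte_fin ltr_pM2r ?invr_gt0// ltrD2r.
  case: ifPn => _; last by rewrite mule0.
  rewrite -!EFinB -EFinM; congr EFin.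
  by rewrite -mulrBl mulrC mulfVK ?gt_eqF//; ring.
rewrite (eq_measure_integral m); last by move=> A mA _; exact: lebE.
rewrite ge0_integral_mscale//=; congr (_ * _)%E.
by rewrite /image_measure ge0_integral_pushforward.
Qed.

End lebesgue_affine.

(* Defs gives [lebesgue_rV] no sigma-finite structure; this alias carries one. *)
Definition lebrV (R : realType) (n : nat) : set 'rV[R]_n -> \bar R :=
  lebesgue_rV R n.

Section lebrV_measure.
Context {R : realType} (n : nat).

Let lebrV0 : lebrV (@set0 'rV[R]_n) = 0%E.
Proof. exact: measure0. Qed.

Let lebrV_ge0 (A : set 'rV[R]_n) : (0 <= lebrV A)%E.
Proof. exact: measure_ge0. Qed.

Let lebrV_sigma_additive : semi_sigma_additive (@lebrV R n).
Proof. exact: measure_semi_sigma_additive. Qed.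

HB.instance Definition _ := isMeasure.Build _ _ _ (@lebrV R n)
  lebrV0 lebrV_ge0 lebrV_sigma_additive.

End lebrV_measure.

Definition cube {R : realType} (n : nat) (r : R) : set 'rV[R]_n :=
  [set u | forall i, `|u ord0 i| < r].
Arguments cube {R} n r.

Section lebrV_theory.
Context {R : realType}.
Local Notation leb := (@lebesgue_measure R).

Lemma cons_rV_at0 n (t : R) (u : 'rV[R]_n) : cons_rV t u ord0 ord0 = t.
Proof. by rewrite mxE unlift_none. Qed.

Lemma cons_rV_lift n (t : R) (u : 'rV[R]_n) i :
  cons_rV t u ord0 (lift ord0 i) = u ord0 i.
Proof. by rewrite mxE liftK. Qed.

Lemma forall_ordS n (P : 'I_n.+1 -> Prop) :
  P ord0 -> (forall i, P (lift ord0 i)) -> forall i, P i.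
Proof. by move=> P0 PS i; case: (unliftP ord0 i) => [j ->|->]. Qed.

Lemma cons_rV_cube n (r t : R) (u : 'rV[R]_n) :
  cube n.+1 r (cons_rV t u) <-> `|t| < r /\ cube n r u.
Proof.
split=> [H|[t_r u_r]].
  split=> [|i]; first by have := H ord0; rewrite cons_rV_at0.
  by have := H (lift ord0 i); rewrite cons_rV_lift.
apply: forall_ordS => [|i]; first by rewrite cons_rV_at0.
by rewrite cons_rV_lift.
Qed.

Lemma measurable_cube n (r : R) : measurable (cube n r).
Proof.
have -> : cube n r = \bigcap_(i in [set: 'I_n])
    ((fun u : 'rV[R]_n => u ord0 i) @^-1` `]- r, r[).
  apply/seteqP; split => [u ur i _|u H i] /=.
    by rewrite in_itv/= -ltr_norml; exact: ur.
  by have := H i I; rewrite /= in_itv/= -ltr_norml.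
apply: fin_bigcap_measurable => // i _.
by rewrite -[X in measurable X]setTI; exact: measurable_coord.
Qed.

Lemma lebrVSE n (A : set 'rV[R]_n.+1) : lebrV A =
  (lebesgue_rV R n \x leb)%E ((fun p => cons_rV p.2 p.1) @^-1` A).
Proof. by []. Qed.

Lemma lebrV_cube n (r : R) : 0 < r ->
  lebrV (cube n r) = ((r *+ 2) ^+ n)%:E.
Proof.
move=> r0; elim: n => [|n IH].
  rewrite expr0 /lebrV/= diracE; apply/eqP; rewrite eqe.
  by rewrite (_ : _ \in _)//; apply/mem_set => -[].
rewrite lebrVSE (_ : _ @^-1` _ = cube n r `*` `]- r, r[%classic); last first.
  apply/seteqP; split => -[u t]/=; rewrite in_itv/= -ltr_norml.
    by move/cons_rV_cube => [].
  by case=> ? ?; exact/cons_rV_cube.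
transitivity (lebesgue_rV R n (cube n r) * leb (`]- r, r[%classic)%R)%E.
  by apply: product_measure1E => //; exact: measurable_cube.
rewrite lebesgue_measure_itv/= lte_fin gtrN// -EFinB opprK.
have -> : lebesgue_rV R n (cube n r) = ((r *+ 2) ^+ n)%:E by exact: IH.
by rewrite -EFinM mulr2n exprSr.
Qed.

Lemma cube_nat_cover n : \bigcup_k @cube R n k.+1%:R = [set: 'rV[R]_n].
Proof.
apply/seteqP; split => // u _.
exists (Num.truncn (\sum_i `|u ord0 i|)) => // i.
apply: le_lt_trans (truncnS_gt _).
by rewrite (bigD1 i)//= lerDl sumr_ge0.
Qed.

Let lebrV_sigma_finite n : sigma_finite [set: 'rV[R]_n] (@lebrV R n).
Proof.
exists (fun k => cube n k.+1%:R); first by rewrite cube_nat_cover.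
move=> k; split; first exact: measurable_cube.
by rewrite lebrV_cube// ltry.
Qed.

HB.instance Definition _ n :=
  Measure_isSigmaFinite.Build _ _ _ (@lebrV R n) (lebrV_sigma_finite n).

Lemma measurable_cons_pair n :
  measurable_fun [set: 'rV[R]_n * R] (fun p => cons_rV p.2 p.1).
Proof. exact: measurable_cons_rV. Qed.

Let lebrVS_prod n (f : 'rV[R]_n.+1 -> \bar R) :
  measurable_fun [set: 'rV[R]_n.+1] f -> (forall z, 0 <= f z)%E ->
  (\int[@lebrV R n.+1]_z f z =
   \int[@lebrV R n \x leb]_p f (cons_rV p.2 p.1))%E.
Proof.
move=> mf f0.
transitivity (\int[image_measure (@lebrV R n \x leb)%E
    (@measurable_snd_cons_fst R n)]_z f z)%E.
  by apply: eq_measure_integral.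
by rewrite ge0_integral_pushforward//; exact: measurable_snd_cons_fst.
Qed.

Lemma measurable_comp_cons n (f : 'rV[R]_n.+1 -> \bar R) :
  measurable_fun [set: 'rV[R]_n.+1] f ->
  measurable_fun [set: 'rV[R]_n * R] (fun p => f (cons_rV p.2 p.1)).
Proof. by move=> mf; apply: measurableT_comp => //; exact: measurable_cons_pair. Qed.

Lemma ge0_integral_lebrVS n (f : 'rV[R]_n.+1 -> \bar R) :
  measurable_fun [set: 'rV[R]_n.+1] f -> (forall z, 0 <= f z)%E ->
  (\int[@lebrV R n.+1]_z f z =
   \int[@lebrV R n]_u \int[leb]_t f (cons_rV t u))%E.
Proof.
move=> mf f0; rewrite lebrVS_prod// fubini_tonelli1//.
exact: measurable_comp_cons.
Qed.

(** Induction on the dimension: coordinate 0 is integrated by the one-dimensional rule and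
    contributes one factor [a]. Translations ([a = 1]) serve for invariance under involutions,
    dilations ([b = 0]) for the cone formula. *)
Lemma ge0_integral_lebrV_affine n (a : R) (b : 'rV[R]_n)
    (f : 'rV[R]_n -> \bar R) : 0 < a ->
  measurable_fun [set: 'rV[R]_n] f -> (forall z, 0 <= f z)%E ->
  (\int[@lebrV R n]_u f u =
   (a ^+ n)%:E * \int[@lebrV R n]_u f (a *: u + b)%R)%E.
Proof.
move=> a0; elim: n b f => [|n IH] b f mf f0.
  rewrite expr0 mul1e; apply: eq_integral => u _.
  by congr f; apply/rowP => -[].
pose F u := (\int[leb]_t f (cons_rV t u))%E.
have mF : measurable_fun [set: 'rV[R]_n] F.
  apply: (measurable_fun_fubini_tonelli_F (m2 := leb)
    (fun p => f (cons_rV p.2 p.1))) => //.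
  exact: measurable_comp_cons.
have F0 u : (0 <= F u)%E by exact: integral_ge0.
have consD t u : a *: cons_rV t u + b =
    cons_rV (a * t + b ord0 ord0) (a *: u + \row_i b ord0 (lift ord0 i)).
  apply/rowP; apply: forall_ordS => [|i].
    by rewrite !mxE unlift_none.
  by rewrite !mxE liftK/= !mxE.
have maff : measurable_fun [set: 'rV[R]_n.+1] (fun u : 'rV[R]_n.+1 => a *: u + b).
  apply: measurable_fun_coordP => i; under eq_fun do rewrite !mxE.
  apply: measurable_funD => //; apply: measurable_funM => //.
  exact: measurable_coord.
rewrite ge0_integral_lebrVS// (IH (\row_i b ord0 (lift ord0 i)))//.
rewrite [in RHS]ge0_integral_lebrVS//; last exact: measurableT_comp.
rewrite exprSr EFinM -muleA; congr (_ * _)%E.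
rewrite -ge0_integralZl//; last 3 first.
- apply: (measurable_fun_fubini_tonelli_F (m2 := leb)
    (fun p => f (a *: cons_rV p.2 p.1 + b))) => //.
  by apply: (@measurable_comp_cons n (fun z => f (a *: z + b))); exact: measurableT_comp.
- by move=> u _; exact: integral_ge0.
- by rewrite lee_fin ltW.
apply: eq_integral => u _; rewrite /F (ge0_integral_affine (b ord0 ord0) a0)//.
  by congr (_ * _)%E; apply: eq_integral => t _; rewrite consD.
apply: measurableT_comp => //.
exact: measurable_cons_rV.
Qed.

End lebrV_theory.

(** * Lebesgue measure under linear involutions *)

Section lebrV_involution.
Context {R : realType} (n : nat) (S : 'M[R]_n).
Local Notation leb := (@lebrV R n).

Lemma measurable_mulmxr d (T : measurableType d) (f : T -> 'rV[R]_n) :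
  measurable_fun [set: T] f -> measurable_fun [set: T] (fun x => f x *m S).
Proof.
move=> mf; apply: measurable_fun_coordP => i; under eq_fun do rewrite mxE.
apply: measurable_sum => j; apply: measurable_funM => //.
exact: (measurableT_comp (measurable_coord j)).
Qed.

Lemma measurable_rVD d (T : measurableType d) (f g : T -> 'rV[R]_n) :
  measurable_fun [set: T] f -> measurable_fun [set: T] g ->
  measurable_fun [set: T] (fun x => f x + g x).
Proof.
move=> mf mg; apply: measurable_fun_coordP => i; under eq_fun do rewrite mxE.
by apply: measurable_funD; apply: (measurableT_comp (measurable_coord i)).
Qed.

Lemma measurable_rVN d (T : measurableType d) (f : T -> 'rV[R]_n) :
  measurable_fun [set: T] f -> measurable_fun [set: T] (fun x => - f x).
Proof.
move=> mf; apply: measurable_fun_coordP => i; under eq_fun do rewrite mxE.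
by apply: measurableT_comp => //; apply: (measurableT_comp (measurable_coord i)).
Qed.

Lemma ge0_integral_lebrV_shift (b : 'rV[R]_n) (f : 'rV[R]_n -> \bar R) :
  measurable_fun [set: 'rV[R]_n] f -> (forall z, 0 <= f z)%E ->
  (\int[leb]_u f (u + b)%R = \int[leb]_u f u)%E.
Proof.
move=> mf f0; rewrite [RHS](ge0_integral_lebrV_affine b ltr01)//.
by rewrite expr1n mul1e; apply: eq_integral => u _; rewrite scale1r.
Qed.

Hypothesis SS : S *m S = 1%:M.

(* Both sides equal [\int\int F (x S + y) G y dx dy], as in the proof that
   translation-invariant measures are proportional. *)
Let integral_mul_invariant (F G : 'rV[R]_n -> \bar R) :
  measurable_fun [set: 'rV[R]_n] F -> measurable_fun [set: 'rV[R]_n] G ->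
  (forall z, 0 <= F z)%E -> (forall z, 0 <= G z)%E ->
  (forall z, G (- z)%R = G z) ->
  ((\int[leb]_x F (x *m S)%R) * (\int[leb]_y G y) =
   (\int[leb]_y F y) * (\int[leb]_x G (x *m S)%R))%E.
Proof.
move=> mF mG F0 G0 Gsym.
have mS d (T : measurableType d) := @measurable_mulmxr d T.
have mT := mS _ _ id (@measurable_id _ _ _).
transitivity (\int[leb]_y \int[leb]_x (F (x *m S + y)%R * G y))%E.
  rewrite -ge0_integralZl//; last by exact: integral_ge0.
  apply: eq_integral => y _.
  rewrite [RHS]ge0_integralZr//; last first.
    by apply: measurableT_comp => //; exact: measurable_rVD.
  congr (_ * _)%E.
  rewrite -(ge0_integral_lebrV_shift (y *m S)) //; last exact: measurableT_comp.
  by apply: eq_integral => x _; rewrite mulmxDl -mulmxA SS mulmx1.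
rewrite -(fubini_tonelli (m1 := leb) (m2 := leb)
  (fun p => F (p.1 *m S + p.2)%R * G p.2)%E); last 2 first.
- apply: emeasurable_funM.
    by apply: measurableT_comp => //; apply: measurable_rVD => //; exact: mS.
  exact: measurableT_comp.
- by move=> p; exact: mule_ge0.
transitivity (\int[leb]_x \int[leb]_y (F y * G (y - x *m S)%R))%E.
  apply: eq_integral => x _ /=.
  rewrite -[RHS](ge0_integral_lebrV_shift (x *m S)); last 2 first.
  - apply: emeasurable_funM => //; apply: measurableT_comp => //.
    exact: measurable_rVD.
  - by move=> p; exact: mule_ge0.
  by apply: eq_integral => y _; rewrite addrK [(x *m S + y)%R]addrC.
rewrite (fubini_tonelli (m1 := leb) (m2 := leb)
  (fun p => F p.2 * G (p.2 - p.1 *m S)%R)%E); last 2 first.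
- apply: emeasurable_funM; first exact: measurableT_comp.
  apply: measurableT_comp => //; apply: measurable_rVD => //.
  by apply: measurable_rVN; exact: mS.
- by move=> p; exact: mule_ge0.
rewrite -ge0_integralZr//; last by exact: integral_ge0.
apply: eq_integral => y _ /=.
rewrite ge0_integralZl//; last first.
  apply: measurableT_comp => //; apply: measurable_rVD => //.
  by apply: measurable_rVN.
congr (_ * _)%E.
rewrite -(ge0_integral_lebrV_shift (y *m S)) //; last first.
  apply: measurableT_comp => //; apply: measurable_rVD => //.
  by apply: measurable_rVN.
apply: eq_integral => x _.
by rewrite mulmxDl -mulmxA SS mulmx1 opprD addrC subrK Gsym.
Qed.

(** Since [u = (u S) S], a bound on [u S] bounds [u]. This makes the preimage of the cube a set of
    finite measure. *)
Let preimage_cube_sub : exists2 C : R, 0 < C &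
  [set u : 'rV[R]_n | cube n 1 (u *m S)] `<=` cube n C.
Proof.
exists (1 + \sum_i \sum_j `|S i j|).
  by rewrite ltr_pwDl// sumr_ge0// => i _; rewrite sumr_ge0.
move=> u /= uS i; rewrite -[u]mulmx1 -SS mulmxA mxE.
apply: le_lt_trans (ler_norm_sum _ _ _) _.
apply: (@le_lt_trans _ _ (\sum_i \sum_j `|S i j|)); last by rewrite ltrDr.
apply: ler_sum => j _; rewrite normrM (bigD1 i)//=.
apply: (@le_trans _ _ (1 * `|S j i|)); last by rewrite mul1r lerDl sumr_ge0.
by rewrite ler_wpM2r// ltW.
Qed.

(** No determinant is computed. By proportionality, taking preimages multiplies all measures by one
    constant; taking the preimage of the unit cube twice gives the cube back, so the square of the
    constant is 1. The cube serves as the symmetric test set required by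
    [integral_mul_invariant]. *)
Lemma lebrV_involution (A : set 'rV[R]_n) : measurable A ->
  leb [set u | A (u *m S)] = leb A.
Proof.
have mT := measurable_mulmxr (@measurable_id _ 'rV[R]_n setT).
have mpre (B : set 'rV[R]_n) :
    measurable B -> measurable [set u : 'rV[R]_n | B (u *m S)].
  by move=> mB; rewrite -[X in measurable X]setTI; exact: mT.
have mc : measurable (cube n 1 : set 'rV[R]_n) by exact: measurable_cube.
have indE (B : set 'rV[R]_n) : measurable B ->
    (\int[leb]_u (\1_B u)%:E = leb B)%E.
  by move=> mB; rewrite integral_indic// setIT.
have key (B : set 'rV[R]_n) : measurable B ->
    (leb [set u | B (u *m S)] * leb (cube n 1) =
     leb B * leb [set u | cube n 1 (u *m S)])%E.
  move=> mB; rewrite -!indE//; try exact: mpre.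
  apply: (@integral_mul_invariant (fun u => (\1_B u)%:E)
    (fun u => (\1_(cube n 1) u)%:E)) => //.
  - exact/measurable_EFinP/measurable_indic.
  - exact/measurable_EFinP/measurable_indic.
  - move=> z; congr (_%:E); rewrite !indicE; congr ((nat_of_bool _)%:R).
    apply/idP/idP => /set_mem zc; apply/mem_set => i.
      by have := zc i; rewrite mxE normrN.
    by rewrite mxE normrN; exact: zc.
have [C C0 sub] := preimage_cube_sub.
have bfin : leb [set u | cube n 1 (u *m S)] \is a fin_num.
  rewrite ge0_fin_numE//; apply: le_lt_trans (_ : leb (cube n C) < +oo)%E.
    by apply: le_measure => //; rewrite inE; [exact: mpre|exact: measurable_cube].
  by rewrite lebrV_cube// ltry.
move=> mA; have := key _ mA; have := key _ (mpre _ mc).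
rewrite (_ : [set u | [set v | cube n 1 (v *m S)] (u *m S)] = cube n 1); last first.
  by apply/seteqP; split => u /=; rewrite -mulmxA SS mulmx1.
rewrite lebrV_cube// -(fineK bfin).
set c : R := _ ^+ n; set b := fine _; have c0 : 0 < c by rewrite exprn_gt0.
have b0 : 0 <= b by exact: fine_ge0.
rewrite -!EFinM => -[/eqP]; rewrite -!expr2 eqrXn2 ?(ltW c0)// => /eqP <-.
by move/(congr1 (fun e => e * (c^-1)%:E)%E); rewrite -!muleA -!EFinM mulfV ?gt_eqF// !mule1.
Qed.

End lebrV_involution.

(** * Substitution along vertical lines *)

Section density_measure.
Context d (T : measurableType d) (R : realType).
Variables (m : {measure set T -> \bar R}) (w : T -> \bar R).

(** The two proofs are arguments so that the measure structure can be inferred from the term. *)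
Definition density_measure of measurable_fun [set: T] w &
  (forall x, 0 <= w x)%E := fun A => (\int[m]_(x in A) w x)%E.

Hypotheses (mw : measurable_fun [set: T] w) (w0 : (forall x, 0 <= w x)%E).

Let density_measure0 : density_measure mw w0 set0 = 0%E.
Proof. by rewrite /density_measure integral_set0. Qed.

Let density_measure_ge0 A : (0 <= density_measure mw w0 A)%E.
Proof. exact: integral_ge0. Qed.

Let density_measure_sigma_additive : semi_sigma_additive (density_measure mw w0).
Proof. exact: semi_sigma_additive_nng_induced. Qed.

HB.instance Definition _ := isMeasure.Build _ _ _ (density_measure mw w0)
  density_measure0 density_measure_ge0 density_measure_sigma_additive.

End density_measure.

Section lebesgue_radial.
Context {R : realType}.
Local Notation leb := (@lebesgue_measure R).

(** Agreement is known only on intervals staying strictly to the right of [tau]. Hence the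
    half-lines starting at [tau + 1 / (k + 1)] are treated separately, and continuity along
    increasing sets finishes the proof. *)
Lemma lebesgue_measure_unique_gt
    (m : {measure set (measurableTypeR R) -> \bar R}) (tau : R) :
  (forall a b, tau < a -> a < b ->
    leb (`]a, b]%classic)%R = m (`]a, b]%classic)%R) ->
  forall S : set R, measurable S -> S `<=` `]tau, +oo[%classic ->
  leb S = m S.
Proof.
move=> H S mS Stau.
pose I k := (`]tau + k.+1%:R^-1, +oo[%classic : set R).
pose J k := (`]-oo, tau + k.+1%:R^-1]%classic : set R).
have mI k : measurable (I k) by exact: measurable_itv.
have mJ k : measurable (J k) by exact: measurable_itv.
have IJ0 k : I k `&` J k = set0.
  apply/seteqP; split => // t []; rewrite /I /J/= !in_itv/= andbT.
  by move=> /lt_le_trans h /h; rewrite ltxx.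
have split_IJ (m' : {measure set (measurableTypeR R) -> \bar R}) k (X : set R) : measurable X ->
    m' X = (m' (X `&` I k) + m' (X `&` J k))%E.
  move=> mX.
  have mXI : measurable (X `&` I k) by exact: measurableI.
  have mXJ : measurable (X `&` J k) by exact: measurableI.
  rewrite -measureU//.
    rewrite -setIUr (_ : I k `|` J k = setT) ?setIT//.
    apply/seteqP; split => // t _.
    case: (ltP (tau + k.+1%:R^-1) t) => h; [left|right].
      by rewrite /I/= in_itv/= h.
    by rewrite /J/= in_itv/=.
  by rewrite setIACA IJ0 setI0.
have step k X : measurable (X : set R) -> leb (X `&` I k) = m (X `&` I k).
  (* This measure is [m] on [I k] and Lebesgue measure on the complement, so it has the right value
     on every half-open interval. *)
  pose mk := [the measure _ _ of measure_add
    [the measure _ _ of mrestr m (mI k)] [the measure _ _ of mrestr leb (mJ k)]].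
  have E Y : mk Y = (m (Y `&` I k) + leb (Y `&` J k))%E.
    exact: measure_addE.
  move=> mX; suff : leb (X `&` I k) = mk (X `&` I k).
    by rewrite E -!setIA setIid IJ0 setI0 measure0 adde0.
  have mXI : measurable (X `&` I k) by exact: measurableI.
  apply: lebesgue_measure_unique => //.
  move=> _ [[a b]] _ <-; rewrite E (split_IJ leb k)//=; congr (_ + _)%E.
  have -> : `]a, b] `&` I k = `]Num.max a (tau + k.+1%:R^-1), b]%classic.
    apply/seteqP; split => t; rewrite /I/= !in_itv/= andbT gt_max.
      by move=> [/andP[-> ->] ->].
    by move=> /andP[/andP[-> ->] ->].
  case: (ltP (Num.max a (tau + k.+1%:R^-1)) b) => h.
    by apply: H => //; rewrite lt_max ltrDl invr_gt0 ltr0Sn orbT.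
  rewrite (_ : `]_, b]%classic = set0) ?measure0//.
  apply/seteqP; split => // t /=; rewrite in_itv/= => /andP[h1 h2].
  by have := lt_le_trans h1 (le_trans h2 h); rewrite ltxx.
have SE : S = \bigcup_k (S `&` I k).
  rewrite -setI_bigcupr; apply/esym/setIidPl => t /Stau; rewrite /= in_itv/= andbT => tt.
  exists (Num.truncn ((t - tau)^-1)) => //.
  rewrite /I/= in_itv/= andbT -ltrBrDl invf_plt ?posrE ?subr_gt0//.
  exact: truncnS_gt.
have mSI k : measurable (S `&` I k) by exact: measurableI.
have cv (m' : {measure set (measurableTypeR R) -> \bar R}) :
    m' (S `&` I k) @[k --> \oo] --> m' S.
  rewrite [in X in _ --> X]SE; apply: nondecreasing_cvg_mu.
  - exact: mSI.
  - by rewrite -SE.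
  - move=> k l kl; apply/subsetPset => t [St] /=; rewrite /I/= !in_itv/= !andbT => h.
    split=> //; apply: le_lt_trans h.
    by rewrite lerD2l lef_pV2 ?posrE ?ltr0Sn// ler_nat ltnS.
have cv_leb : leb (S `&` I k) @[k --> \oo] --> m S.
  have -> : (fun k => leb (S `&` I k)) = (fun k => m (S `&` I k)).
    by apply/funext => k; exact: step.
  exact: cv.
exact: (cvg_unique (@ereal_hausdorff R) (cv leb) cv_leb).
Qed.

(** For [k = c |u|^2], the height [t >= 0] at which the ambient form of [(t, u)] equals [r ^+ 2],
    whenever [k <= r ^+ 2]. *)
Definition radial (k r : R) : R := Num.sqrt (r ^+ 2 - k).

Definition radial_dom (k r : R) : bool := (0 < r) && (k < r ^+ 2).

(* The derivative of [radial k]. *)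
Definition radial_weight (k r : R) : R :=
  if radial_dom k r then r / radial k r else 0.

Lemma radial_weight_ge0 k r : 0 <= radial_weight k r.
Proof.
rewrite /radial_weight; case: ifPn => // /andP[r0 _].
by rewrite divr_ge0 ?sqrtr_ge0// ltW.
Qed.

Lemma measurable_sqrtr : measurable_fun [set: R] (@Num.sqrt R).
Proof. by apply: continuous_measurable_fun; exact: sqrt_continuous. Qed.

Lemma measurable_radial2 :
  measurable_fun [set: R * R] (fun p => radial p.1 p.2).
Proof.
apply: (measurableT_comp measurable_sqrtr).
by apply: measurable_funB => //; apply: measurable_funX.
Qed.

Lemma measurable_radial_dom2 :
  measurable_fun [set: R * R] (fun p => radial_dom p.1 p.2).
Proof.
apply: measurable_and; first exact: measurable_fun_ltr.
by apply: measurable_fun_ltr => //; apply: measurable_funX.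
Qed.

Lemma measurable_radial_weight2 :
  measurable_fun [set: R * R] (fun p => radial_weight p.1 p.2).
Proof.
apply: measurable_fun_ifT => //; first exact: measurable_radial_dom2.
apply: measurable_funM => //.
exact: (measurableT_comp measurable_invr measurable_radial2).
Qed.

Lemma measurable_radial1 k : measurable_fun [set: R] (radial k).
Proof. exact: (measurableT_comp measurable_radial2 (pair1_measurable k)). Qed.

Lemma measurable_radial_weight k : measurable_fun [set: R] (EFin \o radial_weight k).
Proof.
apply/measurable_EFinP.
exact: (measurableT_comp measurable_radial_weight2 (pair1_measurable k)).
Qed.

Let is_derive_radial (k r : R) : k < r ^+ 2 ->
  is_derive r 1 (radial k) (r / radial k r).
Proof.
move=> kr; have p : 0 < r ^+ 2 - k by rewrite subr_gt0.
have H := is_derive1_sqrt p.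
have H1 : is_derive r 1 (fun r : R => r ^+ 2 - k) (2 * r).
  have -> : (fun r : R => r ^+ 2 - k) = (@id R) ^+ 2 - cst k.
    by apply/funext => x; rewrite !fctE expr2.
  apply: is_derive_eq.
  by rewrite /GRing.scale/= mulr1 expr1 subr0.
rewrite -[radial k]/(@Num.sqrt R \o (fun r : R => r ^+ 2 - k)).
have H2 := @is_derive1_comp _ (@Num.sqrt R) (fun r : R => r ^+ 2 - k) _ _ _ H H1.
apply: (is_derive_eq H2).
have s0 : Num.sqrt (r ^+ 2 - k) != 0 by rewrite gt_eqF// sqrtr_gt0.
by rewrite /radial/=; move: s0; set s := Num.sqrt _ => s0; field.
Qed.

Let integral_radial_weight k a b : 0 < a -> k < a ^+ 2 -> a < b ->
  (\int[leb]_(r in `]a, b]) (radial_weight k r)%:E =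
   (radial k b - radial k a)%:E)%E.
Proof.
move=> a0 ka ab.
have dom r : a <= r -> k < r ^+ 2.
  by move=> ar; apply: lt_le_trans ka _; rewrite lerXn2r// nnegrE ltW// (lt_le_trans a0).
have dr r : a <= r -> is_derive r 1 (radial k) (r / radial k r).
  by move=> ar; apply: is_derive_radial; exact: dom.
have cont r : a <= r -> {for r, continuous (radial k)}.
  by move=> /dr [? _]; apply/differentiable_continuous/derivable1_diffP.
have rpos r : a <= r -> 0 < radial k r.
  by move=> ar; rewrite sqrtr_gt0 subr_gt0 dom.
rewrite integral_itv_obnd_cbnd; last first.
  by apply: measurable_funTS; exact: measurable_radial_weight.
rewrite -[RHS]/((radial k b)%:E - (radial k a)%:E)%E.
rewrite -(@continuous_FTC2 _ (fun r => r / radial k r) (radial k))//.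
- apply: eq_integral => r; rewrite inE/= in_itv/= => /andP[ar rb].
  by rewrite /radial_weight /radial_dom (lt_le_trans a0 ar) dom.
- apply: continuous_in_subspaceT => r; rewrite inE/= in_itv/= => /andP[ar rb].
  apply: cvgM; first exact: cvg_id.
  by apply: cvgV; [rewrite gt_eqF// rpos|exact: cont].
- split.
  + by move=> r; rewrite in_itv/= => /andP[/ltW/dr []].
  + by apply: cvg_at_right_filter; apply: cont.
  + by apply: cvg_at_left_filter; apply: cont; exact: ltW.
- move=> r; rewrite in_itv/= => /andP[/ltW ar _].
  by rewrite derive1E; have [_ ->] := dr r ar.
Qed.

(** The substitution [t = radial k r]. On half-open intervals it is the fundamental theorem of
    calculus; uniqueness of Lebesgue measure extends it to measurable sets. *)
Lemma lebesgue_radial k (S : set R) : measurable S ->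
  (forall t, S t -> 0 < t /\ 0 < t ^+ 2 + k) ->
  leb S = (\int[leb]_(r in radial k @^-1` S) (radial_weight k r)%:E)%E.
Proof.
move=> mS ST.
have w0 r : (0 <= (EFin \o radial_weight k) r)%E by rewrite lee_fin radial_weight_ge0.
pose psi : measurableTypeR R -> measurableTypeR R := radial k.
have mpsi : measurable_fun [set: measurableTypeR R] psi.
  exact: measurable_radial1.
pose m := [the measure _ _ of image_measure
  [the measure _ _ of density_measure leb (measurable_radial_weight k) w0]
  mpsi].
(* [Num.sqrt] is 0 on negative reals, so this is the left end of the admissible heights for either
   sign of [k]. *)
pose tau := Num.sqrt (- k).
have tauP t : tau < t <-> 0 < t /\ 0 < t ^+ 2 + k.
  split=> [h|[t0 h]].
    have t0 : 0 < t by apply: le_lt_trans h; exact: sqrtr_ge0.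
    split=> //; rewrite -(opprK k) subr_gt0.
    by move: h; rewrite /tau -{1}(gtr0_norm t0) -sqrtr_sqr ltr_sqrt// exprn_gt0.
  by rewrite /tau -(gtr0_norm t0) -sqrtr_sqr ltr_sqrt ?exprn_gt0// -subr_gt0 opprK.
transitivity (m S); last by [].
apply: (@lebesgue_measure_unique_gt m tau) => //; last first.
  by move=> t /ST /tauP; rewrite /= in_itv/= andbT.
move=> a b tau_a ab; rewrite /m/= /image_measure/= /pushforward/= /density_measure.
have [a0 ka] := (tauP a).1 tau_a.
have [b0 kb] := (tauP b).1 (lt_trans tau_a ab).
pose phi t := Num.sqrt (t ^+ 2 + k).
have phiK t : 0 < t -> 0 < t ^+ 2 + k -> radial k (phi t) = t.
  move=> t0 kt; rewrite /radial sqr_sqrtr ?ltW// addrK sqrtr_sqr gtr0_norm//.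
rewrite lebesgue_measure_itv/= lte_fin ab -EFinB -[in LHS](phiK a)// -[in LHS](phiK b)//.
rewrite -integral_radial_weight ?sqrtr_gt0//; last 2 first.
- by rewrite sqr_sqrtr ?ltW// ltrDr exprn_gt0.
- by rewrite ltr_sqrt// ltrD2r ltrXn2r// ?nnegrE ?ltW.
rewrite integral_mkcond [RHS]integral_mkcond; apply: eq_integral => r _.
rewrite !patchE; have [/andP[r0 kr]|rdom] := boolP (radial_dom k r); last first.
  by do 2 case: ifPn => _ //=; rewrite /radial_weight (negbTE rdom).
congr (if _ then _ else _).
apply/idP/idP => /set_mem; rewrite /= !in_itv/= => /andP[h1 h2]; apply/mem_set; rewrite /= in_itv/=.
  apply/andP; split.
    rewrite -(phiK a)//; rewrite /radial ltr_sqrt ?subr_gt0// ltrD2r.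
    by rewrite ltrXn2r// ?nnegrE ?sqrtr_ge0 ?ltW.
  rewrite -(phiK b)// /radial ler_wsqrtr// lerD2r.
  by rewrite lerXn2r// ?nnegrE ?sqrtr_ge0// ltW.
have rr : 0 < r ^+ 2 - k by rewrite subr_gt0.
apply/andP; split.
  move: h1; rewrite -{1}(phiK a)// /radial ltr_sqrt// ltrD2r.
  by rewrite ltr_pXn2r ?nnegrE ?sqrtr_ge0 ?(ltW r0).
move: h2; rewrite -{1}(phiK b)// /radial ler_sqrt; last first.
  by rewrite subr_ge0 sqr_sqrtr ?(ltW kb)// lerDr exprn_ge0// ltW.
by rewrite lerD2r ler_pXn2r ?nnegrE ?sqrtr_ge0 ?(ltW r0).
Qed.

End lebesgue_radial.

(** The products [L *m B] and [B *m L] have the same determinant and are both block upper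
    triangular; the first exhibits the left side, the second the right side. *)
Lemma det_add1_rank1 (R : comNzRingType) n (u : 'cV[R]_n) (v : 'rV[R]_n) :
  \det (1%:M + u *m v) = 1 + (v *m u) ord0 ord0.
Proof.
pose L : 'M[R]_(1 + n) := block_mx 1%:M 0 (- u) 1%:M.
pose B : 'M[R]_(1 + n) := block_mx 1%:M (- v) u 1%:M.
have detL : \det L = 1 by rewrite det_lblock !det1 mulr1.
have -> : \det (1%:M + u *m v) = \det (L *m B).
  rewrite mulmx_block !mul1mx !mul0mx !addr0 mulmx1 addNr.
  by rewrite mulNmx mulmxN opprK addrC det_ublock det1 mul1r.
rewrite det_mulmx mulrC -det_mulmx mulmx_block !mul1mx !mulmx1 !mulmx0 !add0r.
rewrite mulNmx mulmxN opprK addrN det_ublock det1 mulr1 det_mx11.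
by rewrite !mxE eqxx.
Qed.

(** * The Riemannian measure as a cone measure *)

Section volume_density.
Context {R : realType} (M : space_form) {n : nat}.
Local Notation c := (@curvature R M).

(** The metric tensor is a rank one perturbation of the identity with determinant
    [1 / (1 - c |u|^2)]. Its root is the weight of the radial substitution at [r = 1], which is what
    links charts to cones. *)
Lemma volume_densityE (u : 'rV[R]_n) : volume_density M u =
  (radial_weight (c * dotmul u u) 1)%:E.
Proof.
rewrite /volume_density /radial_weight /radial_dom /radial patchE ltr01 expr1n/=.
rewrite -subr_gt0; case: ifPn => [/set_mem|/negP h]; last first.
  by case: ifPn => // h'; exfalso; apply: h; apply/mem_set.
rewrite /chart_domain/= => p; rewrite p; congr EFin.
rewrite /metric_tensor; set q := 1 - _ in p *.
rewrite scalemxAl det_add1_rank1.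
have -> : (u *m ((c / q) *: u^T)) ord0 ord0 = c / q * dotmul u u.
  by rewrite -scalemxAr mxE; congr (_ * _); rewrite mxE; apply: eq_bigr => i _; rewrite mxE.
have -> : 1 + c / q * dotmul u u = q^-1.
  have q0 : q != 0 by rewrite gt_eqF.
  have qD : c * dotmul u u = 1 - q by rewrite /q; ring.
  by rewrite mulrAC qD; field.
by rewrite sqrtrV ?ltW// div1r.
Qed.

End volume_density.

Section cone.
Context {R : realType} (M : space_form) {n : nat}.
Local Notation c := (@curvature R M).
Local Notation leb1 := (@lebesgue_measure R).
Local Notation q := (fun z : 'rV[R]_n.+1 => ambient_form M z z).

Lemma ambient_form_cons (t : R) (u : 'rV[R]_n) :
  ambient_form M (cons_rV t u) (cons_rV t u) = t ^+ 2 + c * dotmul u u.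
Proof.
rewrite /ambient_form cons_rV_at0; congr (_ + _ * _).
by apply: eq_bigr => i _; rewrite cons_rV_lift.
Qed.

Definition normalize (z : 'rV[R]_n.+1) := (Num.sqrt (q z))^-1 *: z.

(** The truncated solid cone over the part of [A] seen by one chart; the sign [e] selects the
    chart. *)
Definition half_cone (e : R) (A : set 'rV[R]_n.+1) : set 'rV[R]_n.+1 :=
  [set z | [/\ 0 < q z, q z <= 1, 0 < e * z ord0 ord0 & A (normalize z)]].

Lemma measurable_dotmul d (T : measurableType d) k (f g : T -> 'rV[R]_k) :
  measurable_fun [set: T] f -> measurable_fun [set: T] g ->
  measurable_fun [set: T] (fun x => dotmul (f x) (g x)).
Proof.
move=> mf mg; apply: measurable_sum => i; apply: measurable_funM;
  exact: (measurableT_comp (measurable_coord _)).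
Qed.

Lemma measurable_ambient_form d (T : measurableType d) (f g : T -> 'rV[R]_n.+1) :
  measurable_fun [set: T] f -> measurable_fun [set: T] g ->
  measurable_fun [set: T] (fun x => ambient_form M (f x) (g x)).
Proof.
move=> mf mg; have mc i h (mh : measurable_fun [set: T] h) :=
  measurableT_comp (@measurable_coord R n.+1 i) mh.
apply: measurable_funD; first by apply: measurable_funM; exact: mc.
apply: measurable_funM => //.
apply: measurable_sum => i; apply: measurable_funM; exact: mc.
Qed.

Lemma measurable_rVZ d (T : measurableType d) k (a : T -> R) (f : T -> 'rV[R]_k) :
  measurable_fun [set: T] a -> measurable_fun [set: T] f ->
  measurable_fun [set: T] (fun x => a x *: f x).
Proof.
move=> ma mf; apply: measurable_fun_coordP => i; under eq_fun do rewrite mxE.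
by apply: measurable_funM => //; apply: (measurableT_comp (measurable_coord i)).
Qed.

Lemma measurable_normalize : measurable_fun [set: 'rV[R]_n.+1] normalize.
Proof.
apply: measurable_rVZ => //; apply: (measurableT_comp measurable_invr).
apply: (measurableT_comp measurable_sqrtr).
exact: measurable_ambient_form.
Qed.

Lemma measurable_half_cone e A : measurable A -> measurable (half_cone e A).
Proof.
move=> mA.
have mq : measurable_fun [set: 'rV[R]_n.+1] q by exact: measurable_ambient_form.
have -> : half_cone e A = (q @^-1` `]0, 1]%classic) `&`
    ((fun z => e * z ord0 ord0) @^-1` `]0, +oo[%classic) `&` (normalize @^-1` A).
  apply/seteqP; split => z; rewrite /half_cone /= !in_itv/= andbT.
    by move=> [-> -> -> ?].
  by case=> -[/andP[-> ->] -> ?].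
apply: measurableI; last by rewrite -[X in measurable X]setTI; exact: measurable_normalize.
apply: measurableI; first by rewrite -[X in measurable X]setTI; exact: mq.
rewrite -[X in measurable X]setTI.
have mc : measurable_fun [set: 'rV[R]_n.+1] (fun z : 'rV[R]_n.+1 => e * z ord0 ord0).
  by apply: measurable_funM => //; exact: measurable_coord.
exact: mc.
Qed.

(** The indicator of the half cone along the vertical line over [u], after the substitution
    [t = radial k r]: the square root of the form is [r], so normalizing means dividing by [r]. *)
Let unit_integrand (e : R) (A : set 'rV[R]_n.+1) (r : R) (u : 'rV[R]_n) : \bar R :=
  ((radial_weight (c * dotmul u u) r * \1_(`]0, 1] : set R)%classic r) *
   \1_A (r^-1 *: cons_rV (e * radial (c * dotmul u u) r) u))%:E.

Let unit_integrand_ge0 e A r u : (0 <= unit_integrand e A r u)%E.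
Proof.
by rewrite lee_fin mulr_ge0 ?ler0n// mulr_ge0 ?radial_weight_ge0// indicE ler0n.
Qed.

Let measurable_unit_integrand e A : measurable A ->
  measurable_fun [set: 'rV[R]_n * R] (fun p => unit_integrand e A p.2 p.1).
Proof.
move=> mA; apply/measurable_EFinP.
have mk : measurable_fun [set: 'rV[R]_n * R] (fun p => (c * dotmul p.1 p.1, p.2)).
  apply: measurable_fun_pair => //=.
  by apply: measurable_funM => //; exact: measurable_dotmul.
apply: measurable_funM; first apply: measurable_funM.
- exact: (measurableT_comp measurable_radial_weight2 mk).
- exact: (measurableT_comp (measurable_indic (measurable_itv _)) measurable_snd).
- apply: (measurableT_comp (measurable_indic mA)).
  apply: measurable_rVZ; first exact: (measurableT_comp measurable_invr measurable_snd).
  apply: measurable_cons_rV => //; apply: measurable_funM => //.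
  exact: (measurableT_comp measurable_radial2 mk).
Qed.

Let half_cone_section e A u : e ^+ 2 = 1 -> measurable A ->
  leb1 [set t | half_cone e A (cons_rV t u)] =
  (\int[leb1]_r unit_integrand e A r u)%E.
Proof.
move=> e2 mA; set k := c * dotmul u u.
(* The section moved to positive heights: for [e = -1] it is the mirror image under [t |-> - t],
   which preserves Lebesgue measure. *)
pose S := [set t : R | half_cone 1 [set z | A (cons_rV (e * z ord0 ord0)
  (\row_i z ord0 (lift ord0 i)))] (cons_rV t u)].
have SE t : S t <-> [/\ 0 < t ^+ 2 + k, t ^+ 2 + k <= 1, 0 < t &
    A ((Num.sqrt (t ^+ 2 + k))^-1 *: cons_rV (e * t) u)].
  rewrite /S /half_cone /normalize/= ambient_form_cons cons_rV_at0 mul1r.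
  suff -> : cons_rV (e * ((Num.sqrt (t ^+ 2 + k))^-1 *: cons_rV t u) ord0 ord0)
      (\row_i ((Num.sqrt (t ^+ 2 + k))^-1 *: cons_rV t u) ord0 (lift ord0 i)) =
      (Num.sqrt (t ^+ 2 + k))^-1 *: cons_rV (e * t) u by [].
  apply/rowP; apply: forall_ordS => [|i].
    by rewrite cons_rV_at0 !mxE unlift_none/= mulrCA.
  by rewrite cons_rV_lift !mxE liftK.
have mS : measurable S.
  rewrite /S -[X in measurable X]setTI.
  apply: (measurable_cons_rV (@measurable_id _ R setT) (measurable_cst u)) => //.
  apply: measurable_half_cone; rewrite -[X in measurable X]setTI.
  suff : measurable_fun [set: 'rV[R]_n.+1] (fun z : 'rV[R]_n.+1 =>
    cons_rV (e * z ord0 ord0) (\row_i z ord0 (lift ord0 i))) by exact.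
  apply: measurable_cons_rV.
    by apply: measurable_funM => //; exact: measurable_coord.
  by apply: measurable_fun_coordP => i; under eq_fun do rewrite mxE; exact: measurable_coord.
have -> : leb1 [set t | half_cone e A (cons_rV t u)] = leb1 S.
  have HE t : half_cone e A (cons_rV t u) <-> S (e * t).
    rewrite SE /half_cone /normalize/= ambient_form_cons cons_rV_at0.
    by rewrite exprMn mulrA -expr2 e2 !mul1r.
  have [e1|e1] : e = 1 \/ e = -1.
    by move/eqP: e2; rewrite sqrf_eq1 => /orP[]/eqP; [left|right].
    congr (leb1 _); apply/seteqP; split => t /=; by rewrite HE e1 mul1r.
  rewrite -(lebesgue_measureN mS); congr (leb1 _).
  by apply/seteqP; split => t /=; rewrite HE e1 mulN1r.
rewrite (lebesgue_radial (k := k) mS) => [|t /SE[]//].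
rewrite integral_mkcond; apply: eq_integral => r _.
rewrite patchE /unit_integrand -/k.
have [dom|dom] := boolP (radial_dom k r); last first.
  by rewrite /radial_weight (negbTE dom) !mul0r; case: ifP.
have [r0 kr] := andP dom.
have r2 : radial k r ^+ 2 + k = r ^+ 2.
  by rewrite sqr_sqrtr ?subrK// subr_ge0 ltW.
have rS : radial k r \in S = (r \in (`]0, 1] : set R)%classic) &&
    (r^-1 *: cons_rV (e * radial k r) u \in A).
  apply/idP/andP => [/set_mem/SE|[/set_mem h1 /set_mem h2]].
    rewrite r2 sqrtr_sqr gtr0_norm// => -[_ r1 _ Ar].
    split; apply/mem_set => //=; rewrite in_itv/= r0/=.
    by rewrite -(@ler_pXn2r _ 2)// ?nnegrE ?ler01 ?(ltW r0)// expr1n.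
  apply/mem_set/SE; rewrite r2 sqrtr_sqr gtr0_norm//; split => //.
  - by rewrite exprn_gt0.
  - by move: h1; rewrite /= in_itv/= => /andP[_ r1]; rewrite exprn_ile1// (ltW r0).
  - by rewrite sqrtr_gt0 subr_gt0.
rewrite !indicE (_ : (r \in _) = (radial k r \in S)); last first.
  by apply/idP/idP => /set_mem h; apply/mem_set.
rewrite rS; case: (_ \in _) => /=; last by rewrite mulr0 mul0r.
by case: (_ \in A); rewrite !mulr1 ?mulr0.
Qed.

(** The radial factor left after dilating by [r]; its integral is the origin of the constant
    [1 / (n + 1)]. *)
Let unit_power (r : R) : R := \1_(`]0, 1] : set R)%classic r * r ^+ n.

Let integral_unit_power :
  (\int[leb1]_r (unit_power r)%:E = (n.+1%:R^-1)%:E)%E.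
Proof.
rewrite /unit_power.
transitivity (\int[leb1]_(r in (`]0%R, 1%R] : set R)%classic) (r ^+ n)%:E)%E.
  rewrite [RHS]integral_mkcond; apply: eq_integral => r _.
  by rewrite patchE indicE; case: ifPn => _; rewrite ?mul1r ?mul0r.
rewrite integral_itv_obnd_cbnd; last first.
  by apply/measurable_EFinP; exact: measurable_funX.
pose F (r : R) : R := n.+1%:R^-1 * r ^+ n.+1.
have dF (r : R) : is_derive r 1 F (r ^+ n).
  have -> : F = n.+1%:R^-1 *: ((@id R) ^+ n.+1).
    by apply/funext => x; rewrite /F !fctE.
  apply: is_derive_eq.
  by rewrite /GRing.scale/= mulr1 mulrA mulVf ?mul1r// pnatr_eq0.
have cF (r : R) : {for r, continuous F}.
  by have [? _] := dF r; apply/differentiable_continuous/derivable1_diffP.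
rewrite (@continuous_FTC2 _ _ F)//.
- by rewrite /F expr1n mulr1 expr0n/= mulr0 sube0.
- by apply: continuous_in_subspaceT => r _; exact: exprn_continuous.
- split.
  + by move=> r _; have [] := dF r.
  + by apply: cvg_at_right_filter; exact: cF.
  + by apply: cvg_at_left_filter; exact: cF.
- by move=> r _; rewrite derive1E; have [_ ->] := dF r.
Qed.

(** Fubini, the radial substitution on each vertical line, exchange of [u] and [r], and then the
    dilation [u = r v]. The weight is homogeneous of degree 0 and the point is divided by [r], so
    that the integrand splits into [r ^+ n] and the volume density at [v]. *)
Lemma lebrV_half_cone e A : e ^+ 2 = 1 -> measurable A ->
  lebrV (half_cone e A) =
  ((n.+1%:R^-1)%:E * chart_volume M (chart M e @^-1` A))%E.
Proof.
move=> e2 mA; have mH := measurable_half_cone e mA.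
rewrite -[LHS]mul1e -[LHS]mule1 mul1e.
have -> : (lebrV (half_cone e A) * 1 = \int[@lebrV R n.+1]_z (\1_(half_cone e A) z)%:E)%E.
  by rewrite mule1 integral_indic// setIT.
rewrite ge0_integral_lebrVS; last 2 first.
- exact/measurable_EFinP/measurable_indic.
- by move=> z; rewrite lee_fin indicE.
transitivity (\int[@lebrV R n]_u \int[leb1]_r unit_integrand e A r u)%E.
  apply: eq_integral => u _; rewrite -half_cone_section//.
  rewrite (_ : (fun t => _) = EFin \o \1_[set t | half_cone e A (cons_rV t u)]).
    rewrite integral_indic ?setIT//.
    rewrite -[X in measurable X]setTI.
    exact: (measurable_cons_rV (@measurable_id _ R setT) (measurable_cst u)).
  by apply/funext => t; rewrite /= !indicE; congr ((nat_of_bool _)%:R%:E).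
rewrite (fubini_tonelli (m1 := @lebrV R n) (m2 := leb1)
  (fun p => unit_integrand e A p.2 p.1)); last 2 first.
- exact: (measurable_unit_integrand e mA).
- by move=> p; exact: unit_integrand_ge0.
rewrite -integral_unit_power -ge0_integralZr//; last 2 first.
- apply/measurable_EFinP; apply: measurable_funM; last exact: measurable_funX.
  exact: measurable_indic.
- move=> r _; rewrite lee_fin /unit_power indicE; case: (boolP (r \in _)) => [/set_mem|_].
    by rewrite /= in_itv/= => /andP[r0 _]; rewrite mul1r exprn_ge0// ltW.
  by rewrite mul0r.
apply: eq_integral => r _ /=.
have [/set_mem|r01] := boolP (r \in (`]0, 1] : set R)%classic); last first.
  rewrite /unit_power indicE (negbTE r01) mul0r mul0e; apply: integral0_eq => u _.
  by rewrite /unit_integrand indicE (negbTE r01) mulr0 mul0r.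
rewrite /= in_itv/= => r01; have /andP[r0 r1] := r01.
have r01' : r \in (`]0, 1] : set R)%classic by apply/mem_set; rewrite /= in_itv.
rewrite /unit_power indicE r01' mul1r.
have mI : measurable_fun [set: 'rV[R]_n] (fun u => unit_integrand e A r u).
  exact: (measurableT_comp (measurable_unit_integrand e mA) (pair2_measurable r)).
rewrite (ge0_integral_lebrV_affine 0 r0)//; congr (_ * _)%E.
rewrite /chart_volume [RHS]integral_mkcond; apply: eq_integral => v _.
rewrite patchE addr0 /unit_integrand volume_densityE indicE r01' mulr1.
set k := c * dotmul v v.
have -> : c * dotmul (r *: v) (r *: v) = r ^+ 2 * k.
  rewrite /k mulrCA; congr (_ * _); rewrite /dotmul mulr_sumr.
  by apply: eq_bigr => i _; rewrite !mxE; ring.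
have rk : r ^+ 2 - r ^+ 2 * k = r ^+ 2 * (1 - k) by ring.
have wE : radial_weight (r ^+ 2 * k) r = radial_weight k 1.
  rewrite /radial_weight /radial_dom r0 ltr01 expr1n/= -[X in _ < X](mulr1 (r ^+ 2)).
  rewrite ltr_pM2l ?exprn_gt0//; case: ifP => // k1.
  rewrite /radial expr1n rk sqrtrM ?exprn_ge0 ?ltW//.
  by rewrite sqrtr_sqr gtr0_norm// invfM mulrA mulfV ?gt_eqF.
have chE : r^-1 *: cons_rV (e * radial (r ^+ 2 * k) r) (r *: v) = chart M e v.
  rewrite /chart /radial rk sqrtrM ?exprn_ge0 ?ltW//.
  rewrite sqrtr_sqr gtr0_norm//; apply/rowP; apply: forall_ordS => [|i].
    rewrite !mxE unlift_none/= -/k; set s := Num.sqrt _.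
    by field; rewrite gt_eqF.
  by rewrite !mxE liftK/= mxE mulrA mulVf ?gt_eqF// mul1r.
rewrite wE chE indicE (_ : (chart M e v \in A) = (v \in chart M e @^-1` A)).
  by case: ifP => _; rewrite ?mulr1 ?mulr0.
by apply/idP/idP => /set_mem h; apply/mem_set.
Qed.

End cone.

(** The pairs [(C, - B)] and [(B, - A)] give [C] and [A] times the discriminant; when both
    coefficients vanish, [(1, 1)] and [(1, - 1)] force [B = 0]. Every Cauchy-Schwarz inequality of
    the development comes from here. *)
Lemma psd_discriminant (R : realFieldType) (A B C : R) :
  (forall s t, 0 <= s ^+ 2 * A + 2 * s * t * B + t ^+ 2 * C) -> B ^+ 2 <= A * C.
Proof.
move=> H.
have A0 := H 1 0; have C0 := H 0 1; have H1 := H C (- B); have H2 := H B (- A).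
have Hp := H 1 1; have Hm := H 1 (- 1).
have {}A0 : 0 <= A by lra.
have {}C0 : 0 <= C by lra.
have {}H2 : 0 <= A * (A * C - B ^+ 2) by lra.
have {}H1 : 0 <= C * (A * C - B ^+ 2) by lra.
rewrite -subr_ge0.
have [A1|A1] := ltP 0 A; first by rewrite pmulr_rge0 in H2.
have [C1|C1] := ltP 0 C; first by rewrite pmulr_rge0 in H1.
have -> : A = 0 by lra.
have -> : C = 0 by lra.
have -> : B = 0 by lra.
by rewrite mul0r expr0n/= subr0.
Qed.

(** * Distances and reflections *)

Section geometry.
Context {R : realType} (M : space_form) {n : nat}.
Local Notation c := (@curvature R M).
Local Notation P := (@space_points R M n).
Local Notation b := (@ambient_form R M n).
Local Notation d := (@gdist R M n).
Implicit Types x y z w v : 'rV[R]_n.+1.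

Lemma curvature_sqr : c * c = 1.
Proof. by rewrite /curvature; case: M; ring. Qed.

Lemma curvature_norm : `|c| = 1.
Proof. by rewrite /curvature; case: M; rewrite ?normrN1 ?normr1. Qed.

Lemma formC x y : b x y = b y x.
Proof.
rewrite /ambient_form mulrC; congr (_ + _ * _).
by apply: eq_bigr => i _; rewrite mulrC.
Qed.

Lemma formDl x y z : b (x + y) z = b x z + b y z.
Proof.
rewrite /ambient_form mxE.
rewrite (eq_bigr (fun i => x ord0 (lift ord0 i) * z ord0 (lift ord0 i) +
  y ord0 (lift ord0 i) * z ord0 (lift ord0 i))); last by move=> i _; rewrite mxE mulrDl.
by rewrite big_split/=; ring.
Qed.

Lemma formZl a x z : b (a *: x) z = a * b x z.
Proof.
rewrite /ambient_form mxE.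
rewrite (eq_bigr (fun i => a * (x ord0 (lift ord0 i) * z ord0 (lift ord0 i)))).
  by rewrite -mulr_sumr; ring.
by move=> i _; rewrite mxE mulrA.
Qed.

Lemma formDr x y z : b z (x + y) = b z x + b z y.
Proof. by rewrite formC formDl !(formC _ z). Qed.

Lemma formZr a x z : b z (a *: x) = a * b z x.
Proof. by rewrite formC formZl formC. Qed.

Lemma formNl x z : b (- x) z = - b x z.
Proof. by rewrite -scaleN1r formZl mulN1r. Qed.

Lemma formNr x z : b z (- x) = - b z x.
Proof. by rewrite formC formNl formC. Qed.

Lemma formBl x y z : b (x - y) z = b x z - b y z.
Proof. by rewrite formDl formNl. Qed.

Lemma formBr x y z : b z (x - y) = b z x - b z y.
Proof. by rewrite formDr formNr. Qed.

Lemma points_form x : P x -> b x x = 1.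
Proof. by rewrite /space_points; case: M => //= -[]. Qed.

Local Notation dot x y := (\sum_(i < n) x ord0 (lift ord0 i) * y ord0 (lift ord0 i)).

Let dot_cs x y : (dot x y) ^+ 2 <= dot x x * dot y y.
Proof.
apply: psd_discriminant => s t.
have -> : s ^+ 2 * dot x x + 2 * s * t * dot x y + t ^+ 2 * dot y y =
    \sum_(i < n) (s * x ord0 (lift ord0 i) + t * y ord0 (lift ord0 i)) ^+ 2.
  rewrite 3!mulr_sumr -2!big_split; apply: eq_bigr => i _ /=; ring.
by apply: sumr_ge0 => i _; exact: sqr_ge0.
Qed.

Let dot_ge0 x : 0 <= dot x x.
Proof. by apply: sumr_ge0 => i _; exact: sqr_ge0. Qed.

Let dot_eq0 x : dot x x = 0 -> forall i, x ord0 (lift ord0 i) = 0.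
Proof.
move=> /eqP; rewrite psumr_eq0 => [/allP H i|i _]; last exact: sqr_ge0.
by have := H i (mem_index_enum i); rewrite /= mulf_eq0 orbb => /eqP.
Qed.

(** Obvious on the sphere. In the hyperbolic case orthogonality reads [S = v0 * y0], and
    Cauchy-Schwarz for the spatial parts, with [Y = y0 ^+ 2 - 1], shows that tangent vectors are
    spacelike. *)
Lemma tangent_psd y v : P y -> b v y = 0 -> 0 <= c * b v v.
Proof.
rewrite /space_points /ambient_form /curvature.
case: M => [_ _|[yy y0] vy] /=.
  by rewrite !mul1r addr_ge0// ?sqr_ge0// dot_ge0.
have := dot_cs v y; have := dot_ge0 v.
move: yy vy; set E := dot v v; set S := dot v y; set Y := dot y y.
set v0 := v ord0 ord0; move: y0; set y0 := y ord0 ord0 => y0p yy vy E0 SEY.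
have SE : S = v0 * y0 by lra.
have YE : Y = y0 ^+ 2 - 1 by lra.
move: SEY; rewrite SE YE => h.
suff : 0 <= (E - v0 ^+ 2) * y0 ^+ 2.
  by rewrite pmulr_lge0 ?exprn_gt0//; lra.
by move: h; rewrite exprMn; lra.
Qed.

Lemma tangent_definite y v : P y -> b v y = 0 -> b v v = 0 -> v = 0.
Proof.
move=> Py vy vv; suff [v0 v'] : v ord0 ord0 = 0 /\ dot v v = 0.
  by apply/rowP; apply: forall_ordS => [|i]; rewrite mxE//; exact: dot_eq0.
move: Py vy vv; rewrite /space_points /ambient_form /curvature.
have := dot_cs v y; have := dot_ge0 v.
case: M => [h1 h2 yy vy vv|] /=.
  have := sqr_ge0 (v ord0 ord0); rewrite expr2 => h; split; last by lra.
  by apply/eqP; rewrite -sqrf_eq0 expr2; apply/eqP; lra.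
set E := dot v v; set S := dot v y; set Y := dot y y.
set v0 := v ord0 ord0; set y0 := y ord0 ord0.
move=> E0 SEY [yy y0p] vy vv.
have SE : S = v0 * y0 by lra.
have YE : Y = y0 ^+ 2 - 1 by lra.
have EE : E = v0 ^+ 2 by lra.
have E00 : E = 0.
  apply/eqP; rewrite eq_le E0 andbT.
  by move: SEY; rewrite SE YE exprMn -EE mulrBr mulr1; lra.
by split=> //; apply/eqP; rewrite -sqrf_eq0 -EE; apply/eqP.
Qed.

(* The defect in the addition formula for [cos] or [cosh]. *)
Lemma form_gram x y z : P x -> P y -> P z ->
  (b x z - b x y * b y z) ^+ 2 <= (1 - b x y ^+ 2) * (1 - b y z ^+ 2).
Proof.
move=> Px Py Pz; have [xx yy zz] := And3 (points_form Px) (points_form Py) (points_form Pz).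
(* The components of [x] and [z] tangent at [y]; the claim is Cauchy-Schwarz for [c * b] on the
   tangent space. *)
pose x' := x - b x y *: y; pose z' := z - b y z *: y.
have ty s t : b (s *: x' + t *: z') y = 0.
  rewrite formDl !formZl /x' /z' !formBl !formZl yy (formC z y); ring.
have -> : b x z - b x y * b y z = b x' z'.
  rewrite /x' /z' formBl !formBr !formZl !formZr yy; ring.
have -> : 1 - b x y ^+ 2 = b x' x'.
  rewrite /x' formBl !formBr !formZl !formZr yy xx (formC y x); ring.
have -> : 1 - b y z ^+ 2 = b z' z'.
  rewrite /z' formBl !formBr !formZl !formZr yy zz (formC z y); ring.
suff : (c * b x' z') ^+ 2 <= (c * b x' x') * (c * b z' z').
  by rewrite exprMn [leRHS]mulrACA (expr2 c) curvature_sqr !mul1r.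
clearbody x' z'; apply: psd_discriminant => s t; have := tangent_psd Py (ty s t).
rewrite formDl !formDr !formZl !formZr (formC z' x'); congr (_ <= _); ring.
Qed.

Definition form_range (t : R) : Prop :=
  match M with Sphere => -1 <= t <= 1 | Hyperbolic => 1 <= t end.

Lemma form_rangeP x y : P x -> P y -> form_range (b x y).
Proof.
move=> Px Py; have [xx yy] := conj (points_form Px) (points_form Py).
have : 0 <= c * (1 - b x y ^+ 2).
  have -> : 1 - b x y ^+ 2 = b (x - b x y *: y) (x - b x y *: y).
    rewrite formBl !formBr !formZl !formZr yy xx (formC y x); ring.
  by apply: (tangent_psd Py); rewrite formBl formZl yy mulr1 subrr.
move: Px Py xx yy; rewrite /form_range /space_points /curvature.
case: M => [_ _ _ _|[_ x0] [_ y0]] /=.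
  rewrite mul1r subr_ge0 -[1 in X in X -> _](expr1n _ 2) => h.
  by rewrite -ler_norml -(@ler_pXn2r _ 2)// ?nnegrE// real_normK ?num_real.
rewrite /ambient_form /curvature; have := dot_cs x y.
have := dot_ge0 x; have := dot_ge0 y.
set X := dot x x; set S := dot x y; set Y := dot y y.
move: x0 y0; set x0 := x ord0 ord0; set y0 := y ord0 ord0.
move=> x0p y0p Y0 X0 SXY xx yy h.
(* Both points lie on the upper sheet, where spatial parts are shorter than heights. This excludes
   the branch [t <= - 1]. *)
have t0 : 0 < x0 * y0 - S.
  rewrite subr_gt0; apply: le_lt_trans (ler_norm _) _.
  rewrite -(@ltr_pXn2r _ 2)// ?nnegrE// ?mulr_ge0 ?ltW// real_normK ?num_real//.
  apply: le_lt_trans SXY _.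
  have -> : X = x0 ^+ 2 - 1 by lra.
  have YE : Y = y0 ^+ 2 - 1 by lra.
  by rewrite exprMn mulrBl mul1r YE; have := exprn_gt0 2 x0p; have := exprn_gt0 2 y0p; nra.
set t := x0 * y0 + -1 * S; have tp : 0 < t by rewrite /t; lra.
rewrite -(@ler_pXn2r _ 2)// ?nnegrE ?ler01 ?(ltW tp)// expr1n.
by move: h; rewrite -/t; lra.
Qed.

Lemma form_eq1 x y : P x -> P y -> b x y = 1 -> x = y.
Proof.
move=> Px Py xy; have [xx yy] := conj (points_form Px) (points_form Py).
apply/eqP; rewrite -subr_eq0; apply/eqP; apply: (tangent_definite Py).
  by rewrite formBl xy yy subrr.
by rewrite formBl !formBr xx yy (formC y x) xy subrr.
Qed.

Definition angle (t : R) : R :=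
  match M with Sphere => acos t | Hyperbolic => arcosh t end.

Lemma gdistE x y : d x y = angle (b x y).
Proof. by rewrite /gdist /angle; case: M. Qed.

Lemma form_range1 : form_range 1.
Proof. by rewrite /form_range; case: M; rewrite ?lexx// andbT; lra. Qed.

Let arcosh_lt (s t : R) : 1 <= s -> s < t -> arcosh s < arcosh t.
Proof.
move=> s1 st; rewrite /arcosh ltr_ln ?posrE.
- apply: ltr_leD => //; apply: ler_wsqrtr; rewrite lerD2r.
  by rewrite ler_pXn2r// ?nnegrE; lra.
- by apply: ltr_pwDl; [lra|exact: sqrtr_ge0].
- by apply: ltr_pwDl; [lra|exact: sqrtr_ge0].
Qed.

(** [acos] decreases and [arcosh] increases; the factor [c] absorbs the difference, so that
    distances can be compared through the form in both geometries at once. *)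
Lemma angle_lt s t : form_range s -> form_range t ->
  (angle s < angle t) = (c * t < c * s).
Proof.
rewrite /form_range /angle /curvature; case: M => hs ht.
  have [sa sE] := acos_def hs; have [ta tE] := acos_def ht.
  have := @ltr_cos R (acos s) (acos t).
  by rewrite !in_itv/= sa ta sE tE !mul1r => /(_ isT isT) ->.
rewrite !mulN1r ltrN2; apply/idP/idP; last exact: arcosh_lt.
move=> h; rewrite ltNge; apply/negP; rewrite le_eqVlt => /orP[/eqP E|/(arcosh_lt ht)].
  by move: h; rewrite E ltxx.
by move=> /(lt_trans h); rewrite ltxx.
Qed.

Lemma angle_le s t : form_range s -> form_range t ->
  (angle s <= angle t) = (c * t <= c * s).
Proof. by move=> hs ht; rewrite leNgt angle_lt// -leNgt. Qed.

Lemma angle1 : angle 1 = 0.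
Proof.
rewrite /angle; case: M; first exact: acos1.
by rewrite /arcosh expr1n subrr sqrtr0 addr0 ln1.
Qed.

Lemma form_range_le1 t : form_range t -> c * t <= c.
Proof. by rewrite /form_range /curvature; case: M; lra. Qed.

Lemma angle_ge0 t : form_range t -> 0 <= angle t.
Proof.
move=> ht; rewrite -angle1 angle_le ?mulr1//; last exact: form_range1.
exact: form_range_le1.
Qed.

Lemma gdistC x y : d x y = d y x.
Proof. by rewrite !gdistE formC. Qed.

Lemma gdist_ge0 x y : P x -> P y -> 0 <= d x y.
Proof. by move=> Px Py; rewrite gdistE angle_ge0//; exact: form_rangeP. Qed.

Lemma gdistxx x : P x -> d x x = 0.
Proof. by move=> Px; rewrite gdistE points_form// angle1. Qed.

Lemma gdist_gt0 x y : P x -> P y -> x <> y -> 0 < d x y.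
Proof.
move=> Px Py xy; rewrite gdistE -angle1 angle_lt.
- rewrite mulr1 lt_neqAle form_range_le1 ?andbT; last exact: form_rangeP.
  apply/eqP => h; apply: xy; apply: form_eq1 => //.
  by have := congr1 ( *%R c) h; rewrite mulrA curvature_sqr mul1r.
- exact: form_range1.
- exact: form_rangeP.
Qed.

Lemma gdist_le x y z w : P x -> P y -> P z -> P w ->
  (d x y <= d z w) = (c * b z w <= c * b x y).
Proof. by move=> *; rewrite !gdistE angle_le//; exact: form_rangeP. Qed.

(** The hypothesis bounds [t] by [A * B + p * r], which is the hyperbolic cosine of the sum on the
    right. *)
Let arcoshD (A B t : R) : 1 <= A -> 1 <= B -> 1 <= t ->
  (t - A * B) ^+ 2 <= (1 - A ^+ 2) * (1 - B ^+ 2) ->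
  arcosh t <= arcosh A + arcosh B.
Proof.
move=> A1 B1 t1 h; pose p := Num.sqrt (A ^+ 2 - 1); pose r := Num.sqrt (B ^+ 2 - 1).
have A2 : 0 <= A ^+ 2 - 1 by nra.
have B2 : 0 <= B ^+ 2 - 1 by nra.
have pE : p ^+ 2 = A ^+ 2 - 1 by rewrite sqr_sqrtr.
have rE : r ^+ 2 = B ^+ 2 - 1 by rewrite sqr_sqrtr.
have p0 : 0 <= p by exact: sqrtr_ge0.
have r0 : 0 <= r by exact: sqrtr_ge0.
have pr0 : 0 <= p * r by exact: mulr_ge0.
have tle : t <= A * B + p * r.
  rewrite -lerBlDl; apply: le_trans (ler_norm _) _.
  rewrite -(@ler_pXn2r _ 2)// ?nnegrE// real_normK ?num_real// exprMn pE rE.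
  by apply: le_trans h _; rewrite le_eqVlt; apply/orP; left; apply/eqP; ring.
have AB1 : 1 <= A * B by nra.
have -> : arcosh A + arcosh B = arcosh (A * B + p * r).
  rewrite /arcosh -/p -/r -lnM ?posrE; last 2 first.
    by apply: ltr_pwDl => //; lra.
    by apply: ltr_pwDl => //; lra.
  congr ln; have -> : (A * B + p * r) ^+ 2 - 1 = (A * r + B * p) ^+ 2.
    rewrite !sqrrD !exprMn pE rE; ring.
  rewrite sqrtr_sqr ger0_norm; first by ring.
  by apply: addr_ge0; apply: mulr_ge0 => //; lra.
move: tle; rewrite le_eqVlt => /orP[/eqP <-//|tle].
by apply: ltW; exact: arcosh_lt.
Qed.

Let acosD (A B t : R) : -1 <= A <= 1 -> -1 <= B <= 1 -> -1 <= t <= 1 ->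
  (t - A * B) ^+ 2 <= (1 - A ^+ 2) * (1 - B ^+ 2) ->
  acos t <= acos A + acos B.
Proof.
move=> hA hB ht h.
have [/andP[a0 api] cA] := acos_def hA; have [/andP[b0 bpi] cB] := acos_def hB.
have [/andP[t0 tpi] ct] := acos_def ht.
(* A sum of angles beyond [pi] needs no proof; below it, [cos] is decreasing. *)
have [abpi|/ltW abpi] := leP (acos A + acos B) pi; last exact: le_trans abpi.
rewrite leNgt; apply/negP => abt.
have : cos (acos t) < cos (acos A + acos B).
  by rewrite ltr_cos// in_itv/= ?t0// abpi addr_ge0.
apply/negP; rewrite -leNgt ct cosD cA cB !sin_acos//.
rewrite lerBlDr -lerBlDl; apply: le_trans (ler_norm _) _.
rewrite -(@ler_pXn2r _ 2)// ?nnegrE ?mulr_ge0 ?sqrtr_ge0// real_normK ?num_real//.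
have A2 : 0 <= 1 - A ^+ 2 by have /andP[? ?] := hA; nra.
have B2 : 0 <= 1 - B ^+ 2 by have /andP[? ?] := hB; nra.
rewrite exprMn !sqr_sqrtr//; apply: le_trans h.
by rewrite le_eqVlt; apply/orP; left; apply/eqP; ring.
Qed.

Lemma gdist_triangle x y z : P x -> P y -> P z -> d x z <= d x y + d y z.
Proof.
move=> Px Py Pz; have h := form_gram Px Py Pz; rewrite !gdistE.
have := form_rangeP Px Py; have := form_rangeP Py Pz; have := form_rangeP Px Pz.
by rewrite /form_range /angle; case: M h => *; [exact: acosD|exact: arcoshD].
Qed.

Let angle_small r : 0 < r ->
  exists2 e, 0 < e & forall t, form_range t -> `|t - 1| < e -> angle t < r.
Proof.
rewrite /form_range /angle => r0; case: M.
  pose s := Num.min r 1; have s0 : 0 < s by rewrite lt_min r0 ltr01.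
  have spi : s <= pi.
    by have := pi_ge2 R; have : s <= 1 by [rewrite ge_min lexx orbT]; lra.
  have cs1 : cos s < 1.
    by rewrite -[ltRHS]cos0 ltr_cos// in_itv/= ?lexx ?pi_ge0// spi (ltW s0).
  exists (1 - cos s) => [|t ht]; first by rewrite subr_gt0.
  rewrite distrC => /(le_lt_trans (ler_norm _)) h.
  apply: (@lt_le_trans _ _ s); last by rewrite /s ge_min lexx.
  have [tpi tc] := acos_def ht.
  have := @ltr_cos R (acos t) s.
  by rewrite !in_itv/= tpi tc (ltW s0) spi => /(_ isT isT) <-; lra.
(* The hyperbolic cosine of [r]. *)
pose s := (expR r + expR (- r)) / 2.
have E1 : expR r * expR (- r) = 1 by rewrite expRN mulfV// gt_eqF// expR_gt0.
have e1 : 1 < expR r by rewrite expR_gt1.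
have e2 := expR_gt0 (- r).
have s1 : 1 < s by rewrite /s; nra.
have as_r : arcosh s = r.
  rewrite /arcosh -[RHS]expRK; congr ln.
  have -> : s ^+ 2 - 1 = ((expR r - expR (- r)) / 2) ^+ 2.
    by rewrite /s !expr2; lra.
  rewrite sqrtr_sqr ger0_norm /s; first by field.
  by rewrite divr_ge0//; nra.
exists (s - 1) => [|t ht]; first by rewrite subr_gt0.
move=> /(le_lt_trans (ler_norm _)) h.
by rewrite -as_r; apply: arcosh_lt => //; lra.
Qed.

(** Compares the geodesic topology with that of the coordinates: it lets geodesically open sets be
    written with rational boxes, and places small chart cubes inside balls. *)
Lemma gdist_small x r : P x -> 0 < r -> exists2 e, 0 < e &
  forall y, P y -> (forall i, `|y ord0 i - x ord0 i| < e) -> d x y < r.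
Proof.
move=> Px r0; have [e e0 H] := angle_small r0.
pose C := 1 + \sum_i `|x ord0 i|.
have C0 : 0 < C by rewrite ltr_pwDl// sumr_ge0.
exists (e / C); first exact: divr_gt0.
move=> y Py yx; rewrite gdistE; apply: H; first exact: form_rangeP.
rewrite -(points_form Px) -formBr.
apply: (@le_lt_trans _ _ (\sum_i `|x ord0 i| * `|(y - x) ord0 i|)).
  rewrite big_ord_recl /ambient_form; apply: le_trans (ler_normD _ _) _.
  rewrite normrM lerD2l normrM curvature_norm mul1r; apply: le_trans (ler_norm_sum _ _ _) _.
  by apply: ler_sum => i _; rewrite normrM.
apply: (@le_lt_trans _ _ (\sum_i `|x ord0 i| * (e / C))).
  apply: ler_sum => i _; apply: ler_wpM2l => //.
  by rewrite mxE [(- x) _ _]mxE ltW.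
rewrite -mulr_suml mulrCA -[ltRHS]mulr1 ltr_pM2l// ltr_pdivrMr// mul1r.
by rewrite /C ltrDr.
Qed.

End geometry.

(** * The reflection exchanging two points *)

Section swap.
Context {R : realType} (M : space_form) {n : nat}.
Local Notation c := (@curvature R M).
Local Notation P := (@space_points R M n).
Local Notation b := (@ambient_form R M n).
Local Notation d := (@gdist R M n).
Implicit Types x y z w v : 'rV[R]_n.+1.

Lemma space_formP : M = Sphere \/ M = Hyperbolic.
Proof. by case: M; [left|right]. Qed.

Lemma points_sphere z : M = Sphere -> P z <-> b z z = 1.
Proof. by rewrite /space_points; case: M. Qed.

Lemma points_hyperbolic z :
  M = Hyperbolic -> P z <-> b z z = 1 /\ 0 < z ord0 ord0.
Proof. by rewrite /space_points; case: M. Qed.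

Lemma form_range_hyperbolic (t : R) : M = Hyperbolic -> form_range M t -> 1 <= t.
Proof. by rewrite /form_range; case: M. Qed.

Definition form_col v : 'cV[R]_n.+1 :=
  \col_i (if i == ord0 then v ord0 i else c * v ord0 i).

Lemma mul_form_col z v : z *m form_col v = (b z v)%:M.
Proof.
apply/matrixP => i j; rewrite !ord1 !mxE eqxx mulr1n big_ord_recl !mxE eqxx.
rewrite /ambient_form; congr (_ + _); rewrite mulr_sumr; apply: eq_bigr => k _.
by rewrite !mxE /= mulrCA.
Qed.

(** The reflection, orthogonal for the ambient form, in the hyperplane orthogonal to [x - y]. It is
    a matrix acting on rows so that the invariance of Lebesgue measure under linear involutions
    applies. *)
Definition swap_mx x y : 'M[R]_n.+1 :=
  1%:M - (2 / b (x - y) (x - y)) *: (form_col (x - y) *m (x - y)).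

Lemma mul_swap_mx z x y :
  z *m swap_mx x y = z - (2 * b z (x - y) / b (x - y) (x - y)) *: (x - y).
Proof.
rewrite /swap_mx mulmxBr mulmx1 -scalemxAr mulmxA mul_form_col mul_scalar_mx.
by rewrite scalerA; congr (_ - _ *: _); ring.
Qed.

Definition swap x y z := z *m swap_mx x y.

Variables (x y : 'rV[R]_n.+1).
Hypotheses (Px : P x) (Py : P y) (xy : x <> y).
Local Notation s := (swap x y).
Local Notation v := (x - y).
Local Notation N := (b v v).

Let NE : N = 2 * (1 - b x y).
Proof. by rewrite formBl !formBr !points_form// (formC M y x); ring. Qed.

Let cN : 0 < c * N.
Proof.
rewrite NE mulrCA pmulr_rgt0// mulrBr mulr1 subr_gt0 lt_neqAle.
rewrite form_range_le1 ?andbT; last exact: form_rangeP.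
apply/eqP => h; apply: xy; apply: (form_eq1 Px Py).
by have := congr1 ( *%R c) h; rewrite mulrA curvature_sqr mul1r.
Qed.

Let N0 : N != 0.
Proof. by apply/eqP => h; have := cN; rewrite h mulr0 ltxx. Qed.

Lemma swapE z : s z = z - (2 * b z v / N) *: v.
Proof. exact: mul_swap_mx. Qed.

Let form_swap_v z : b (s z) v = - b z v.
Proof.
by rewrite swapE (formBl M z) formZl; field.
Qed.

Lemma swapK : involutive s.
Proof.
move=> z; rewrite [s (s z)]swapE form_swap_v swapE -addrA -opprD -scalerDl.
by rewrite mulrN mulNr subrr scale0r subr0.
Qed.

Lemma swap_mxK : swap_mx x y *m swap_mx x y = 1%:M.
Proof.
by apply/row_matrixP => i; rewrite !rowE mulmxA mulmx1; exact: swapK.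
Qed.

Lemma form_swap z w : b (s z) (s w) = b z w.
Proof.
rewrite !swapE (formBl M z) !(formBr M w) !formZl !formZr (formC M v w); field.
exact: N0.
Qed.

Lemma form_swapl z w : b (s z) w = b z (s w).
Proof. by rewrite -[w in LHS]swapK form_swap. Qed.

Lemma swap_left : s x = y.
Proof.
have -> : s x = x - v; last by rewrite opprB addrC subrK.
rewrite swapE -[X in _ = _ - X]scale1r; congr (_ - _ *: _).
by rewrite formBr points_form// -NE mulfV.
Qed.

(** Otherwise [- u] would be a point of the upper sheet, and its form with [y] would be at least 1.
    This keeps the swap from leaving the upper sheet. *)
Let form_sign u : M = Hyperbolic -> b u u = 1 -> 0 < b u y -> 0 < u ord0 ord0.
Proof.
move=> MH uu uy; rewrite ltNge le_eqVlt; apply/negP => /orP[/eqP u0|u0].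
  move: uu; rewrite /ambient_form u0 MH /= mul0r add0r mulN1r => /eqP.
  rewrite -subr_eq0 subr_eq0 eq_sym gt_eqF//; apply: le_lt_trans ltr01.
  by rewrite oppr_le0; apply: sumr_ge0 => i _; exact: sqr_ge0.
have Pu : P (- u).
  by apply/points_hyperbolic => //; rewrite formNl formNr opprK uu mxE oppr_gt0.
have := form_range_hyperbolic MH (form_rangeP Pu Py); rewrite formNl.
by move: uy; lra.
Qed.

Lemma swap_points z : P z -> P (s z).
Proof.
move=> Pz; have zz : b (s z) (s z) = 1 by rewrite form_swap points_form.
have sy : s y = x by have := swapK x; rewrite swap_left.
have E : b (s z) y = b z x by rewrite form_swapl sy.
have [MS|MH] := space_formP; first exact/points_sphere.
apply/points_hyperbolic => //; split => //; apply: form_sign => //; rewrite E.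
by have := form_range_hyperbolic MH (form_rangeP Pz Px); lra.
Qed.

(** The closed half on the side of [x]. The mirror lies both in it and in its image. *)
Definition half z : bool := 0 <= c * b z v.

Lemma half_swap z : half z || half (s z).
Proof.
rewrite /half form_swap_v mulrN oppr_ge0.
by case: (leP 0 (c * b z v)) => //= /ltW.
Qed.

Lemma half_fix z : half z -> half (s z) -> s z = z.
Proof.
rewrite /half form_swap_v mulrN oppr_ge0 => h1 h2.
have h : c * b z v = 0 by apply/eqP; rewrite eq_le h1 h2.
have {}h : b z v = 0.
  by have := congr1 ( *%R c) h; rewrite mulrA curvature_sqr mul1r mulr0.
by rewrite swapE h mulr0 mul0r scale0r subr0.
Qed.

(** Reflecting [w] subtracts from [c * b z w] twice a product of two nonnegative numbers, divided by
    [c * N > 0], and a smaller value of [c * b] is a larger distance. *)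
Lemma half_closer z w : P z -> P w -> half z -> half w -> d z w <= d z (s w).
Proof.
rewrite /half => Pz Pw hz hw; rewrite gdist_le//; last exact: swap_points.
rewrite swapE (formBr M w) formZr.
have -> : c * (b z w - 2 * b w v / N * b z v) =
    c * b z w - 2 * ((c * b w v) * (c * b z v)) / (c * N).
  have c0 : c != 0.
    by apply/eqP => h; have := @curvature_sqr R M; rewrite h mul0r => /esym/eqP; rewrite oner_eq0.
  by field; rewrite N0 c0.
by rewrite gerBl divr_ge0 ?(ltW cN)// mulr_ge0// mulr_ge0.
Qed.

Lemma half_left z : P z -> d z x <= d z y -> half z.
Proof. by move=> Pz; rewrite gdist_le// /half formBr mulrBr subr_ge0. Qed.

Lemma normalize_swap z : normalize M (s z) = s (normalize M z).
Proof. by rewrite /normalize form_swap /swap scalemxAl. Qed.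

Lemma measurable_swap : measurable_fun [set: 'rV[R]_n.+1] s.
Proof. exact: measurable_mulmxr. Qed.

Lemma measurable_half : measurable_fun [set: 'rV[R]_n.+1] half.
Proof.
apply: measurable_fun_ler => //; apply: measurable_funM => //.
exact: measurable_ambient_form.
Qed.

End swap.

(** * Invariance of the Riemannian measure *)

Section riemannian.
Context {R : realType} (M : space_form) {n : nat}.
Local Notation P := (@space_points R M n).
Local Notation q := (fun z : 'rV[R]_n.+1 => ambient_form M z z).
Local Notation leb := (@lebrV R n.+1).

Definition unit_cone (A : set 'rV[R]_n.+1) : set 'rV[R]_n.+1 :=
  [set z | [/\ 0 < q z, q z <= 1, P (normalize M z) & A (normalize M z)]].

Let form_normalize (z : 'rV[R]_n.+1) : 0 < q z -> q (normalize M z) = 1.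
Proof.
move=> h; rewrite /normalize formZl formZr mulrA -invfM -expr2 sqr_sqrtr ?ltW//.
by rewrite mulVf// gt_eqF.
Qed.

Let lebrV_hyperplane : leb [set z | z ord0 ord0 = 0] = 0%E.
Proof.
rewrite lebrVSE (_ : _ @^-1` _ = [set: 'rV[R]_n] `*` [set (0 : R)]); last first.
  by apply/seteqP; split => -[u t] /=; rewrite cons_rV_at0// => -[].
transitivity (@lebrV R n [set: 'rV[R]_n] * @lebesgue_measure R [set (0 : R)]%R)%E.
  exact: product_measure1E.
by rewrite lebesgue_measure_set1 mule0.
Qed.

Let measurable_hyperplane : measurable ([set z | z ord0 ord0 = 0] : set 'rV[R]_n.+1).
Proof.
rewrite -[X in measurable X]setTI.
exact: (measurable_coord ord0 measurableT (measurable_set1 (0 : R))).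
Qed.

Let measurable_preimage_q (B : set R) : measurable B ->
  measurable ((fun z => q z) @^-1` B).
Proof.
move=> mB; rewrite -[X in measurable X]setTI.
have mq : measurable_fun [set: 'rV[R]_n.+1] q by exact: measurable_ambient_form.
exact: mq.
Qed.

Lemma measurable_points : measurable P.
Proof.
have mS : measurable [set z | q z = 1].
  exact: (measurable_preimage_q (measurable_set1 (1 : R))).
have [MS|MH] := space_formP M.
  by rewrite (_ : P = [set z | q z = 1])//; apply/seteqP; split => z /points_sphere; exact.
rewrite (_ : P = [set z | q z = 1] `&`
    ((fun z => z ord0 ord0) @^-1` `]0, +oo[%classic)).
  apply: measurableI => //; rewrite -[X in measurable X]setTI.
  exact: (measurable_coord ord0 measurableT (measurable_itv `]0, +oo[)).
apply/seteqP; split => z.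
  by move=> /(points_hyperbolic _ MH)[? ?]; split => //=; rewrite in_itv/= andbT.
by case=> /= h; rewrite in_itv/= andbT => ?; apply/(points_hyperbolic _ MH).
Qed.

Lemma measurable_unit_cone A : measurable A -> measurable (unit_cone A).
Proof.
move=> mA; have -> : unit_cone A = (q @^-1` `]0, 1]%classic) `&`
    (normalize M @^-1` (P `&` A)).
  apply/seteqP; split => z; rewrite /unit_cone /= in_itv/=.
    by move=> [-> -> ? ?].
  by case=> /andP[-> ->] [].
apply: measurableI; first exact: (measurable_preimage_q (measurable_itv _)).
rewrite -[X in measurable X]setTI; apply: measurable_normalize => //.
by apply: measurableI => //; exact: measurable_points.
Qed.

(** Removes the charts from the measure: a linear map preserving the form and the points commutes
    with forming cones. On the sphere the two half cones miss only a part of the hyperplane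
    [z_0 = 0], which is Lebesgue null. *)
Lemma riemannian_measure_cone (A : set 'rV[R]_n.+1) : measurable A ->
  riemannian_measure M A = (n.+1%:R%:E * leb (unit_cone A))%E.
Proof.
move=> mA.
have E e : e ^+ 2 = 1 -> chart_volume M (chart M e @^-1` A) =
    (n.+1%:R%:E * leb (half_cone M e A))%E.
  by move=> e2; rewrite lebrV_half_cone// muleA -EFinM mulfV// mul1e.
have [MS|MH] := space_formP M.
  have -> : riemannian_measure M A = (chart_volume M (chart M 1 @^-1` A) +
      chart_volume M (chart M (- 1) @^-1` A))%E.
    by move: MS; case: (M) => // _; exact: measure_addE.
  rewrite !E ?sqrrN ?expr1n// -muleDr//; last by rewrite ge0_adde_def// inE.
  congr (_ * _)%E; rewrite -measureU; last 3 first.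
  - exact: measurable_half_cone.
  - exact: measurable_half_cone.
  - apply/seteqP; split => // z [[_ _ h1 _] [_ _ h2 _]].
    by move: h1 h2; rewrite /=; lra.
  pose Z := unit_cone A `&` [set z | z ord0 ord0 = 0].
  have mZ : measurable Z.
    apply: measurableI; last exact: measurable_hyperplane.
    exact: measurable_unit_cone.
  transitivity (leb ((half_cone M 1 A `|` half_cone M (- 1) A) `|` Z)).
    apply/esym/measureU0 => //.
      by apply: measurableU; exact: measurable_half_cone.
    apply/eqP; rewrite eq_le measure_ge0 andbT -lebrV_hyperplane.
    by apply: le_measure; rewrite ?inE//; exact: subIsetr.
  congr (leb _); apply/seteqP; split => z.
    have HP h := (points_sphere _ MS).2 (@form_normalize z h).
    by move=> [[[h1 h2 h3 h4]|[h1 h2 h3 h4]]|[]//]; split => //; exact: HP.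
  case=> h1 h2 h3 h4.
  have [z0|z0|z0] := ltrgt0P (z ord0 ord0).
  - by left; left; split => //; rewrite mul1r.
  - by left; right; split => //; rewrite mulN1r oppr_gt0.
  - by right.
have -> : riemannian_measure M A = chart_volume M (chart M 1 @^-1` A).
  by move: MH; case: (M).
rewrite E ?expr1n//; congr (_ * leb _)%E; apply/seteqP; split => z.
  case=> h1 h2; rewrite mul1r => h3 h4; split => //.
  apply/points_hyperbolic => //; rewrite form_normalize//; split => //.
  by rewrite mxE mulr_gt0// invr_gt0 sqrtr_gt0.
case=> h1 h2 h3 h4; split => //; rewrite mul1r.
move: h3 => /(points_hyperbolic _ MH)[_]; rewrite mxE.
by rewrite pmulr_rgt0// invr_gt0 sqrtr_gt0.
Qed.

End riemannian.

(* [riemannian_measure] with a sigma-finite structure. *)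
Definition riemM (R : realType) (M : space_form) (n : nat) :
  set 'rV[R]_n.+1 -> \bar R := riemannian_measure M.

Section riemM_measure.
Context {R : realType} (M : space_form) (n : nat).

Let riemM0 : @riemM R M n set0 = 0%E.
Proof. exact: measure0. Qed.

Let riemM_ge0 A : (0 <= @riemM R M n A)%E.
Proof. exact: measure_ge0. Qed.

Let riemM_sigma_additive : semi_sigma_additive (@riemM R M n).
Proof. exact: measure_semi_sigma_additive. Qed.

HB.instance Definition _ := isMeasure.Build _ _ _ (@riemM R M n)
  riemM0 riemM_ge0 riemM_sigma_additive.

Let normalizeE (z : 'rV[R]_n.+1) : 0 < ambient_form M z z ->
  z = Num.sqrt (ambient_form M z z) *: normalize M z.
Proof.
by move=> h; rewrite /normalize scalerA mulfV ?scale1r// gt_eqF// sqrtr_gt0.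
Qed.

(** The truncated cone over a subset of the cube stays in the cube, because its points are
    normalized points multiplied by a factor at most 1. *)
Lemma riemM_cube C : 0 < C -> (riemM M (cube n.+1 C : set 'rV[R]__) < +oo)%E.
Proof.
move=> C0; rewrite /riemM riemannian_measure_cone; last exact: measurable_cube.
apply: (@le_lt_trans _ _ (n.+1%:R%:E * lebrV (cube n.+1 C))%E); last first.
  by rewrite lebrV_cube// -EFinM ltry.
rewrite lee_pmul2l ?lte_fin//; apply: le_measure.
- by rewrite inE; apply: measurable_unit_cone; exact: measurable_cube.
- by rewrite inE; exact: measurable_cube.
move=> z [q0 q1 _ Az] i; rewrite (normalizeE q0) mxE normrM ger0_norm ?sqrtr_ge0//.
apply: le_lt_trans (Az i); rewrite ler_piMl// -sqrtr1.
by rewrite ler_wsqrtr.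
Qed.

Let riemM_sigma_finite : sigma_finite [set: 'rV[R]_n.+1] (@riemM R M n).
Proof.
exists (fun k => cube n.+1 k.+1%:R); first by rewrite cube_nat_cover.
by move=> k; split; [exact: measurable_cube|exact: riemM_cube].
Qed.

HB.instance Definition _ :=
  Measure_isSigmaFinite.Build _ _ _ (@riemM R M n) riemM_sigma_finite.

End riemM_measure.

(** All that polarization uses of the swap of two points. [H] stands for a closed half; its overlap
    with its image must be fixed pointwise, otherwise a pair could receive its maximum twice. *)
Record is_reflection {R : realType} (M : space_form) (n : nat)
    (s : 'rV[R]_n.+1 -> 'rV[R]_n.+1) (H : 'rV[R]_n.+1 -> bool) : Prop :=
  IsReflection {
  reflection_points : forall z, space_points M z -> space_points M (s z) ;
  reflectionK : involutive s ;
  reflection_form : forall z w, ambient_form M (s z) (s w) = ambient_form M z w ;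
  measurable_reflection : measurable_fun [set: 'rV[R]_n.+1] s ;
  reflection_measure : forall A, measurable A -> riemM M (s @^-1` A) = riemM M A ;
  measurable_side : measurable_fun [set: 'rV[R]_n.+1] H ;
  side_reflection : forall z, H z || H (s z) ;
  side_fix : forall z, H z -> H (s z) -> s z = z ;
  side_closer : forall z w, space_points M z -> space_points M w ->
    H z -> H w -> gdist M z w <= gdist M z (s w) }.

Lemma measurable_rV_set1 (R : realType) k (u : 'rV[R]_k) : measurable [set u].
Proof.
have -> : [set u] = \bigcap_(i in [set: 'I_k])
    ((fun w : 'rV[R]_k => w ord0 i) @^-1` [set u ord0 i]).
  apply/seteqP; split => [w -> //|w H]; apply/rowP => i; exact: (H i I).
apply: fin_bigcap_measurable => // i _.
rewrite -[X in measurable X]setTI.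
exact: (measurable_coord i measurableT (measurable_set1 (u ord0 i))).
Qed.

(** * Balls and open sets *)

Section riemannian_space.
Context {R : realType} (M : space_form) {n : nat}.
Local Notation c := (@curvature R M).
Local Notation P := (@space_points R M n).
Local Notation b := (@ambient_form R M n).
Local Notation d := (@gdist R M n).
Local Notation mu := (@riemM R M n).
Implicit Types x y z w v : 'rV[R]_n.+1.

Lemma swap_reflection x y : P x -> P y -> x <> y ->
  exists s H, [/\ is_reflection M s H, s x = y &
    forall z, P z -> d z x <= d z y -> H z].
Proof.
move=> Px Py xy; exists (swap M x y), (half M x y); split; last first.
- by move=> z Pz; exact: half_left.
- exact: swap_left.
split.
- by move=> z; exact: swap_points.
- exact: swapK.
- by move=> z w; exact: form_swap.
- exact: measurable_swap.
- move=> A mA; have mpre : measurable (swap M x y @^-1` A).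
    by rewrite -[X in measurable X]setTI; exact: (measurable_swap _ _ _ measurableT mA).
  rewrite /riemM !riemannian_measure_cone//; congr (_ * _)%E.
  (* The cone over the preimage is the preimage of the cone under a linear involution. *)
  rewrite -[RHS](lebrV_involution (swap_mxK Px Py xy)); last exact: measurable_unit_cone.
  congr (lebrV _); apply/seteqP; split => z [h1 h2 h3 h4]; split => //=.
  + by rewrite -/(swap M x y z) form_swap.
  + by rewrite -/(swap M x y z) form_swap.
  + by rewrite -/(swap M x y z) normalize_swap//; exact: swap_points.
  + by rewrite -/(swap M x y z) normalize_swap.
  + by move: h1; rewrite -/(swap M x y z) form_swap.
  + by move: h2; rewrite -/(swap M x y z) form_swap.
  + move: h3; rewrite -/(swap M x y z) normalize_swap// => /(swap_points Px Py xy).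
    by rewrite swapK.
  + by move: h4; rewrite -/(swap M x y z) normalize_swap.
- exact: measurable_half.
- by move=> z; exact: half_swap.
- by move=> z; exact: half_fix.
- by move=> z w; exact: half_closer.
Qed.

Lemma reflection_gdist s H : is_reflection M s H ->
  forall z w, d (s z) (s w) = d z w.
Proof. by move=> rs z w; rewrite !gdistE (reflection_form rs). Qed.

Lemma gball_sub x r r' : r <= r' -> gball M x r `<=` gball M x r'.
Proof. by move=> rr' z [Pz zr]; split => //; exact: lt_le_trans rr'. Qed.

Lemma gopen_gball x r : P x -> gopen M (gball M x r).
Proof.
move=> Px; split => [z []//|z [Pz zr]].
exists (r - d z x); first by rewrite subr_gt0.
move=> w [Pw wz]; split => //; apply: le_lt_trans (gdist_triangle Pw Pz Px) _.
by rewrite -ltrBrDr.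
Qed.

Lemma gball_center x r : P x -> 0 < r -> gball M x r x.
Proof. by move=> Px r0; split => //; rewrite gdistxx. Qed.

Let box (a : 'rV[rat]_n.+1 * nat) : set 'rV[R]_n.+1 :=
  [set y | forall i, `|y ord0 i - ratr (a.1 ord0 i)| < a.2.+1%:R^-1].

Let measurable_box a : measurable (box a).
Proof.
have -> : box a = \bigcap_(i in [set: 'I_n.+1])
    ((fun u : 'rV[R]_n.+1 => u ord0 i) @^-1`
     [set` `]ratr (a.1 ord0 i) - a.2.+1%:R^-1, ratr (a.1 ord0 i) + a.2.+1%:R^-1[]).
  apply/seteqP; split => [u ur i _|u H i] /=.
    by rewrite in_itv/= -ltr_distl; exact: ur.
  by have := H i I; rewrite /= in_itv/= -ltr_distl.
apply: fin_bigcap_measurable => // i _; rewrite -[X in measurable X]setTI.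
exact: (measurable_coord i measurableT (measurable_itv _)).
Qed.

Let box_dense x (e : R) : 0 < e ->
  exists2 a, box a x & forall y, box a y -> forall i, `|y ord0 i - x ord0 i| < e.
Proof.
move=> e0; pose k := Num.truncn ((e / 2)^-1).
have k0 : 0 < k.+1%:R^-1 :> R by rewrite invr_gt0.
have ke : k.+1%:R^-1 + k.+1%:R^-1 <= e.
  rewrite [leRHS]splitr lerD//.
    by rewrite invf_ple ?posrE ?divr_gt0//; exact/ltW/truncnS_gt.
  by rewrite invf_ple ?posrE ?divr_gt0//; exact/ltW/truncnS_gt.
have /choice[f Hf] i : exists r : rat, `|x ord0 i - ratr r| < k.+1%:R^-1.
  have lt : x ord0 i - k.+1%:R^-1 < x ord0 i + k.+1%:R^-1 by rewrite ltrD2l gtrN.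
  have [r] := rat_in_itvoo lt.
  by rewrite in_itv/= => h; exists r; rewrite distrC ltr_distl.
exists (\row_i f i, k) => [i|y yb i]; first by rewrite mxE; exact: Hf.
apply: lt_le_trans ke; rewrite -(subrKA (ratr (f i)) (y ord0 i)).
apply: le_lt_trans (ler_normD _ _) _; rewrite ltrD//.
  by have := yb i; rewrite mxE.
by rewrite distrC.
Qed.

(** An open set is the trace on [P] of the union of those rational boxes whose trace it contains,
    and these are countably many. *)
Lemma measurable_gopen (O : set 'rV[R]_n.+1) : gopen M O -> measurable O.
Proof.
move=> [OP Oball].
have -> : O = P `&` \bigcup_a (if `[< box a `&` P `<=` O >] then box a else set0).
  apply/seteqP; split => [z Oz|z [Pz [a _]]]; last first.
    by case: asboolP => // sub ?; apply: sub.
  have Pz := OP _ Oz; split => //; have [r r0 sub] := Oball _ Oz.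
  have [e e0 small] := gdist_small Pz r0.
  have [a az ae] := box_dense z e0; exists a => //; case: asboolP => // -[].
  move=> w [aw Pw]; apply: sub; split => //; rewrite gdistC.
  by apply: small => //; exact: ae.
apply: measurableI; first exact: measurable_points.
apply: countable_bigcupT_measurable; first exact: countableP.
by move=> a; case: ifP.
Qed.

Lemma measurable_gball x r : P x -> measurable (gball M x r).
Proof. by move=> Px; apply: measurable_gopen; exact: gopen_gball. Qed.

(** The swap of the two centres carries one ball to the other. *)
Lemma riemM_gball_eq x y r : P x -> P y -> mu (gball M x r) = mu (gball M y r).
Proof.
move=> Px Py; have [->//|/eqP xy] := eqVneq x y.
have [s [H [rs sxy _]]] := swap_reflection Px Py xy.
rewrite -(reflection_measure rs); last exact: measurable_gball.
congr (mu _); have E z : d (s z) x = d z y by rewrite -(reflection_gdist rs) (reflectionK rs) sxy.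
apply/seteqP; split => z [Pz yz]; split.
- by rewrite -(reflectionK rs z); exact: (reflection_points rs).
- by rewrite -E.
- exact: (reflection_points rs).
- by rewrite E.
Qed.

Definition pole : 'rV[R]_n.+1 := cons_rV 1 0.

Let form_pole y : b pole y = y ord0 ord0.
Proof.
rewrite /ambient_form cons_rV_at0 mul1r big1 ?mulr0 ?addr0// => i _.
by rewrite cons_rV_lift mxE mul0r.
Qed.

Lemma pole_points : P pole.
Proof.
have h : b pole pole = 1 by rewrite form_pole cons_rV_at0.
have [MS|MH] := space_formP M; first exact/points_sphere.
by apply/points_hyperbolic => //; split => //; rewrite cons_rV_at0.
Qed.

(** By homogeneity the centre may be the pole, and the ball is then inside a cube: on the
    hyperboloid [arcosh (y_0) < r] gives [y_0 < expR r], and the height dominates the spatial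
    coordinates. *)
Lemma riemM_gball_finite x r : P x -> (mu (gball M x r) < +oo)%E.
Proof.
move=> Px; rewrite (riemM_gball_eq r Px pole_points).
suff [C C0 sub] : exists2 C, 0 < C & gball M pole r `<=` cube n.+1 C.
  apply: le_lt_trans (riemM_cube M n C0); apply: le_measure => //; rewrite inE.
    by apply: measurable_gball; exact: pole_points.
  exact: measurable_cube.
have [MS|MH] := space_formP M.
  exists 2 => // y [/(points_sphere _ MS) yy _] i.
  apply: (@le_lt_trans _ _ 1); last by rewrite ltr1n.
  rewrite -(@ler_pXn2r _ 2)// ?nnegrE// real_normK ?num_real// expr1n -yy.
  rewrite /ambient_form /curvature MS mul1r; move: i; apply: forall_ordS => [|i].
    by rewrite expr2 lerDl sumr_ge0// => j _; exact: sqr_ge0.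
  rewrite (bigD1 i)//= addrCA -expr2 lerDl addr_ge0 ?sqr_ge0// sumr_ge0// => j _.
  exact: sqr_ge0.
exists (expR r) => [|y [Py yr]]; first exact: expR_gt0.
have [yy y0] := (points_hyperbolic _ MH).1 Py.
have y1 : 1 <= y ord0 ord0.
  by rewrite -form_pole; exact: (form_range_hyperbolic MH (form_rangeP pole_points Py)).
have y0r : y ord0 ord0 < expR r.
  move: yr; rewrite gdistE formC form_pole /angle MH /arcosh.
  set t := Num.sqrt _ => yr; have t0 : 0 <= t by exact: sqrtr_ge0.
  have yt : 0 < y ord0 ord0 + t by lra.
  by apply: (@le_lt_trans _ _ (y ord0 ord0 + t)); [lra|rewrite -(lnK yt) ltr_expR].
apply: forall_ordS => [|i]; first by rewrite gtr0_norm.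
apply: le_lt_trans y0r.
rewrite -(@ler_pXn2r _ 2)// ?nnegrE ?(ltW y0)// real_normK ?num_real//.
move: yy; rewrite /ambient_form /curvature MH (bigD1 i)//=.
set S := \sum_(_ | _) _; have S0 : 0 <= S by apply: sumr_ge0 => j _; exact: sqr_ge0.
by rewrite !expr2; lra.
Qed.

(** About the pole, a chart maps a small cube into the ball, and the volume density is at least 1/2
    on this cube. *)
Lemma riemM_gball_gt0 x r : P x -> 0 < r -> (0 < mu (gball M x r))%E.
Proof.
move=> Px r0; rewrite (riemM_gball_eq r Px pole_points).
have mB := measurable_gball r pole_points.
have [e e0 small] := gdist_small pole_points r0.
(* Chosen to have [n * h ^+ 2 <= h / 2], so that the height of the chart point differs from 1 by
   less than [e]. *)
pose h : R := Num.min e (2 * n.+1%:R)^-1.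
have nn0 : 0 < 2 * n.+1%:R :> R by rewrite mulr_gt0.
have h0 : 0 < h by rewrite lt_min e0 invr_gt0.
have he : h <= e by rewrite ge_min lexx.
have hn : n.+1%:R * h <= 2^-1.
  have : h <= (2 * n.+1%:R)^-1 by rewrite ge_min lexx orbT.
  by rewrite -(ler_pM2l nn0) mulfV ?gt_eqF//; lra.
have dot_small u : cube n h u -> `|c * dotmul u u| <= h / 2.
  move=> uh; rewrite normrM curvature_norm mul1r.
  apply: le_trans (ler_norm_sum _ _ _) _.
  apply: (@le_trans _ _ (\sum_(i < n) h * h)).
    by apply: ler_sum => i _; rewrite normrM ler_pM// ltW//; exact: uh.
  rewrite sumr_const card_ord -mulr_natl.
  have : n%:R <= n.+1%:R :> R by rewrite ler_nat.
  by move: hn; nra.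
have h2 : h <= 2^-1.
  apply: le_trans hn; rewrite ler_peMl ?(ltW h0)//.
  by rewrite ler1n.
pose k (u : 'rV[R]_n) : R := c * dotmul u u.
have kE u : cube n h u -> -h / 2 <= k u <= h / 2.
  by move=> /dot_small; rewrite ler_norml mulNr.
have chart_ball u : cube n h u -> gball M pole r (chart M 1 u).
  move=> uh; have /andP[k1 k2] := kE u uh.
  set s := Num.sqrt (1 - k u).
  have s2 : s ^+ 2 = 1 - k u by rewrite sqr_sqrtr//; lra.
  have s0 : 0 < s by rewrite sqrtr_gt0; lra.
  have ch : chart M 1 u = cons_rV s u by rewrite /chart mul1r.
  have bb : b (cons_rV s u) (cons_rV s u) = 1 by rewrite ambient_form_cons s2 subrK.
  have Pc : P (chart M 1 u).
    rewrite ch; have [MS|MH] := space_formP M; first exact/points_sphere.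
    by apply/points_hyperbolic => //; rewrite cons_rV_at0.
  split=> //; rewrite gdistC; apply: small => //; rewrite ch.
  apply: forall_ordS => [|i].
    rewrite !cons_rV_at0; apply: le_lt_trans (_ : h / 2 < _); last by lra.
    rewrite ler_norml; apply/andP; split; nra.
  by rewrite !cons_rV_lift mxE subr0; apply: lt_le_trans he; exact: uh.
have mc : measurable (cube n h : set 'rV[R]_n) by exact: measurable_cube.
have mpre : measurable (chart M 1 @^-1` gball M pole r).
  by rewrite -[X in measurable X]setTI; exact: (measurable_chart _ _ measurableT mB).
apply: (@lt_le_trans _ _ (chart_volume M (chart M 1 @^-1` gball M pole r))); last first.
  rewrite /riemM; have [MS|MH] := space_formP M.
    have -> : riemannian_measure M (gball M pole r) =
        (chart_volume M (chart M 1 @^-1` gball M pole r) +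
         chart_volume M (chart M (- 1) @^-1` gball M pole r))%E.
      by move: MS; case: (M) => // _; exact: measure_addE.
    by rewrite leeDl.
  by have -> : riemannian_measure M (gball M pole r) =
      chart_volume M (chart M 1 @^-1` gball M pole r) by move: MH; case: (M).
apply: (@lt_le_trans _ _ (\int[lebrV (n := n)]_(u in cube n h) (2^-1)%:E)%E).
  rewrite integral_cst// [X in (_ * X)%E](lebrV_cube n h0) -EFinM lte_fin mulr_gt0// exprn_gt0//.
  by rewrite mulrn_wgt0.
apply: (@le_trans _ _ (\int[lebrV (n := n)]_(u in cube n h) volume_density M u)%E).
  apply: ge0_le_integral => //.
  - by apply: measurable_funTS; exact: measurable_volume_density.
  - move=> u uh; rewrite volume_densityE lee_fin -/(k u).
    have /andP[k1 k2] := kE u uh.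
    rewrite /radial_weight /radial_dom /radial ltr01 expr1n/= ifT; last by lra.
    rewrite div1r lef_pV2 ?posrE// ?sqrtr_gt0; last by lra.
    by rewrite -(@ler_pXn2r _ 2)// ?nnegrE ?sqrtr_ge0// sqr_sqrtr; nra.
apply: ge0_subset_integral => //.
  by apply: measurable_funTS; exact: measurable_volume_density.
by move=> u _; exact: volume_density_ge0.
Qed.

(** A chart meets a point in at most one parameter. Points being null, the diagonal is negligible in
    every energy. *)
Lemma riemM_set1 x : (0 < n)%N -> mu [set x] = 0%E.
Proof.
move=> n0; have m1 := @measurable_rV_set1 R.
have leb1 (u : 'rV[R]_n) : lebrV [set u] = 0%E.
  case: n n0 u => // k _ u; rewrite lebrVSE.
  rewrite (_ : _ @^-1` _ = [set \row_i u ord0 (lift ord0 i)] `*` [set (u ord0 ord0)]).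
    transitivity (@lebrV R k [set \row_i u ord0 (lift ord0 i)] *
      @lebesgue_measure R [set u ord0 ord0])%E.
      by apply: product_measure1E => //; exact: m1.
    by rewrite lebesgue_measure_set1 mule0.
  apply/seteqP; split => -[w t] /=.
    move=> <-; rewrite cons_rV_at0; split => //; apply/rowP => i.
    by rewrite mxE cons_rV_lift.
  case=> -> ->; apply/rowP; apply: forall_ordS => [|i]; first by rewrite cons_rV_at0.
  by rewrite cons_rV_lift mxE.
have cv e : chart_volume M (chart M e @^-1` [set x]) = 0%E.
  have mpre : measurable (chart M e @^-1` [set x]).
    by rewrite -[X in measurable X]setTI; exact: (measurable_chart _ _ measurableT (m1 _ x)).
  apply/eqP; rewrite eq_le measure_ge0 andbT.
  apply: (@le_trans _ _ (\int[lebrV (n := n)]_(u in [set \row_i x ord0 (lift ord0 i)])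
     `|volume_density M u|)%E).
    rewrite (eq_integral (volume_density M)); last first.
      by move=> u _; rewrite gee0_abs// volume_density_ge0.
    apply: ge0_subset_integral => //; first exact: m1.
    - by apply: measurable_funTS; exact: measurable_volume_density.
    - by move=> u _; exact: volume_density_ge0.
    - move=> u /= <-; apply/rowP => i; by rewrite mxE cons_rV_lift.
  rewrite integral_abs_eq0//; first exact: m1.
    by apply: measurable_funTS; exact: measurable_volume_density.
  exact: leb1.
have [MS|MH] := space_formP M.
  transitivity (chart_volume M (chart M 1 @^-1` [set x]) +
       chart_volume M (chart M (- 1) @^-1` [set x]))%E.
    rewrite -[LHS]/(riemannian_measure M [set x]).
    by move: MS; case: (M) => // _; exact: measure_addE.
  by rewrite !cv adde0.
transitivity (chart_volume M (chart M 1 @^-1` [set x])); last exact: cv.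
rewrite -[LHS]/(riemannian_measure M [set x]).
by move: MH; case: (M).
Qed.

End riemannian_space.

Lemma ge0_integral_image_measure d1 d2 (T1 : measurableType d1)
    (T2 : measurableType d2) (R : realType) (m : {measure set T1 -> \bar R})
    (f : T1 -> T2) (mf : measurable_fun [set: T1] f) (g : T2 -> \bar R) :
  measurable_fun [set: T2] g -> (forall y, 0 <= g y)%E ->
  (\int[image_measure m mf]_y g y = \int[m]_x g (f x))%E.
Proof. by move=> mg g0; rewrite /image_measure ge0_integral_pushforward. Qed.

(** * The kernel *)

Section kern.
Context {R : realType} (M : space_form) {n : nat} (K : R -> R).
Local Notation c := (@curvature R M).
Local Notation P := (@space_points R M n).
Local Notation b := (@ambient_form R M n).
Local Notation d := (@gdist R M n).
Local Notation mu := (@riemM R M n).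
Implicit Types x y z w : 'rV[R]_n.+1.

Definition clamp (t : R) : R :=
  match M with
  | Sphere => Num.max (- 1) (Num.min 1 t)
  | Hyperbolic => Num.max 1 t
  end.

(* Equal to [gdist] on pairs of points, and measurable everywhere. *)
Definition clamped_dist x y : R := angle M (clamp (b x y)).

Lemma clamp_range t : form_range M (clamp t).
Proof.
rewrite /form_range /clamp; case: M; last by rewrite le_max lexx.
by rewrite le_max lexx/= ge_max ge_min lexx/=; lra.
Qed.

Lemma clamp_id t : form_range M t -> clamp t = t.
Proof.
rewrite /form_range /clamp; case: M => [/andP[h1 h2]|h].
  by rewrite min_r// max_r.
by rewrite max_r.
Qed.

Let clamp_mono s t : c * s <= c * t -> c * clamp s <= c * clamp t.
Proof.
rewrite /curvature /clamp; case: M; rewrite ?mul1r ?mulN1r ?lerN2 => st.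
  by apply: le_max2 => //; apply: le_min2.
by apply: le_max2.
Qed.

Lemma clamped_distE x y : P x -> P y -> clamped_dist x y = d x y.
Proof. by move=> Px Py; rewrite /clamped_dist clamp_id ?gdistE//; exact: form_rangeP. Qed.

(** As a function of [c] times the form, the clamped distance is nonincreasing on the whole line. *)
Lemma measurable_clamped_dist : measurable_fun [set: 'rV[R]_n.+1 * 'rV[R]_n.+1]
  (fun p => clamped_dist p.1 p.2).
Proof.
pose f (s : R) : R := angle M (clamp (c * s)).
have mf : measurable_fun [set: R] f.
  apply: nonincreasing_measurable => // s t st.
  rewrite /f angle_le; try exact: clamp_range.
  by apply: clamp_mono; rewrite !mulrA curvature_sqr !mul1r.
have mb : measurable_fun [set: 'rV[R]_n.+1 * 'rV[R]_n.+1] (fun p => c * b p.1 p.2).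
  by apply: measurable_funM => //; exact: measurable_ambient_form.
rewrite (_ : (fun p => _) = f \o (fun p => c * b p.1 p.2)).
  exact: measurableT_comp.
by apply/funext => p; rewrite /f /= mulrA curvature_sqr mul1r.
Qed.

(* [expR \o ln] is the identity on positive reals; composing with it makes the
   monotone function [K \o expR] total. *)
Definition kern x y : R :=
  if 0 < clamped_dist x y then K (expR (ln (clamped_dist x y))) else 0.

Hypotheses (K_pos : forall t, 0 < t -> 0 < K t)
  (K_noninc : forall s t, 0 < s -> s <= t -> K t <= K s).

Lemma kern_ge0 x y : 0 <= kern x y.
Proof. by rewrite /kern; case: ifP => // _; rewrite ltW// K_pos// expR_gt0. Qed.

Lemma kernC x y : kern x y = kern y x.
Proof. by rewrite /kern /clamped_dist formC. Qed.

Lemma kernE x y : P x -> P y -> x <> y -> kern x y = K (d x y).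
Proof.
move=> Px Py xy; have d0 := gdist_gt0 Px Py xy.
by rewrite /kern clamped_distE// d0 lnK.
Qed.

Lemma kern_gt0 x y : P x -> P y -> x <> y -> 0 < kern x y.
Proof. by move=> Px Py xy; rewrite kernE// K_pos// gdist_gt0. Qed.

Lemma kern_le x y z w : P x -> P y -> P z -> P w -> x <> y -> z <> w ->
  d x y <= d z w -> kern z w <= kern x y.
Proof. by move=> *; rewrite !kernE// K_noninc// gdist_gt0. Qed.

Lemma kern_reflection s H x y : is_reflection M s H ->
  kern (s x) (s y) = kern x y.
Proof. by move=> rs; rewrite /kern /clamped_dist (reflection_form rs). Qed.

Lemma measurable_kern : measurable_fun [set: 'rV[R]_n.+1 * 'rV[R]_n.+1]
  (fun p => kern p.1 p.2).
Proof.
have mKe : measurable_fun [set: R] (fun t => K (expR t)).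
  apply: nonincreasing_measurable => // s t st.
  by apply: K_noninc; rewrite ?expR_gt0// ler_expR.
apply: measurable_fun_ifT => //.
  by apply: measurable_fun_ltr => //; exact: measurable_clamped_dist.
apply: (measurableT_comp mKe).
by apply: (measurableT_comp (@measurable_ln R)); exact: measurable_clamped_dist.
Qed.

Lemma measurable_kern1 x : measurable_fun [set: 'rV[R]_n.+1] (kern x).
Proof. exact: (measurableT_comp measurable_kern (pair1_measurable x)). Qed.

Lemma ge0_integral_reflection s H (f : 'rV[R]_n.+1 -> \bar R) :
  is_reflection M s H -> measurable_fun [set: 'rV[R]_n.+1] f ->
  (forall z, 0 <= f z)%E -> (\int[mu]_z f (s z) = \int[mu]_z f z)%E.
Proof.
move=> rs mf f0; have ms := measurable_reflection rs.
transitivity (\int[image_measure mu ms]_z f z)%E.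
  by rewrite ge0_integral_image_measure.
by apply: eq_measure_integral => A mA _; exact: (reflection_measure rs).
Qed.

Lemma reflection_gball s H x r : is_reflection M s H ->
  s @^-1` gball M x r = gball M (s x) r.
Proof.
move=> rs; have E z : d (s z) x = d z (s x).
  by rewrite -(reflection_gdist rs) (reflectionK rs).
apply/seteqP; split => z [Pz yz]; split.
- by rewrite -(reflectionK rs z); exact: (reflection_points rs).
- by rewrite -E.
- exact: (reflection_points rs).
- by rewrite E.
Qed.

(** Homogeneity again: the swap of [x] and [y] preserves the kernel and the measure. Estimates at
    one centre thereby become uniform. *)
Lemma integral_kern_gball x y r : P x -> P y ->
  (\int[mu]_(z in gball M x r) (kern x z)%:E =
   \int[mu]_(z in gball M y r) (kern y z)%:E)%E.
Proof.
move=> Px Py; have [->//|/eqP xy] := eqVneq x y.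
have [s [H [rs sxy _]]] := swap_reflection Px Py xy.
rewrite [LHS]integral_mkcond [RHS]integral_mkcond.
rewrite -[LHS](ge0_integral_reflection rs).
- apply: eq_integral => z _; rewrite !patchE -sxy -[in RHS](reflection_gball x r rs).
  rewrite -(kern_reflection x (s z) rs) (reflectionK rs).
  by congr (if _ then _ else _); apply/idP/idP => /set_mem h; apply/mem_set.
- apply/(measurable_restrict _ _) => //; first exact: measurable_gball.
  by rewrite setTI; apply: measurable_funTS; apply/measurable_EFinP; exact: measurable_kern1.
- by move=> z; rewrite patchE; case: ifP => // _; rewrite lee_fin kern_ge0.
Qed.

Hypothesis K_locint : forall x, P x -> glocally_integrable M (fun y => K (d x y)).

(** Within distance [r0] of [x] the integral does not depend on [x] and is finite by local
    integrability; farther away the kernel is at most [K r0], on a ball of finite measure. *)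
Lemma kern_schur p r : P p -> exists2 C : R, 0 <= C & forall x, P x ->
  (\int[mu]_(y in gball M p r) (kern x y)%:E <= C%:E)%E.
Proof.
move=> Pp; have [r0 r00 int] := K_locint Pp Pp.
have mg x r' : P x -> measurable (gball M x r') by exact: measurable_gball.
have mk x (D : set 'rV[R]_n.+1) : measurable_fun D (EFin \o kern x).
  by apply: measurable_funTS; apply/measurable_EFinP; exact: measurable_kern1.
have k0 x y : (0 <= (kern x y)%:E)%E by rewrite lee_fin kern_ge0.
have A_fin : (\int[mu]_(y in gball M p r0) (kern p y)%:E < +oo)%E.
  have /integrableP[mK] := int; apply: le_lt_trans.
  apply: ge0_le_integral => //; [exact: mg|exact: mk| |].
    exact: measurableT_comp.
  move=> y [Py _]; rewrite /= lee_fin; have [<-|/eqP py] := eqVneq p y.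
    by rewrite /kern clamped_distE// gdistxx// ltxx.
  by rewrite kernE// ler_norm.
have B_fin := riemM_gball_finite r Pp.
pose A := (\int[mu]_(y in gball M p r0) (kern p y)%:E)%E.
have A0 : (0 <= A)%E by apply: integral_ge0.
exists (fine A + K r0 * fine (mu (gball M p r))).
  by rewrite addr_ge0 ?fine_ge0// mulr_ge0 ?fine_ge0// ltW// K_pos.
move=> x Px; rewrite EFinD EFinM !fineK ?ge0_fin_numE//.
rewrite /A -(integral_kern_gball r0 Px Pp) -integral_cst; last exact: mg.
rewrite [leLHS]integral_mkcond [X in (_ <= X + _)%E]integral_mkcond.
rewrite [X in (_ <= _ + X)%E]integral_mkcond.
have mr (D : set 'rV[R]_n.+1) (f : 'rV[R]_n.+1 -> \bar R) : measurable D ->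
    measurable_fun [set: 'rV[R]_n.+1] f -> measurable_fun [set: 'rV[R]_n.+1] (f \_ D).
  move=> mD mf; apply/(measurable_restrict _ _) => //.
  by rewrite setTI; exact: measurable_funTS.
have r_ge0 (D : set 'rV[R]_n.+1) (f : 'rV[R]_n.+1 -> \bar R) z :
    (forall z, 0 <= f z)%E -> (0 <= (f \_ D) z)%E.
  by move=> f0; rewrite patchE; case: ifP.
have Kr0 : (0 <= (K r0)%:E)%E by rewrite lee_fin ltW// K_pos.
rewrite -ge0_integralD//; last 4 first.
- by move=> z _; exact: r_ge0.
- by apply: mr; [exact: mg|exact: mk].
- by move=> z _; exact: r_ge0.
- by apply: mr => //; exact: mg.
apply: ge0_le_integral => //.
- by move=> z _; exact: r_ge0.
- by apply: mr; [exact: mg|exact: mk].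
- by apply: emeasurable_funD; apply: mr => //; [exact: mg|exact: mk|exact: mg].
move=> z _; rewrite !patchE; case: ifPn => [/set_mem[Pz zp]|_]; last first.
  by rewrite adde0; case: ifP.
case: ifPn => [_|/negP zx]; first by rewrite leeDl.
rewrite add0e lee_fin.
have xz : r0 <= d x z.
  rewrite leNgt; apply/negP => h; apply: zx; apply/mem_set; split => //.
  by rewrite gdistC.
have xz' : x <> z by move=> E; move: xz; rewrite E gdistxx// leNgt r00.
by rewrite kernE// K_noninc.
Qed.

End kern.

(** * Extremal eigenvectors of compact forms *)

Section bilinear_form_on.
Context {R : realType} {E : lmodType R} (V : E -> Prop).
Hypotheses (VD : forall f g, V f -> V g -> V (f + g))
  (VZ : forall (a : R) f, V f -> V (a *: f)).

(** The laws are required only on [V], since L^2 appears as a predicate on the type of all functions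
    and integrals obey linearity only there. *)
Record bilinear_form_on (q : E -> E -> R) : Prop := BilinearFormOn {
  bfC : forall f g, V f -> V g -> q f g = q g f ;
  bfD : forall f g h, V f -> V g -> V h -> q (f + g) h = q f h + q g h ;
  bfZ : forall a f h, V f -> V h -> q (a *: f) h = a * q f h }.

Variable q : E -> E -> R.
Hypothesis qB : bilinear_form_on q.

Lemma bf_sqr s t f g : V f -> V g -> q (s *: f + t *: g) (s *: f + t *: g) =
  s ^+ 2 * q f f + 2 * s * t * q f g + t ^+ 2 * q g g.
Proof.
move=> Vf Vg; have [Vsf Vtg] := (VZ s Vf, VZ t Vg); have VS := VD Vsf Vtg.
rewrite (bfD qB)// !(bfZ qB)// (bfC qB Vf)// (bfC qB Vg)// !(bfD qB)// !(bfZ qB)//.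
by rewrite (bfC qB Vg Vf); ring.
Qed.

Hypothesis q0 : forall f, V f -> 0 <= q f f.

Lemma bf_cauchy_schwarz f g : V f -> V g -> q f g ^+ 2 <= q f f * q g g.
Proof.
move=> Vf Vg; apply: psd_discriminant => s t; rewrite -bf_sqr//.
by apply: q0; apply: VD; exact: VZ.
Qed.

Lemma bf_sqrD_le f g : V f -> V g -> q (f + g) (f + g) <= 2 * q f f + 2 * q g g.
Proof.
move=> Vf Vg; have := q0 (VD (VZ 1 Vf) (VZ (- 1) Vg)).
rewrite bf_sqr//; have := bf_sqr 1 1 Vf Vg; rewrite !scale1r => ->.
by rewrite expr1n sqrrN expr1n; lra.
Qed.

End bilinear_form_on.

Lemma le0_of_cvg0 (R : realType) (x : R) (u : nat -> R) :
  (forall k, x <= u k) -> u k @[k --> \oo] --> (0 : R) -> x <= 0.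
Proof.
by move=> xu u0; apply: (ler_cvg_to (cvg_cst x) u0); apply: nearW.
Qed.

Section maximal_eigenvector.
Context {R : realType} {E : lmodType R} (V : E -> Prop).
Variables (ip B : E -> E -> R) (A : E -> E) (L : R).
Hypotheses (VD : forall f g, V f -> V g -> V (f + g))
  (VZ : forall (a : R) f, V f -> V (a *: f)) (VA : forall f, V f -> V (A f)).
Hypotheses (ipB : bilinear_form_on V ip) (BB : bilinear_form_on V B)
  (ip0 : forall f, V f -> 0 <= ip f f)
  (ipA : forall f g, V f -> V g -> ip (A f) g = B f g).
Hypotheses (L0 : 0 < L) (BL : forall f, V f -> `|B f f| <= L * ip f f)
  (near_max : forall e, 0 < e -> exists f, [/\ V f, ip f f <= 1 & L - e < B f f])
  (compactA : forall f_ : nat -> E, (forall k, V (f_ k)) -> (forall k, ip (f_ k) (f_ k) <= 1) ->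
    exists (s : nat -> nat) g, [/\ {homo s : i j / (i < j)%N}, V g &
      ip (A (f_ (s k)) - g) (A (f_ (s k)) - g) @[k --> \oo] --> (0 : R)]).

Let VN f : V f -> V (- f).
Proof. by move=> Vf; rewrite -scaleN1r; exact: VZ. Qed.

Let VB f g : V f -> V g -> V (f - g).
Proof. by move=> Vf Vg; apply: VD => //; exact: VN. Qed.

Let a f g := L * ip f g - B f g.

Let aB : bilinear_form_on V a.
Proof.
split=> [f g Vf Vg|f g h Vf Vg Vh|r f h Vf Vh]; rewrite /a.
- by rewrite (bfC ipB)// (bfC BB).
- by rewrite (bfD ipB)// (bfD BB)//; ring.
- by rewrite (bfZ ipB)// (bfZ BB)//; ring.
Qed.

Let a0 f : V f -> 0 <= a f f.
Proof. by move=> /BL; rewrite ler_norml /a => /andP[_]; lra. Qed.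

Let a_le f : V f -> a f f <= 2 * L * ip f f.
Proof. by move=> /BL; rewrite ler_norml /a => /andP[]; lra. Qed.

Let residual f := L *: f - A f.

Let ip_residual f w : V f -> V w -> ip (residual f) w = a f w.
Proof.
move=> Vf Vw; rewrite /residual -scaleN1r (bfD ipB) ?(bfZ ipB)//; try exact: VZ.
- by rewrite /a ipA//; ring.
- exact: VA.
- by apply: VZ; exact: VA.
Qed.

(** Cauchy-Schwarz for the nonnegative form [a], tested against the residual [h] itself:
    [ip h h ^+ 2 <= a f f * a h h], and [a h h <= 2 * L * ip h h]. *)
Let residual_le f : V f ->
  ip (residual f) (residual f) <= 2 * L * a f f.
Proof.
move=> Vf; have Vh : V (residual f) by apply: VB; [exact: VZ|exact: VA].
set x := ip _ _; have x0 : 0 <= x by exact: ip0.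
have := bf_cauchy_schwarz VD VZ aB a0 Vf Vh.
rewrite -ip_residual// -/x => h.
have {}h : x * x <= (2 * L * a f f) * x.
  have := a_le Vh; rewrite -/x; have := a0 Vf; move: h; rewrite expr2; nra.
have [xp|xn] := ltP 0 x; first by rewrite ler_pM2r in h.
by apply: le_trans xn _; rewrite !mulr_ge0 ?a0// ltW.
Qed.

(** A sequence [f_] nearly maximizing [B] has defect [a] tending to 0, hence residual tending to 0.
    Along a subsequence [A f_] converges to some [g], so [L *: f_] converges to [g] as well, and [g]
    inherits zero defect. Only compactness of [A] provides a limit; [V] is not assumed complete.
    [ip] may be degenerate, so the conclusion says that the residual has norm 0. *)
Lemma maximal_eigenvector : exists g, [/\ V g, 0 < ip g g &
  ip (L *: g - A g) (L *: g - A g) = 0].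
Proof.
have /choice[f_ Hf] k : exists f, [/\ V f, ip f f <= 1 & L - k.+1%:R^-1 < B f f].
  by apply: near_max; rewrite invr_gt0.
have Vf k : V (f_ k) by have [] := Hf k.
have ipf k : ip (f_ k) (f_ k) <= 1 by have [] := Hf k.
have [s [g [smono Vg cv]]] := compactA Vf ipf.
have VAf k : V (A (f_ k)) by exact: VA.
have sk k : (k <= s k)%N.
  elim: k => [//|k IH]; exact: leq_ltn_trans IH (smono _ _ (ltnSn k)).
have afk k : a (f_ (s k)) (f_ (s k)) <= k.+1%:R^-1.
  have [_ h1 h2] := Hf (s k).
  have : (s k).+1%:R^-1 <= k.+1%:R^-1 :> R by rewrite lef_pV2 ?posrE// ler_nat ltnS sk.
  have h3 : L * ip (f_ (s k)) (f_ (s k)) <= L by rewrite ler_piMr// ltW.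
  move: h2 h3; rewrite /a; set x := L * _; set y := B _ _; set p := _^-1.
  set r := k.+1%:R^-1; move: p r => p r; lra.
pose u k := L *: f_ (s k) - g.
have Vu k : V (u k) by apply: VB => //; exact: VZ.
(* Twice the bound [2 * L / (k + 1)] on the residual plus twice the error of the convergence of
   [A f_]. *)
pose e k := 4 * L * k.+1%:R^-1 + 2 * ip (A (f_ (s k)) - g) (A (f_ (s k)) - g).
have ipu k : ip (u k) (u k) <= e k.
  have -> : u k = residual (f_ (s k)) + (A (f_ (s k)) - g).
    by rewrite /u /residual addrA subrK.
  have Vr : V (residual (f_ (s k))) by apply: VB => //; exact: VZ.
  apply: le_trans (bf_sqrD_le VD VZ ipB ip0 Vr (VB (VAf _) Vg)) _.
  rewrite /e lerD2r; have h1 := residual_le (Vf (s k)).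
  have h2 : 2 * L * a (f_ (s k)) (f_ (s k)) <= 2 * L * k.+1%:R^-1.
    by rewrite ler_pM2l ?mulr_gt0.
  move: h1 h2; set x := ip _ _; set y := 2 * L * a _ _; set p := k.+1%:R^-1.
  by move: p => p; lra.
have e0 : e k @[k --> \oo] --> (0 : R).
  rewrite -(addr0 0); apply: cvgD.
    by rewrite -(mulr0 (4 * L)); apply: cvgMl_tmp; exact: cvg_harmonic.
  by rewrite -(mulr0 2); apply: cvgMl_tmp.
have inv0 : (k.+1%:R^-1 : R) @[k --> \oo] --> (0 : R) by exact: cvg_harmonic.
have Lf k : L *: f_ (s k) = g + u k by rewrite /u addrC subrK.
exists g; split => //.
  (* [L *: f_] is [g + u], and its squared norm is at least [L * (L - 1 / (k + 1))] because
     [L * ip f f >= B f f]; the limit [g] is therefore not null. *)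
  suff : L ^+ 2 - 2 * ip g g <= 0 by have := exprn_gt0 2 L0; lra.
  pose v k := 2 * e k + L * k.+1%:R^-1.
  apply: (@le0_of_cvg0 _ _ v) => [k|]; last first.
    rewrite -(addr0 0); apply: cvgD.
      by rewrite -(mulr0 2); apply: cvgMl_tmp.
    by rewrite -(mulr0 L); apply: cvgMl_tmp.
  have := bf_sqrD_le VD VZ ipB ip0 Vg (Vu k); rewrite -Lf.
  have Vs := Vf (s k); rewrite (bfZ ipB)//; last exact: VZ.
  rewrite (bfC ipB)//; last exact: VZ.
  rewrite (bfZ ipB)//; have := ipu k; rewrite /v.
  have [_ _ h1] := Hf (s k); have := BL Vs; rewrite ler_norml => /andP[_ h2].
  have h3 : (s k).+1%:R^-1 <= k.+1%:R^-1 :> R by rewrite lef_pV2 ?posrE// ler_nat ltnS sk.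
  have : L * (L - k.+1%:R^-1) <= L * (L * ip (f_ (s k)) (f_ (s k))).
    rewrite ler_pM2l//; apply: le_trans h2; apply: le_trans (ltW h1).
    by rewrite lerD2l lerN2.
  set x := L * (L * _); set p := k.+1%:R^-1; move: p => p; rewrite expr2.
  by move: (e k) (ip (u k) (u k)) x => ek uk x; lra.
(* [g] is [L *: f_] minus [u]; the defect of the first and the norm of the second both tend to 0. *)
have agg : a g g <= 0.
  pose v k := 2 * L ^+ 2 * k.+1%:R^-1 + 4 * L * e k.
  apply: (@le0_of_cvg0 _ _ v) => [k|]; last first.
    rewrite -(addr0 0); apply: cvgD.
      by rewrite -(mulr0 (2 * L ^+ 2)); apply: cvgMl_tmp.
    by rewrite -(mulr0 (4 * L)); apply: cvgMl_tmp.
  have gE : g = L *: f_ (s k) + (- 1) *: u k by rewrite Lf scaleN1r addrK.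
  have Vs := Vf (s k).
  have VLs : V (L *: f_ (s k)) by exact: VZ.
  have VNu : V ((- 1) *: u k) by exact: VZ.
  rewrite {1 2}gE; apply: le_trans (bf_sqrD_le VD VZ aB a0 VLs VNu) _.
  have aZZ r f : V f -> a (r *: f) (r *: f) = r ^+ 2 * a f f.
    move=> Vf'; rewrite (bfZ aB)//; last exact: VZ.
    by rewrite (bfC aB)//; [rewrite (bfZ aB)//; ring|exact: VZ].
  rewrite !aZZ// /v sqrrN expr1n mul1r.
  have := a_le (Vu k); have := ipu k; have := afk k; move: L0.
  set x := a _ _; set y := a _ _; set z := ip _ _ => L0' h1 h2 h3.
  apply: lerD; first by rewrite -mulrA ler_pM2l// ler_pM2l// exprn_gt0.
  have : L * z <= L * e k by rewrite ler_pM2l.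
  by move: h3; move: (e k) => ek; lra.
apply/eqP; rewrite eq_le ip0 ?andbT; last by apply: VB; [exact: VZ|exact: VA].
apply: le_trans (residual_le Vg) _.
by rewrite mulr_ge0_le0// mulr_ge0// ltW.
Qed.

End maximal_eigenvector.

(** * Square-integrable functions on a set *)

Section square_integrable.
Context d (T : measurableType d) (R : realType).
Variables (mu : {measure set T -> \bar R}) (U : set T).
Hypothesis mU : measurable U.
Implicit Types f g h : T -> R.

(* Representatives of the elements of L^2(U), extended by zero. *)
Record L2_on f : Prop := L2On {
  L2_on_measurable : measurable_fun [set: T] f ;
  L2_on_finite : (\int[mu]_x (f x ^+ 2)%:E < +oo)%E ;
  L2_on_out : forall x, ~ U x -> f x = 0 }.

Definition ip f g : R := \int[mu]_x (f x * g x).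

Lemma L2_on_sqr_integrable f : L2_on f ->
  mu.-integrable [set: T] (EFin \o (fun x => f x ^+ 2)).
Proof.
case=> mf ff _; apply/integrableP; split.
  by apply/measurable_EFinP; exact: measurable_funX.
rewrite (eq_integral (fun x => (f x ^+ 2)%:E))// => x _ /=.
by rewrite ger0_norm// sqr_ge0.
Qed.

Lemma L2_on_mul_integrable f g : L2_on f -> L2_on g ->
  mu.-integrable [set: T] (EFin \o (fun x => f x * g x)).
Proof.
move=> Lf Lg.
apply: (le_integrable measurableT _ _ (integrableD measurableT
  (L2_on_sqr_integrable Lf) (L2_on_sqr_integrable Lg))).
  by apply/measurable_EFinP; apply: measurable_funM; exact: L2_on_measurable.
move=> x _ /=; rewrite lee_fin [leRHS]ger0_norm ?addr_ge0 ?sqr_ge0// normrM.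
rewrite -(real_normK (num_real (f x))) -(real_normK (num_real (g x))).
by have := sqr_ge0 (`|f x| - `|g x|); have := normr_ge0 (f x); have := normr_ge0 (g x); nra.
Qed.

Lemma L2_on_le f g : L2_on g -> measurable_fun [set: T] f ->
  (forall x, `|f x| <= `|g x|) -> L2_on f.
Proof.
case=> mg gf g0 mf fg; split => // [|x /g0 gx]; last first.
  by have := fg x; rewrite gx normr0 normr_le0 => /eqP.
apply: le_lt_trans gf; apply: ge0_le_integral => //.
- by move=> x _; rewrite lee_fin sqr_ge0.
- by apply/measurable_EFinP; exact: measurable_funX.
- by apply/measurable_EFinP; exact: measurable_funX.
move=> x _; rewrite lee_fin -(real_normK (num_real (f x))) -(real_normK (num_real (g x))).
by rewrite lerXn2r// nnegrE.
Qed.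

Lemma L2_onZ (a : R) f : L2_on f -> L2_on (a *: (f : T -> R^o)).
Proof.
move=> Lf; have [mf ff f0] := Lf; split.
- by apply: measurable_funM.
- rewrite (eq_integral (fun x => (a ^+ 2)%:E * (f x ^+ 2)%:E)%E); last first.
    by move=> x _; rewrite -EFinM -exprMn.
  rewrite ge0_integralZl//; last 3 first.
  + by apply/measurable_EFinP; exact: measurable_funX.
  + by move=> x _; rewrite lee_fin sqr_ge0.
  + by rewrite lee_fin sqr_ge0.
  by rewrite lte_mul_pinfty// lee_fin sqr_ge0.
- by move=> x /f0 fx; rewrite /= fctE fx scaler0.
Qed.

Lemma L2_onD f g : L2_on f -> L2_on g -> L2_on (f + g).
Proof.
move=> Lf Lg; have [mf ff f0] := Lf; have [mg gf g0] := Lg; split.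
- exact: measurable_funD.
- apply: (@le_lt_trans _ _ (\int[mu]_x ((2 * f x ^+ 2)%:E + (2 * g x ^+ 2)%:E))%E).
    apply: ge0_le_integral => //.
    + by move=> x _; rewrite lee_fin sqr_ge0.
    + by apply/measurable_EFinP; apply: measurable_funX; exact: measurable_funD.
    + apply: emeasurable_funD; apply/measurable_EFinP; apply: measurable_funM => //;
        exact: measurable_funX.
    + move=> x _; rewrite -EFinD lee_fin fctE; have := sqr_ge0 (f x - g x).
      by rewrite !expr2; lra.
  rewrite ge0_integralD//; last 4 first.
  + by move=> x _; rewrite lee_fin mulr_ge0// sqr_ge0.
  + by apply/measurable_EFinP; apply: measurable_funM => //; exact: measurable_funX.
  + by move=> x _; rewrite lee_fin mulr_ge0// sqr_ge0.
  + by apply/measurable_EFinP; apply: measurable_funM => //; exact: measurable_funX.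
  have E h : measurable_fun [set: T] h -> (\int[mu]_x (2 * h x ^+ 2)%:E =
      2%:E * \int[mu]_x (h x ^+ 2)%:E)%E.
    move=> mh; rewrite -ge0_integralZl//.
    + by apply/measurable_EFinP; exact: measurable_funX.
    + by move=> x _; rewrite lee_fin sqr_ge0.
  by rewrite !E// lte_add_pinfty// lte_mul_pinfty// lee_fin.
- by move=> x Ux; rewrite fctE f0// g0// addr0.
Qed.

Lemma L2_on_norm f : L2_on f -> L2_on (fun x => `|f x|).
Proof.
move=> Lf; apply: (L2_on_le Lf) => [|x]; last by rewrite normr_id.
by apply: measurableT_comp => //; exact: L2_on_measurable.
Qed.

Lemma ip_bilinear : bilinear_form_on (E := T -> R^o) L2_on ip.
Proof.
split=> [f g Lf Lg|f g h Lf Lg Lh|a f h Lf Lh]; rewrite /ip.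
- by apply: eq_Rintegral => x _; rewrite mulrC.
- rewrite -RintegralD//; try exact: L2_on_mul_integrable.
  by apply: eq_Rintegral => x _; rewrite fctE mulrDl.
- rewrite -RintegralZl//; last exact: L2_on_mul_integrable.
  by apply: eq_Rintegral => x _; rewrite fctE /= /GRing.scale/= mulrA.
Qed.

Lemma ip_ge0 f : L2_on f -> 0 <= ip f f.
Proof.
by move=> Lf; apply: fine_ge0; apply: integral_ge0 => x _; rewrite lee_fin -expr2 sqr_ge0.
Qed.

Lemma ipE f : L2_on f -> ((ip f f)%:E = \int[mu]_x (f x ^+ 2)%:E)%E.
Proof.
case=> _ ff _; rewrite /ip /Rintegral fineK.
  by apply: eq_integral => x _; rewrite expr2.
rewrite (eq_integral (fun x => (f x ^+ 2)%:E)) => [|x _]; last by rewrite expr2.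
by rewrite ge0_fin_numE//; apply: integral_ge0 => x _; rewrite lee_fin sqr_ge0.
Qed.

Lemma ip_eq0 f : L2_on f -> ip f f = 0 -> {ae mu, forall x, f x = 0}.
Proof.
move=> Lf f0; have := ipE Lf; rewrite f0 => /esym E.
have [mf _ _] := Lf.
have m2 : measurable_fun [set: T] (fun x => (f x ^+ 2)%:E).
  by apply/measurable_EFinP; exact: measurable_funX.
have := (ae_eq_integral_abs mu measurableT m2).1.
rewrite (eq_integral (fun x => (f x ^+ 2)%:E)); last first.
  by move=> x _; rewrite gee0_abs// lee_fin sqr_ge0.
move=> /(_ E); apply: filterS => x /(_ I) [/eqP].
by rewrite sqrf_eq0 => /eqP.
Qed.

Lemma eq_ip f g f' g' : L2_on f -> L2_on g -> L2_on f' -> L2_on g' ->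
  {ae mu, forall x, f x * g x = f' x * g' x} -> ip f g = ip f' g'.
Proof.
move=> Lf Lg Lf' Lg' H; rewrite /ip /Rintegral; congr fine.
have m (p q : T -> R) : L2_on p -> L2_on q ->
    measurable_fun [set: T] (fun x => (p x * q x)%:E).
  by move=> [mp _ _] [mq _ _]; apply/measurable_EFinP; exact: measurable_funM.
apply: ae_eq_integral => //; [exact: m|exact: m|].
by apply: filterS H => x h _; rewrite h.
Qed.

Let Lnorm_sqr f : (('N[mu]_2%:E [EFin \o f]) `^ 2 = \int[mu]_x (f x ^+ 2)%:E)%E.
Proof.
rewrite poweR_Lnorm//; apply: eq_integral => x _ /=.
by rewrite powR_mulrn// real_normK// num_real.
Qed.

Lemma L2_onP f : L2_on (f \_ U) <-> in_L2 mu U f.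
Proof.
rewrite /in_L2 inE; split=> [[mf ff _]|/andP[]].
  apply/andP; split; rewrite inE//= /finite_norm.
  apply: (@lty_poweRy _ _ 2) => //.
  by rewrite Lnorm_sqr.
rewrite inE/= => mf; rewrite inE/= /finite_norm => ff; split => //.
  by rewrite -Lnorm_sqr poweR_lty.
by move=> x Ux; rewrite patchE; case: ifP => // /set_mem.
Qed.

Lemma L2_on_restrict f : L2_on f -> f \_ U = f.
Proof.
case=> _ _ f0; apply/funext => x; rewrite patchE; case: ifPn => // /negP xU.
by rewrite f0// => h; apply: xU; exact/mem_set.
Qed.

Lemma L2norm_le1 f : L2_on f -> ip f f <= 1 -> (L2norm mu U f <= 1%:E)%E.
Proof.
move=> Lf f1; rewrite /L2norm (L2_on_restrict Lf) leNgt; apply/negP => h.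
have : (1%:E < ('N[mu]_2%:E [EFin \o f]) `^ 2)%E.
  move: h; case: ('N[mu]_2%:E [EFin \o f])%E => [r| |//].
    rewrite !lte_fin => r1.
    by rewrite powR_mulrn ?expr_gt1// ltW// (lt_trans ltr01).
  by rewrite poweRyr// ltry.
by rewrite Lnorm_sqr -ipE// lte_fin ltNge f1.
Qed.

Lemma L2norm_cvg0 (f_ : nat -> T -> R) : (forall k, L2_on (f_ k \_ U)) ->
  L2norm mu U (f_ k) @[k --> \oo] --> 0%E ->
  ip (f_ k \_ U) (f_ k \_ U) @[k --> \oo] --> (0 : R).
Proof.
move=> Lf /fine_cvgP[fin cv].
have : (fine (L2norm mu U (f_ k)) * fine (L2norm mu U (f_ k))) @[k --> \oo] --> (0 : R).
  by rewrite -[in X in _ --> X](mulr0 0); apply: cvgM; exact: cv.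
apply: cvg_trans; apply: near_eq_cvg.
apply: filterS fin => k fk; apply: EFin_inj.
rewrite ipE// -Lnorm_sqr -/(L2norm mu U (f_ k)).
have N0 : 0 <= fine (L2norm mu U (f_ k)) by apply: fine_ge0; exact: Lnorm_ge0.
move: fk N0; case: (L2norm mu U (f_ k)) => //= r _ r0.
by rewrite powR_mulrn// expr2.
Qed.

End square_integrable.

(** * The energy of a kernel *)

Section kernel_form.
Context d (T : measurableType d) (R : realType).
Variables (mu : {sigma_finite_measure set T -> \bar R}) (k : T -> T -> R).
Hypotheses (mk : measurable_fun [set: T * T] (fun p => k p.1 p.2))
  (k0 : forall x y, 0 <= k x y) (kC : forall x y, k x y = k y x).
Implicit Types f g h : T -> R.

Lemma measurable_kernel_section x : measurable_fun [set: T] (k x).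
Proof. exact: (measurableT_comp mk (pair1_measurable x)). Qed.

Lemma measurable_kernel_mul f g : measurable_fun [set: T] f ->
  measurable_fun [set: T] g ->
  measurable_fun [set: T * T] (fun p => (k p.1 p.2 * (f p.1 * g p.2))%:E).
Proof.
move=> mf mg; apply/measurable_EFinP; apply: measurable_funM => //.
by apply: measurable_funM; apply: measurableT_comp.
Qed.

Lemma measurable_kernel_integral f g : measurable_fun [set: T] f ->
  measurable_fun [set: T] g -> (forall x y, 0 <= f x * g y) ->
  measurable_fun [set: T] (fun x => \int[mu]_y (k x y * (f x * g y))%:E)%E.
Proof.
move=> mf mg fg0; apply: (measurable_fun_fubini_tonelli_F (m2 := mu)
  (fun p => (k p.1 p.2 * (f p.1 * g p.2))%:E)).
  exact: measurable_kernel_mul.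
by move=> p; rewrite lee_fin mulr_ge0.
Qed.

Definition energy f g : \bar R :=
  (\int[mu]_x \int[mu]_y (k x y * (f x * g y))%:E)%E.

Lemma energy_ge0 f g : (forall x y, 0 <= f x * g y) -> (0 <= energy f g)%E.
Proof.
by move=> fg0; apply: integral_ge0 => x _; apply: integral_ge0 => y _; rewrite lee_fin mulr_ge0.
Qed.

Lemma energyC f g : measurable_fun [set: T] f -> measurable_fun [set: T] g ->
  (forall x y, 0 <= f x * g y) -> energy f g = energy g f.
Proof.
move=> mf mg fg0; rewrite /energy.
rewrite (fubini_tonelli (m1 := mu) (m2 := mu)
  (fun p => (k p.1 p.2 * (f p.1 * g p.2))%:E)).
- by apply: eq_integral => y _; apply: eq_integral => x _; rewrite kC [f _ * _]mulrC.
- exact: measurable_kernel_mul.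
- by move=> p; rewrite lee_fin mulr_ge0.
Qed.

(** On [P] the product [|f x| * |g y|] is at most [f x ^+ 2 + g y ^+ 2]; each term is integrated
    first in the other variable, where the row bound [C] applies, using the symmetry of the kernel
    for the second. *)
Lemma schur_test (P : set T) (C : R) f g : measurable P -> 0 <= C ->
  (forall x, P x -> (\int[mu]_(y in P) (k x y)%:E <= C%:E)%E) ->
  measurable_fun [set: T] f -> measurable_fun [set: T] g ->
  (forall x, ~ P x -> f x = 0) -> (forall x, ~ P x -> g x = 0) ->
  (energy (fun x => `|f x|)%R (fun x => `|g x|)%R <=
    C%:E * (\int[mu]_x (f x ^+ 2)%:E + \int[mu]_x (g x ^+ 2)%:E))%E.
Proof.
move=> mP C0 kP mf mg f0 g0.
have m1 : measurable_fun [set: T] (\1_P : T -> R) by exact: measurable_indic.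
have mX h : measurable_fun [set: T] h -> measurable_fun [set: T] (fun x => h x ^+ 2).
  by move=> mh; exact: measurable_funX.
have i0 x : 0 <= \1_P x :> R by rewrite indicE.
have half h : measurable_fun [set: T] h -> (forall x, ~ P x -> h x = 0) ->
    (energy (fun x => h x ^+ 2)%R (\1_P) <= C%:E * \int[mu]_x (h x ^+ 2)%:E)%E.
  move=> mh h0; rewrite -ge0_integralZl//; last 2 first.
  - by apply/measurable_EFinP; exact: mX.
  - by move=> x _; rewrite lee_fin sqr_ge0.
  apply: ge0_le_integral => //.
  - by move=> x _; apply: integral_ge0 => y _; rewrite lee_fin mulr_ge0 ?k0// mulr_ge0 ?sqr_ge0//.
  - by apply: measurable_kernel_integral => [||x y]; first [exact: mX|exact: m1|by rewrite mulr_ge0 ?sqr_ge0].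
  - by apply/measurable_EFinP; apply: measurable_funM => //; exact: mX.
  move=> x _; rewrite (eq_integral (fun y => (h x ^+ 2)%:E * ((EFin \o k x) \_ P) y)%E).
    have mkx : measurable_fun [set: T] ((EFin \o k x) \_ P).
      apply/(measurable_restrict _ _) => //; rewrite setTI; apply: measurable_funTS.
      by apply/measurable_EFinP; exact: measurable_kernel_section.
    rewrite ge0_integralZl//; last 2 first.
    - by move=> y _; rewrite patchE; case: ifP => // _; rewrite lee_fin.
    - by rewrite lee_fin sqr_ge0.
    rewrite -integral_mkcond muleC.
    have [Px|Px] := pselect (P x); last by rewrite h0// expr0n/= !mule0.
    by rewrite lee_wpmul2r ?lee_fin ?sqr_ge0//; exact: kP.
  move=> y _; rewrite indicE patchE; case: ifPn => _; last by rewrite !mulr0 mule0.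
  by rewrite mulr1 /= mulrC EFinM.
rewrite ge0_muleDr; try by apply: integral_ge0 => x _; rewrite lee_fin sqr_ge0.
apply: le_trans (leeD (half f mf f0) (half g mg g0)).
rewrite (@energyC (fun x => g x ^+ 2));
  [|exact: mX|exact: m1|by move=> x y; rewrite mulr_ge0 ?sqr_ge0].
rewrite /energy -ge0_integralD//; last 4 first.
- by move=> x _; apply: integral_ge0 => y _; rewrite lee_fin mulr_ge0 ?k0// mulr_ge0 ?sqr_ge0//.
- by apply: measurable_kernel_integral => [||x y]; first [exact: mX|exact: m1|by rewrite mulr_ge0 ?sqr_ge0].
- by move=> x _; apply: integral_ge0 => y _; rewrite lee_fin mulr_ge0 ?k0// mulr_ge0 ?sqr_ge0//.
- by apply: measurable_kernel_integral => [||x y]; first [exact: mX|exact: m1|by rewrite mulr_ge0 ?sqr_ge0].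
have mn h : measurable_fun [set: T] h -> measurable_fun [set: T] (fun x => `|h x|).
  by move=> mh; exact: measurableT_comp.
have ms (h1 h2 : T -> R) x : measurable_fun [set: T] h2 ->
    measurable_fun [set: T] (fun y => (k x y * (h1 x * h2 y))%:E).
  move=> mh; apply/measurable_EFinP; apply: measurable_funM; first exact: measurable_kernel_section.
  exact: measurable_funM.
apply: ge0_le_integral => //.
- by move=> x _; apply: integral_ge0 => y _; rewrite lee_fin mulr_ge0 ?k0// mulr_ge0.
- by apply: measurable_kernel_integral; [exact: mn|exact: mn|move=> x y; rewrite mulr_ge0].
- by apply: emeasurable_funD; apply: measurable_kernel_integral => [||x y];
    first [exact: mX|exact: m1|by rewrite mulr_ge0 ?sqr_ge0].
move=> x _; rewrite -ge0_integralD//; last 4 first.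
- by move=> y _; rewrite lee_fin mulr_ge0 ?k0// mulr_ge0 ?sqr_ge0//.
- exact: (ms (fun x => f x ^+ 2)).
- by move=> y _; rewrite lee_fin mulr_ge0 ?k0// mulr_ge0 ?sqr_ge0//.
- by apply: (ms (\1_P) (fun x => g x ^+ 2)); exact: mX.
apply: ge0_le_integral => //.
- by move=> y _; rewrite lee_fin mulr_ge0 ?k0// mulr_ge0.
- by apply: (ms (fun x => `|f x|)); exact: mn.
- by apply: emeasurable_funD; [exact: (ms (fun x => f x ^+ 2))|
    by apply: (ms (\1_P) (fun x => g x ^+ 2)); exact: mX].
move=> y _; rewrite -EFinD lee_fin -mulrDr ler_wpM2l// !indicE.
have [Px|Px] := pselect (P x); last first.
  by rewrite f0// normr0 mul0r expr0n/= mul0r add0r mulr_ge0 ?sqr_ge0//.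
have [Py|Py] := pselect (P y); last first.
  by rewrite g0// normr0 mulr0 expr0n/= mulr0 addr0 mulr_ge0 ?sqr_ge0//.
rewrite !mem_set// mulr1 mul1r -(real_normK (num_real (f x))) -(real_normK (num_real (g y))).
have := sqr_ge0 (`|f x| - `|g y|); have := normr_ge0 (f x); have := normr_ge0 (g y).
by rewrite !expr2; nra.
Qed.

Variable U : set T.
Hypothesis mU : measurable U.
Variable C : R.
Hypotheses (C0 : 0 <= C)
  (kU : forall x, U x -> (\int[mu]_(y in U) (k x y)%:E <= C%:E)%E).
Local Notation L2 := (L2_on mu U).

Lemma kernel_form_integrable f g : L2 f -> L2 g ->
  (mu \x mu)%E.-integrable [set: T * T]
    (fun p => (k p.1 p.2 * (f p.1 * g p.2))%:E).
Proof.
move=> [mf ff f0] [mg gf g0].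
apply/integrable12ltyP; first exact: measurable_kernel_mul.
apply: (@le_lt_trans _ _ (C%:E * (\int[mu]_x (f x ^+ 2)%:E + \int[mu]_x (g x ^+ 2)%:E))%E).
  apply: le_trans (schur_test mU C0 kU mf mg f0 g0).
  rewrite /energy; under [X in (_ <= X)%E]eq_integral do
    (under eq_integral do rewrite -normrM -(ger0_norm (k0 _ _)) -normrM).
  by [].
by rewrite lte_mul_pinfty ?lee_fin// lte_add_pinfty.
Qed.

(** The real counterpart of [energy], for functions of any sign. The energy is kept in the extended
    reals because Tonelli then applies with no integrability condition. *)
Definition kform f g : R := \int[(mu \x mu)%E]_p (k p.1 p.2 * (f p.1 * g p.2)).

Lemma kformE f g : L2 f -> L2 g -> (forall x y, 0 <= f x * g y) ->
  ((kform f g)%:E = energy f g)%E.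
Proof.
move=> Lf Lg fg0; rewrite /kform /Rintegral fineK; last first.
  exact: (integrable_fin_num measurableT (kernel_form_integrable Lf Lg)).
rewrite fubini_tonelli1//; last by move=> p; rewrite lee_fin mulr_ge0.
by apply: measurable_kernel_mul; [exact: L2_on_measurable Lf|exact: L2_on_measurable Lg].
Qed.

Definition kop f x : R := \int[mu]_(y in U) (k x y * f y).

Lemma kformC f g : L2 f -> L2 g -> kform f g = kform g f.
Proof.
move=> Lf Lg; rewrite /kform /Rintegral; congr fine.
rewrite -(integral12_prod_meas1 (kernel_form_integrable Lf Lg)).
rewrite -(integral21_prod_meas1 (kernel_form_integrable Lg Lf)).
by apply: eq_integral => x _; apply: eq_integral => y _; rewrite /= kC [f _ * _]mulrC.
Qed.

Lemma kform_bilinear : bilinear_form_on (E := T -> R^o) L2 kform.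
Proof.
split=> [f g|f g h Lf Lg Lh|a f h Lf Lh]; first exact: kformC.
- rewrite /kform -RintegralD//; try exact: kernel_form_integrable.
  by apply: eq_Rintegral => x _; rewrite fctE; ring.
- rewrite /kform -RintegralZl//; last exact: kernel_form_integrable.
  by apply: eq_Rintegral => x _; rewrite fctE /= /GRing.scale/=; ring.
Qed.

Lemma kform_kop f g : L2 f -> L2 g -> L2 (kop f \_ U) ->
  ip mu (kop f \_ U) g = kform f g.
Proof.
move=> Lf Lg Lk; rewrite kformC// /kform /ip /Rintegral; congr fine.
have int := kernel_form_integrable Lg Lf.
rewrite -(integral12_prod_meas1 int).
apply: ae_eq_integral => //.
- apply/measurable_EFinP; apply: measurable_funM.
    exact: L2_on_measurable Lk.
  exact: L2_on_measurable Lg.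
- exact: measurable_fubini_F int.
apply: filterS (ae_integrable1 int) => x ix _ /=.
rewrite patchE; case: ifPn => [_|/negP xU]; last first.
  have g0 : g x = 0 by apply: (L2_on_out Lg) => h; apply: xU; exact: mem_set.
  rewrite mul0r /fubini_F/= g0.
  by rewrite integral0_eq// => y _; rewrite mul0r mulr0.
have E : kop f x * g x = \int[mu]_y (k x y * (g x * f y)).
  (* Integrability is known only for the product with [g x]. Where [g x] is 0 both sides vanish;
     elsewhere dividing by [g x] recovers the section of [f]. *)
  have [->|gx] := eqVneq (g x) 0.
    rewrite mulr0 /Rintegral integral0_eq// => y _.
    by rewrite mul0r mulr0.
  have E y : k x y * f y = (g x)^-1 * (k x y * (g x * f y)).
    by field.
  rewrite /kop Rintegral_mkcond.
  under eq_Rintegral => y _.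
    have -> : ((fun y => k x y * f y) \_ U) y = (g x)^-1 * (k x y * (g x * f y)).
      rewrite -E patchE; case: ifPn => // /negP yU.
      by rewrite (L2_on_out Lf) ?mulr0// => h; apply: yU; exact: mem_set.
    over.
  by rewrite RintegralZl//= mulrAC mulVf// mul1r.
by rewrite E /Rintegral fineK//; exact: integrable_fin_num.
Qed.

Lemma normr_kform_le f : L2 f -> `|kform f f| <= kform (fun x => `|f x|) (fun x => `|f x|).
Proof.
move=> Lf; rewrite /kform; apply: le_trans (le_normr_Rintegral _ (kernel_form_integrable Lf Lf)) _ => //.
rewrite le_eqVlt; apply/orP; left; apply/eqP.
by apply: eq_Rintegral => p _; rewrite !normrM (ger0_norm (k0 _ _)).
Qed.

Lemma kform_le f : L2 f -> `|kform f f| <= 2 * C * ip mu f f.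
Proof.
move=> Lf; have := schur_test mU C0 kU (L2_on_measurable Lf) (L2_on_measurable Lf)
  (L2_on_out Lf) (L2_on_out Lf).
have Ln := L2_on_norm Lf.
rewrite -kformE//.
rewrite -!(ipE Lf) -EFinD -EFinM lee_fin => h.
apply: le_trans (_ : kform (fun x => `|f x|) (fun x => `|f x|) <= _); last first.
  by move: h; lra.
exact: normr_kform_le.
Qed.

(** The inner integral [F] vanishes almost everywhere. If it vanishes at one [x] with [f x] nonzero,
    strict positivity of [k x] kills [f] almost everywhere; otherwise [f] vanishes wherever [F]
    does. *)
Lemma kform_eq0 f : (forall x, U x -> {ae mu, forall y, U y -> 0 < k x y}) ->
  L2 f -> (forall x, 0 <= f x) -> kform f f = 0 -> {ae mu, forall x, f x = 0}.
Proof.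
move=> kpos Lf f0 E; have := kformE Lf Lf (fun x y => mulr_ge0 (f0 x) (f0 y)).
have [mf _ fU] := Lf.
rewrite E => /esym; rewrite /energy => I0.
set F := fun x => (\int[mu]_y (k x y * (f x * f y))%:E)%E in I0.
have mF : measurable_fun [set: T] F.
  by apply: measurable_kernel_integral => // x y; exact: mulr_ge0.
have F0 x : (0 <= F x)%E by apply: integral_ge0 => y _; rewrite lee_fin mulr_ge0 ?k0// mulr_ge0.
have : ae_eq mu [set: T] F (cst 0%E).
  apply/(ae_eq_integral_abs mu measurableT mF).
  by rewrite -[RHS]I0; apply: eq_integral => x _; rewrite gee0_abs.
move=> aeF.
have [bad|good] := pselect (exists x, F x = 0%E /\ f x != 0).
  have [x [Fx fx]] := bad.
  have Ux : U x by apply: contrapT => /fU fx'; rewrite fx' eqxx in fx.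
  have mkx : measurable_fun [set: T] (fun y => (k x y * (f x * f y))%:E).
    apply/measurable_EFinP; apply: measurable_funM; first exact: measurable_kernel_section.
    exact: measurable_funM.
  have : ae_eq mu [set: T] (fun y => (k x y * (f x * f y))%:E) (cst 0%E).
    apply/(ae_eq_integral_abs mu measurableT mkx).
    by rewrite -[RHS]Fx; apply: eq_integral => y _; rewrite gee0_abs// lee_fin mulr_ge0 ?k0// mulr_ge0.
  apply: filterS2 (kpos x Ux) => y kxy /(_ I) [/eqP].
  have [Uy|/fU//] := pselect (U y).
  by rewrite mulf_eq0 gt_eqF ?kxy//= mulf_eq0 (negbTE fx)/= => /eqP.
apply: filterS aeF => x /(_ I) Fx; apply: contrapT => /eqP fx.
by apply: good; exists x.
Qed.

End kernel_form.

(** * The top of the spectrum of a positive kernel *)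

Section kernel_spectrum.
Context d (T : measurableType d) (R : realType).
Variables (mu : {sigma_finite_measure set T -> \bar R}) (k : T -> T -> R).
Hypotheses (mk : measurable_fun [set: T * T] (fun p => k p.1 p.2))
  (k0 : forall x y, 0 <= k x y) (kC : forall x y, k x y = k y x).
Variables (U : set T) (C : R).
Hypotheses (mU : measurable U) (C0 : 0 <= C)
  (kU : forall x, U x -> (\int[mu]_(y in U) (k x y)%:E <= C%:E)%E)
  (kpos : forall x, U x -> {ae mu, forall y, U y -> 0 < k x y})
  (Ufin : (mu U < +oo)%E) (Upos : (0 < mu U)%E).
Local Notation L2 := (L2_on mu U).
Local Notation dot := (ip mu).
Local Notation B := (kform mu k).
Local Notation A := (fun f => kop mu k U f \_ U).
Hypotheses (AL2 : forall f, L2 f -> L2 (A f))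
  (Acompact : forall f_ : nat -> T -> R, (forall i, L2 (f_ i)) ->
    (forall i, dot (f_ i) (f_ i) <= 1) ->
    exists (s : nat -> nat) (g : T -> R^o), [/\ {homo s : i j / (i < j)%N}, L2 g &
      dot ((A (f_ (s i)) : T -> R^o) - g) ((A (f_ (s i)) : T -> R^o) - g)
        @[i --> \oo] --> (0 : R)]).

Let LD (f g : T -> R^o) : L2 f -> L2 g -> L2 (f + g).
Proof. exact: L2_onD. Qed.

Let LZ a (f : T -> R^o) : L2 f -> L2 (a *: f).
Proof. exact: L2_onZ. Qed.

Let ipB : bilinear_form_on (E := T -> R^o) L2 dot.
Proof. exact: ip_bilinear. Qed.

Let BB : bilinear_form_on (E := T -> R^o) L2 B.
Proof. exact: (kform_bilinear mk k0 kC mU C0 kU). Qed.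

Let B0 f : L2 f -> (forall x, 0 <= f x) -> 0 <= B f f.
Proof.
move=> Lf f0; rewrite -lee_fin (kformE mk k0 kC mU C0 kU)//.
  by apply: energy_ge0 => // x y; exact: mulr_ge0.
by move=> x y; exact: mulr_ge0.
Qed.

Let ipZ a (f : T -> R^o) : L2 f -> dot (a *: f) (a *: f) = a ^+ 2 * dot f f.
Proof.
move=> Lf; rewrite (bfZ ipB)//; last exact: LZ.
by rewrite (bfC ipB)//; [rewrite (bfZ ipB)//; ring|exact: LZ].
Qed.

Let BZ a (f : T -> R^o) : L2 f -> B (a *: f) (a *: f) = a ^+ 2 * B f f.
Proof.
move=> Lf; rewrite (bfZ BB)//; last exact: LZ.
by rewrite (bfC BB)//; [rewrite (bfZ BB)//; ring|exact: LZ].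
Qed.

Let S : set R := [set t | exists f, [/\ L2 f, dot f f <= 1 & t = B f f]].
Let L := sup S.

Let L2_0 : L2 (cst 0).
Proof.
split => //.
by rewrite integral0_eq// => x _; rewrite expr0n.
Qed.

Let S_sup : has_sup S.
Proof.
split.
  exists (B (cst 0) (cst 0)), (cst 0); split; [exact: L2_0| |by []].
  by rewrite /ip; rewrite /Rintegral integral0_eq//= => x _; rewrite mul0r.
exists (2 * C) => _ [f [Lf f1 ->]].
apply: le_trans (ler_norm _) _; apply: le_trans (kform_le mk k0 kC mU C0 kU Lf) _.
by rewrite ler_piMr// mulr_ge0.
Qed.

Let B_le f : L2 f -> B f f <= L * dot f f.
Proof.
move=> Lf; have i0 : 0 <= dot f f := ip_ge0 Lf.
have [ipf|/eqP ipf] := pselect (dot f f = 0).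
  rewrite ipf mulr0; apply: le_trans (ler_norm _) _.
  by apply: le_trans (kform_le mk k0 kC mU C0 kU Lf) _; rewrite ipf mulr0.
have {}ipf : 0 < dot f f by rewrite lt_def ipf.
set t := dot f f in ipf i0 *.
have Lg : L2 ((Num.sqrt t)^-1 *: (f : T -> R^o)) by exact: LZ.
have : B ((Num.sqrt t)^-1 *: (f : T -> R^o)) ((Num.sqrt t)^-1 *: (f : T -> R^o)) <= L.
  apply: sup_upper_bound => //; exists ((Num.sqrt t)^-1 *: (f : T -> R^o)); split => //.
  by rewrite ipZ// exprVn sqr_sqrtr// mulVf// gt_eqF.
by rewrite BZ// exprVn sqr_sqrtr// mulrC ler_pdivrMr.
Qed.

Let ip_norm f : dot (fun x => `|f x|) (fun x => `|f x|) = dot f f.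
Proof.
by apply: eq_Rintegral => x _; rewrite -!expr2 real_normK// num_real.
Qed.

Let normB_le f : L2 f -> `|B f f| <= L * dot f f.
Proof.
move=> Lf; apply: le_trans (normr_kform_le mk k0 kC mU C0 kU Lf) _.
by rewrite -(ip_norm f); apply: B_le; exact: L2_on_norm.
Qed.

Let L_gt0 : 0 < L.
Proof.
pose f : T -> R := \1_U.
have Lf : L2 f.
  split; first exact: measurable_indic.
  2: by move=> x Ux; rewrite /f indicE memNset.
  rewrite (eq_integral (fun x => (\1_U x)%:E)); last first.
    by move=> x _; rewrite /f indicE; case: (_ \in _); rewrite ?expr1n ?expr0n.
  by rewrite integral_indic// setIT.
have f0 x : 0 <= f x by rewrite /f indicE.
have Bf : 0 < B f f.
  rewrite lt_def; apply/andP; split; last exact: (B0 Lf f0).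
  apply/eqP => /(kform_eq0 mk k0 kC mU C0 kU kpos Lf f0).
  case=> N [mN N0 sub]; move: Upos; rewrite ltNge => /negP; apply.
  rewrite -N0; apply: le_measure; rewrite ?inE// => x Ux; apply: sub => /=.
  by rewrite /f indicE mem_set// => /eqP; rewrite oner_eq0.
have := B_le Lf; have := ip_ge0 Lf; rewrite le_eqVlt => /predU1P[<-|i0 h].
  by rewrite mulr0 leNgt Bf.
by rewrite -(pmulr_lgt0 _ i0); exact: lt_le_trans h.
Qed.

Let near_sup e : 0 < e -> exists f, [/\ L2 f, forall x, 0 <= f x,
  dot f f <= 1 & L - e < B f f].
Proof.
move=> e0; have [_ [f [Lf f1 ->]] fe] := sup_adherent e0 S_sup.
exists (fun x => `|f x|); split => //; first exact: L2_on_norm.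
  by rewrite ip_norm.
apply: lt_le_trans fe _; apply: le_trans (ler_norm _) _.
exact: (normr_kform_le mk k0 kC mU C0 kU Lf).
Qed.

Let eigen_form m f : L2 f -> {ae mu, forall x, A f x = m * f x} ->
  B f f = m * dot f f.
Proof.
move=> Lf H; rewrite -(kform_kop mk k0 kC mU C0 kU Lf Lf)//; last exact: AL2.
rewrite -(bfZ ipB)//; apply: (@eq_ip _ _ _ mu U) => //; [exact: AL2|exact: LZ|].
by apply: filterS H => x /= ->.
Qed.

(** [l] is the supremum of the form on the unit ball. Passing to [|f|] keeps the norm and does not
    decrease the modulus of the form, so nonnegative functions suffice and [l] bounds the modulus of
    every eigenvalue. The indicator of [U] shows [l > 0], and compactness makes [l] an
    eigenvalue. *)
Lemma kernel_spectrum : exists l, [/\ 0 < l,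
  exists f, [/\ L2 f, 0 < dot f f & {ae mu, forall x, A f x = l * f x}],
  (forall m f, L2 f -> 0 < dot f f -> {ae mu, forall x, A f x = m * f x} ->
    `|m| <= l /\ m <> - l),
  (forall f, L2 f -> (forall x, 0 <= f x) ->
    (energy mu k f f <= l%:E * \int[mu]_x (f x ^+ 2)%:E)%E) &
  (forall e, 0 < e -> exists f, [/\ L2 f, forall x, 0 <= f x,
    (\int[mu]_x (f x ^+ 2)%:E <= 1)%E & ((l - e)%:E < energy mu k f f)%E])].
Proof.
exists L; split => //.
- have [g [Lg g0 gE]] : exists g : T -> R^o, [/\ L2 g, 0 < dot g g &
      dot (L *: g - A g) (L *: g - A g) = 0].
    apply: (@maximal_eigenvector R (T -> R^o) L2 dot B A L) => //.
    - exact: ip_ge0.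
    - by move=> f g Lf Lg; apply: (kform_kop mk k0 kC mU C0 kU) => //; exact: AL2.
    - by move=> e /near_sup[f [? _ ? ?]]; exists f.
  exists g; split => //.
  have LA : L2 (L *: (g : T -> R^o) - (A g : T -> R^o)).
    by apply: LD; [exact: LZ|rewrite -scaleN1r; apply: LZ; exact: AL2].
  apply: filterS (ip_eq0 LA gE) => x /= /eqP.
  by rewrite -[_ x]/(L * g x - A g x) subr_eq0 => /eqP.
- move=> m f Lf ipf /(eigen_form Lf) E.
  split=> [|mL].
    by have := normB_le Lf; rewrite E normrM (gtr0_norm ipf) ler_pM2r.
  (* With [f = p - q], adding the values of the form at [f] and at [|f|] cancels the cross terms:
     [2 * B p p + 2 * B q q <= 0] if [m = - L]. Both parts are then null, against [dot f f > 0]. *)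
  have mf := L2_on_measurable Lf.
  pose p : T -> R^o := fun x => Num.max (f x) 0.
  pose q : T -> R^o := fun x => Num.max (- f x) 0.
  have p0 x : 0 <= p x by rewrite le_max lexx orbT.
  have q0 x : 0 <= q x by rewrite le_max lexx orbT.
  have Lp : L2 p.
    apply: (L2_on_le Lf) => [|x]; first exact: measurable_maxr.
    by rewrite ger0_norm// /p ge_max ler_norm/=.
  have Lq : L2 q.
    apply: (L2_on_le Lf) => [|x]; first by apply: measurable_maxr => //; exact: measurableT_comp.
    by rewrite ger0_norm// /q ge_max -normrN ler_norm/=.
  have fE : f = 1 *: p + (- 1) *: q.
    apply/funext => x; rewrite -[RHS]/(1 * p x + (- 1) * q x) /p /q.
    by case: (leP (f x) 0) => h; case: (leP (- f x) 0) => h'; lra.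
  have nE : (fun x => `|f x|) = 1 *: p + 1 *: q.
    apply/funext => x; rewrite -[RHS]/(1 * p x + 1 * q x) /p /q.
    by case: (leP (f x) 0) => h; case: (leP (- f x) 0) => h';
      rewrite ?(ler0_norm h) ?(gtr0_norm h); lra.
  have := B_le (L2_on_norm Lf); rewrite ip_norm.
  have := E; rewrite mL nE {1 2}fE !(bf_sqr LD LZ BB)// => E1 E2.
  have [Bp Bq] := (B0 Lp p0, B0 Lq q0).
  have [Ep Eq] : B p p = 0 /\ B q q = 0.
    by move: E1 E2; rewrite !expr2; split; lra.
  have zp := kform_eq0 mk k0 kC mU C0 kU kpos Lp p0 Ep.
  have zq := kform_eq0 mk k0 kC mU C0 kU kpos Lq q0 Eq.
  have : dot f f = dot (cst 0) (cst 0).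
    apply: (@eq_ip _ _ _ mu U) => //.
    apply: filterS2 zp zq => x hp hq.
    have -> : f x = 1 * p x + (- 1) * q x by rewrite {1}fE.
    by rewrite hp hq !mulr0 addr0 !mul0r.
  move=> i0; move: ipf; rewrite i0 /ip /Rintegral integral0_eq ?ltxx//.
  by move=> x _; rewrite mul0r.
- move=> f Lf f0; rewrite -(kformE mk k0 kC mU C0 kU)//; last first.
    by move=> x y; exact: mulr_ge0.
  by rewrite -(ipE Lf) -EFinM lee_fin B_le.
- move=> e /near_sup[f [Lf f0 f1 fe]]; exists f; split => //.
    by rewrite -(ipE Lf) lee_fin.
  rewrite -(kformE mk k0 kC mU C0 kU)//.
  by move=> x y; exact: mulr_ge0.
Qed.

End kernel_spectrum.

(** * The largest eigenvalue as a supremum of energies *)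

Section largest_eigenvalue.
Context {R : realType} (M : space_form) {n : nat} (K : R -> R).
Local Notation P := (@space_points R M n).
Local Notation d := (@gdist R M n).
Local Notation mu := (@riemM R M n).
Local Notation rmu := (@riemannian_measure R M n).
Local Notation kK := (@kern R M n K).
Implicit Types x y z w : 'rV[R]_n.+1.
Hypotheses (n0 : (0 < n)%N) (K_pos : forall t, 0 < t -> 0 < K t)
  (K_noninc : forall s t, 0 < s -> s <= t -> K t <= K s)
  (K_locint : forall x, P x -> glocally_integrable M (fun y => K (d x y))).
Variable U : set 'rV[R]_n.+1.
Hypotheses (U0 : U !=set0) (Ub : gbounded M U) (Uo : gopen M U)
  (Uc : compact_operator rmu U (kernel_operator M K U)).

Let UP : U `<=` P. Proof. by have [] := Uo. Qed.

Let mU : measurable U. Proof. exact: measurable_gopen Uo. Qed.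

Let L2_riemM f : L2_on rmu U f <-> L2_on mu U f.
Proof. by split=> [[]|[]]. Qed.

Lemma ae_neq x : {ae mu, forall y, x <> y}.
Proof.
exists [set x]; split; [exact: measurable_rV_set1|exact: riemM_set1|].
by move=> y /= /contrapT ->.
Qed.

(** The two integrands differ only at [y = x], a null set. Measurability of the original one is
    obtained by adding to the other a multiple of the indicator of [[set x]]. *)
Lemma kernel_operatorE f x : P x -> L2_on mu U f ->
  kernel_operator M K U f x = kop mu kK U f x.
Proof.
move=> Px Lf; rewrite /kernel_operator /kop /Rintegral; congr fine.
have mf := L2_on_measurable Lf; have mk := measurable_kern1 M K_noninc x.
have mKf : measurable_fun U (fun y => (kK x y * f y)%:E).
  by apply: measurable_funTS; apply/measurable_EFinP; exact: measurable_funM.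
apply: ae_eq_integral => //.
- have E : {in U, (fun y => (kK x y * f y + K (d x x) * f x * \1_[set x] y)%:E) =1
      (fun y => (K (d x y) * f y)%:E)}.
    move=> y /set_mem /UP Py; have [<-|xy] := eqVneq x y.
      by rewrite /kern clamped_distE// gdistxx// ltxx mul0r add0r indicE mem_set// mulr1.
    rewrite kernE//; last exact/eqP.
    by rewrite indicE memNset ?mulr0 ?addr0// => /esym/eqP; exact/negP.
  apply: (eq_measurable_fun _ E); apply: measurable_funTS; apply/measurable_EFinP.
  apply: measurable_funD; first exact: measurable_funM.
  by apply: measurable_funM => //; apply: measurable_indic; exact: measurable_rV_set1.
- apply: filterS (ae_neq x) => y xy /UP Py.
  by rewrite kernE.
Qed.

Lemma kernel_operator_restrict f :
  kernel_operator M K U (f \_ U) = kernel_operator M K U f.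
Proof.
apply/funext => x; apply: eq_Rintegral => y Uy.
by rewrite patchE Uy.
Qed.

(** The interface between spectral theory and geometry: the eigenvalue is described through energies
    of nonnegative functions, which are what polarization compares. Uniqueness holds because a
    dominant eigenvalue has modulus [l] and [- l] is excluded. *)
Lemma largest_eigenvalue_energy : exists l, [/\ 0 < l,
  (forall m, largest_eigenvalue rmu U (kernel_operator M K U) m <-> m = l),
  (forall f, L2_on mu U f -> (forall x, 0 <= f x) ->
    (energy mu kK f f <= l%:E * \int[mu]_x (f x ^+ 2)%:E)%E) &
  (forall e, 0 < e -> exists f, [/\ L2_on mu U f, forall x, 0 <= f x,
    (\int[mu]_x (f x ^+ 2)%:E <= 1)%E & ((l - e)%:E < energy mu kK f f)%E])].
Proof.
have [p [r [Pp Ur]]] := Ub.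
have [C C0 kC] := kern_schur K_pos K_noninc K_locint r Pp.
have mB := measurable_gball r Pp.
have kU x : U x -> (\int[mu]_(y in U) (kK x y)%:E <= C%:E)%E.
  move=> Ux; apply: le_trans (kC x (UP Ux)).
  apply: ge0_subset_integral => //.
    by apply: measurable_funTS; apply/measurable_EFinP; exact: measurable_kern1.
  by move=> y _; rewrite lee_fin kern_ge0.
have kpos x : U x -> {ae mu, forall y, U y -> 0 < kK x y}.
  by move=> Ux; apply: filterS (ae_neq x) => y xy Uy; apply: kern_gt0 => //; exact: UP.
have Ufin : (mu U < +oo)%E.
  apply: le_lt_trans (riemM_gball_finite r Pp).
  by apply: le_measure; rewrite ?inE.
have Upos : (0 < mu U)%E.
  have [x Ux] := U0; have [e e0 xe] := Uo.2 x Ux.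
  apply: lt_le_trans (riemM_gball_gt0 (UP Ux) e0) _.
  by apply: le_measure; rewrite ?inE//; apply: measurable_gball; exact: UP.
have AE f : L2_on mu U f -> kernel_operator M K U f \_ U = kop mu kK U f \_ U.
  move=> Lf; apply/funext => x; rewrite !patchE; case: ifPn => // /set_mem Ux.
  by rewrite kernel_operatorE//; exact: UP.
have in_L2P f : in_L2 rmu U f <-> L2_on mu U (f \_ U).
  by rewrite -L2_riemM; split=> /L2_onP; exact.
have AL2 f : L2_on mu U f -> L2_on mu U (kop mu kK U f \_ U).
  move=> Lf; rewrite -AE// -in_L2P; apply: Uc.1.
  by rewrite in_L2P (L2_on_restrict Lf).
have [|l [l0 [g [Lg g0 gE]] lmax lE lsup]] := @kernel_spectrum _ _ R mu kK
  (measurable_kern M K_noninc) (kern_ge0 M K_pos) (kernC M K) U C mU C0 kU kpos Ufin Upos AL2.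
  move=> f_ Lf f1.
  have [] := Uc.2 f_.
  - by move=> k; rewrite in_L2P (L2_on_restrict (Lf k)).
  - by exists 1 => k; apply: L2norm_le1 => //; [exact/L2_riemM|exact: f1].
  move=> s [h [smono Lh cv]]; exists s, (h \_ U); split => //; first exact/in_L2P.
  have E k : (kernel_operator M K U (f_ (s k)) \- h) \_ U =
      ((kop mu kK U (f_ (s k)) \_ U : _ -> R^o) - (h \_ U : _ -> R^o)).
    rewrite -AE//; apply/funext => x; rewrite patchE.
    rewrite -[RHS]/((kernel_operator M K U (f_ (s k)) \_ U) x - (h \_ U) x) !patchE.
    by case: ifPn => // _; rewrite subr0.
  under eq_fun do rewrite -E.
  apply: (@L2norm_cvg0 _ _ _ rmu) => // k; rewrite L2_riemM E.
  apply: L2_onD => //; first exact: AL2.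
  by rewrite -scaleN1r; apply: L2_onZ => //; exact/in_L2P.
have eigenP m : L2_eigenvalue rmu U (kernel_operator M K U) m <->
    exists f, [/\ L2_on mu U f, 0 < ip mu f f &
      {ae mu, forall x, (kop mu kK U f \_ U) x = m * f x}].
  split=> [[f [Lf f0 fE]]|[f [Lf f0 fE]]].
    exists (f \_ U); have LfU : L2_on mu U (f \_ U) by exact/in_L2P.
    split => //.
      rewrite lt_def (ip_ge0 LfU) andbT; apply/eqP => /(ip_eq0 LfU) h; apply: f0.
      apply: filterS h => x + Ux; by rewrite patchE mem_set.
    apply: filterS fE => x; rewrite -AE// kernel_operator_restrict !patchE.
    by case: ifPn => [/set_mem Ux ->|]; rewrite ?mulr0.
  exists f; split; first by rewrite in_L2P (L2_on_restrict Lf).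
    move=> h; move: f0; rewrite (_ : ip mu f f = 0) ?ltxx//.
    apply/EFin_inj; rewrite (ipE Lf); apply/eqP.
    have mf := L2_on_measurable Lf.
    rewrite (ae_eq_integral (cst 0%E)) ?integral0//.
    - by apply/measurable_EFinP; exact: measurable_funX.
    apply: filterS h => x hx _; have [/hx ->|/(L2_on_out Lf) ->] := pselect (U x);
      by rewrite expr0n.
  apply: filterS fE => x + Ux; rewrite -AE// patchE mem_set//.
exists l; split => // m; split=> [[/eigenP[f [Lf f0 fE]] mmax]|->].
  have [ml mNl] := lmax m f Lf f0 fE.
  have lm : `|l| <= `|m| by apply: mmax; apply/eigenP; exists g.
  have {ml lm} : `|m| == l by rewrite eq_le ml/=; rewrite (gtr0_norm l0) in lm.
  by rewrite eqr_norml => /andP[/orP[/eqP//|/eqP/mNl]].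
split; first by apply/eigenP; exists g.
move=> m' /eigenP[f [Lf f0 fE]]; rewrite (gtr0_norm l0).
by have [] := lmax m' f Lf f0 fE.
Qed.

End largest_eigenvalue.

(** * Polarization *)

Section polarization.
Context {R : realType} (M : space_form) {n : nat}.
Local Notation T := 'rV[R]_n.+1.
Local Notation P := (@space_points R M n).
Local Notation mu := (@riemM R M n).
Variables (s : T -> T) (H : T -> bool).
Hypothesis rs : is_reflection M s H.
Implicit Types (f : T -> R) (x y z w : T).

Let sK : involutive s := reflectionK rs.

Definition pol f z : R :=
  if H z then Num.max (f z) (f (s z)) else Num.min (f z) (f (s z)).

Lemma pol_order f z : if H z then pol f (s z) <= pol f z else pol f z <= pol f (s z).
Proof.
rewrite /pol sK; case: (boolP (H z)) => Hz.
  case: (boolP (H (s z))) => Hs; first by rewrite (side_fix rs Hz Hs).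
  by rewrite ge_min !le_max lexx orbT.
have := side_reflection rs z; rewrite (negbTE Hz)/= => ->.
by rewrite ge_min !le_max lexx orbT.
Qed.

Lemma pol_pair f z : (pol f z = f z /\ pol f (s z) = f (s z)) \/
  (pol f z = f (s z) /\ pol f (s z) = f z).
Proof.
rewrite /pol sK; case: (boolP (H z)) => Hz; case: (boolP (H (s z))) => Hs.
- by rewrite (side_fix rs Hz Hs) maxxx; left.
- by case: (leP (f z) (f (s z))) => _; [right|left].
- by case: (leP (f z) (f (s z))) => _; [left|right].
- by have := side_reflection rs z; rewrite (negbTE Hz) (negbTE Hs).
Qed.

Lemma measurable_pol f : measurable_fun [set: T] f -> measurable_fun [set: T] (pol f).
Proof.
move=> mf; have ms := measurable_reflection rs.
have mfs : measurable_fun [set: T] (fun z => f (s z)) by exact: measurableT_comp.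
apply: measurable_fun_ifT; first exact: (measurable_side rs).
  exact: measurable_maxr.
exact: measurable_minr.
Qed.

Lemma pol_ge0 f : (forall z, 0 <= f z) -> forall z, 0 <= pol f z.
Proof. by move=> f0 z; have [[-> _]|[-> _]] := pol_pair f z. Qed.

Lemma reflection_out z : ~ P z -> ~ P (s z).
Proof. by move=> Pz /(reflection_points rs); rewrite sK. Qed.

Lemma pol_out f : (forall z, ~ P z -> f z = 0) -> forall z, ~ P z -> pol f z = 0.
Proof.
move=> f0 z Pz; have [[-> _]|[-> _]] := pol_pair f z; apply: f0 => //.
exact: reflection_out.
Qed.

(** Doubling an integral replaces its integrand by a sum over the pair {z, s z}. Statements about
    polarized functions thus reduce to pairs, without cutting the space along the mirror. *)
Lemma integral_reflection_pair (h : T -> \bar R) : measurable_fun [set: T] h ->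
  (forall z, 0 <= h z)%E ->
  (\int[mu]_z h z + \int[mu]_z h z = \int[mu]_z (h z + h (s z)))%E.
Proof.
move=> mh h0; rewrite ge0_integralD//; last first.
  by apply: measurableT_comp => //; exact: (measurable_reflection rs).
by rewrite (ge0_integral_reflection rs mh h0).
Qed.

Lemma adde_double_inj (a b : \bar R) : (0 <= a)%E -> (0 <= b)%E ->
  (a + a <= b + b)%E -> (a <= b)%E.
Proof.
case: a => [a| |]; case: b => [b| |] //=; rewrite ?leey// -?EFinD ?lee_fin => *; lra.
Qed.

(* Polarization permutes the values within each pair {z, s z}. *)
Lemma ge0_integral_pol (G : R -> \bar R) f : measurable_fun [set: R] G ->
  (forall t, 0 <= G t)%E -> measurable_fun [set: T] f ->
  (\int[mu]_z G (pol f z) = \int[mu]_z G (f z))%E.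
Proof.
move=> mG G0 mf.
have mGf h : measurable_fun [set: T] h -> measurable_fun [set: T] (fun z => G (h z)).
  by move=> mh; exact: measurableT_comp.
suff E : (\int[mu]_z G (pol f z) + \int[mu]_z G (pol f z) =
    \int[mu]_z G (f z) + \int[mu]_z G (f z))%E.
  by apply/le_anti/andP; split; apply: adde_double_inj; rewrite ?E//; exact: integral_ge0.
rewrite !integral_reflection_pair//.
- by apply: eq_integral => z _; have [[-> ->]|[-> ->]] := pol_pair f z; rewrite 1?addeC.
- exact: mGf.
- by apply: mGf; exact: measurable_pol.
Qed.

Variable K : R -> R.
Hypotheses (n0 : (0 < n)%N) (K_pos : forall t, 0 < t -> 0 < K t)
  (K_noninc : forall s t, 0 < s -> s <= t -> K t <= K s).
Local Notation kK := (@kern R M n K).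
Let mk := @measurable_kern R M n K K_noninc.
Let k0 := @kern_ge0 R M n K K_pos.

Let four f x y : R := (kK x y * (f x * f y) + kK x (s y) * (f x * f (s y))) +
  (kK (s x) y * (f (s x) * f y) + kK (s x) (s y) * (f (s x) * f (s y))).

(** The two-point rearrangement inequality: the right side minus the left side is 0 if both pairs
    are kept or both exchanged, and [(a - b) * (X - X') * (Y - Y')] otherwise. *)
Let rearrange (a b x x' y y' X X' Y Y' : R) :
  X = x /\ X' = x' \/ X = x' /\ X' = x -> Y = y /\ Y' = y' \/ Y = y' /\ Y' = y ->
  0 <= (a - b) * (X - X') * (Y - Y') ->
  a * (x * y) + b * (x * y') + (b * (x' * y) + a * (x' * y')) <=
  a * (X * Y) + b * (X * Y') + (b * (X' * Y) + a * (X' * Y')).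
Proof. by move=> [[-> ->]|[-> ->]] [[-> ->]|[-> ->]]; lra. Qed.

Let null_terms (a b a' b' p q p' q' : R) : p = 0 -> q = 0 -> p' = 0 -> q' = 0 ->
  a * p + b * q + (a' * p' + b' * q') <= 0.
Proof. by move=> -> -> -> ->; rewrite !mulr0 !addr0. Qed.

(** The kernel takes two values on the four pairs, the larger one on pairs lying on the same side;
    [pol_order] gives the matching signs of the differences. Coincident points are excluded because
    [kern] is 0 on the diagonal and not monotone there. *)
Let four_pol f x y : P x -> P y -> x <> y -> s x <> y -> four f x y <= four (pol f) x y.
Proof.
move=> Px Py xy sxy.
have [Psx Psy] := (reflection_points rs Px, reflection_points rs Py).
have xsy : x <> s y by move=> E; apply: sxy; rewrite E sK.
have sxsy : s x <> s y by move=> E; apply: xy; rewrite -(sK x) E sK.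
have E1 : kK (s x) (s y) = kK x y := kern_reflection K x y rs.
have E2 : kK (s x) y = kK x (s y) by have := kern_reflection K x (s y) rs; rewrite sK.
have closer z w : P z -> P w -> z <> w -> z <> s w -> H z -> H w -> kK z (s w) <= kK z w.
  move=> Pz Pw zw zsw Hz Hw.
  exact: (@kern_le R M n K K_noninc z w z (s w) Pz Pw Pz (reflection_points rs Pw) zw zsw
    (side_closer rs Pz Pw Hz Hw)).
have C1 : H x -> H y -> kK x (s y) <= kK x y by exact: closer.
have C2 : H x -> H (s y) -> kK x y <= kK x (s y) by have := closer x (s y); rewrite sK; apply.
have C3 : H (s x) -> H y -> kK (s x) (s y) <= kK (s x) y.
  by have := closer (s x) y; apply=> //; exact.
have C4 : H (s x) -> H (s y) -> kK (s x) y <= kK (s x) (s y).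
  by have := closer (s x) (s y); rewrite sK; apply.
move: E1 E2 C1 C2 C3 C4; rewrite /four.
generalize (kK x y) (kK x (s y)) (kK (s x) y) (kK (s x) (s y)) => a b b' a' -> -> C1 C2 C3 C4.
apply: rearrange; [exact: pol_pair|exact: pol_pair|].
have := pol_order f x; have := pol_order f y.
have := side_reflection rs x; have := side_reflection rs y.
case: (boolP (H x)) => Hx; case: (boolP (H y)) => Hy /= Hsy Hsx hy hx.
- by rewrite mulr_ge0 ?mulr_ge0 ?subr_ge0 ?C1.
- by rewrite mulr_le0 ?mulr_le0_ge0 ?subr_ge0 ?subr_le0 ?C2.
- by rewrite mulr_ge0 ?mulr_le0 ?subr_ge0 ?subr_le0 ?C3.
- by rewrite mulr_le0 ?mulr_ge0_le0 ?subr_ge0 ?subr_le0 ?C4.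
Qed.

Let ms : measurable_fun [set: T] s := measurable_reflection rs.

Let mfour f : measurable_fun [set: T] f ->
  measurable_fun [set: T * T] (fun p => four f p.1 p.2).
Proof.
move=> mf.
have m (a b : T -> T) : measurable_fun [set: T] a -> measurable_fun [set: T] b ->
    measurable_fun [set: T * T] (fun p => kK (a p.1) (b p.2) * (f (a p.1) * f (b p.2))).
  move=> ma mb.
  have ma1 : measurable_fun [set: T * T] (fun p => a p.1) by exact: measurableT_comp.
  have mb2 : measurable_fun [set: T * T] (fun p => b p.2) by exact: measurableT_comp.
  apply: measurable_funM.
    exact: (measurableT_comp mk (measurable_fun_pair ma1 mb2)).
  by apply: measurable_funM; exact: measurableT_comp.
by apply: measurable_funD; apply: measurable_funD;
  [exact: (m id id)|exact: (m id s)|exact: (m s id)|exact: (m s s)].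
Qed.

Let four_ge0 f x y : (forall z, 0 <= f z) -> 0 <= four f x y.
Proof. by move=> f0; rewrite /four !addr_ge0// mulr_ge0 ?k0// mulr_ge0. Qed.

Let energy_four f : measurable_fun [set: T] f -> (forall z, 0 <= f z) ->
  (\int[mu]_x \int[mu]_y (four f x y)%:E =
   (energy mu kK f f + energy mu kK f f) + (energy mu kK f f + energy mu kK f f))%E.
Proof.
move=> mf f0; pose F x := (\int[mu]_y (kK x y * (f x * f y))%:E)%E.
have ff0 x y : 0 <= f x * f y by exact: mulr_ge0.
have F0 x : (0 <= F x)%E by apply: integral_ge0 => y _; rewrite lee_fin mulr_ge0 ?k0.
have mF : measurable_fun [set: T] F by exact: measurable_kernel_integral.
have E x : (F x + F x = \int[mu]_y
    (kK x y * (f x * f y) + kK x (s y) * (f x * f (s y)))%:E)%E.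
  rewrite integral_reflection_pair// => [|y]; last by rewrite lee_fin mulr_ge0 ?k0.
  apply/measurable_EFinP; apply: measurable_funM; first exact: measurable_kern1.
  exact: measurable_funM.
rewrite /energy -/F integral_reflection_pair//.
have mFs : measurable_fun [set: T] (fun x => F x + F (s x))%E.
  by apply: emeasurable_funD => //; exact: measurableT_comp.
rewrite -ge0_integralD//;
  try by move=> x _; exact: adde_ge0 (F0 x) (F0 (s x)).
have m2 x : measurable_fun [set: T]
    (fun y => (kK x y * (f x * f y) + kK x (s y) * (f x * f (s y)))%:E).
  apply/measurable_EFinP; apply: measurable_funD; apply: measurable_funM.
  - exact: measurable_kern1.
  - exact: measurable_funM.
  - by apply: (measurableT_comp _ ms); exact: measurable_kern1.
  - by apply: measurable_funM => //; exact: measurableT_comp.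
apply: eq_integral => x _; rewrite addeACA !E -ge0_integralD//.
- by move=> y _; rewrite lee_fin addr_ge0// mulr_ge0 ?k0.
- by move=> y _; rewrite lee_fin addr_ge0// mulr_ge0 ?k0.
Qed.

Lemma energy_pol f : measurable_fun [set: T] f -> (forall z, 0 <= f z) ->
  (forall z, ~ P z -> f z = 0) ->
  (energy mu kK f f <= energy mu kK (pol f) (pol f))%E.
Proof.
move=> mf f0 fP.
have mp := measurable_pol mf; have p0 := pol_ge0 f0.
have e0 g : (forall z, 0 <= g z) -> (0 <= energy mu kK g g)%E.
  by move=> g0; apply: energy_ge0 => // x y; exact: mulr_ge0.
have [Ef Ep] := (e0 _ f0, e0 _ p0).
(* The integral of [four] is four times the energy, hence two halvings. *)
apply: (adde_double_inj Ef Ep); apply: (adde_double_inj (adde_ge0 Ef Ef) (adde_ge0 Ep Ep)).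
rewrite -(energy_four mf f0) -(energy_four mp p0).
apply: ge0_le_integral => //.
- by move=> x _; apply: integral_ge0 => y _; rewrite lee_fin four_ge0.
- apply: (measurable_fun_fubini_tonelli_F (m2 := mu) (fun p => (four f p.1 p.2)%:E)).
    by apply/measurable_EFinP; exact: mfour.
  by move=> p; rewrite lee_fin four_ge0.
- apply: (measurable_fun_fubini_tonelli_F (m2 := mu) (fun p => (four (pol f) p.1 p.2)%:E)).
    by apply/measurable_EFinP; exact: mfour.
  by move=> p; rewrite lee_fin four_ge0.
move=> x _.
have m1 g : measurable_fun [set: T] g -> measurable_fun [set: T] (fun y => (four g x y)%:E).
  move=> mg; apply/measurable_EFinP.
  exact: (measurableT_comp (mfour mg) (pair1_measurable x)).
apply: ae_ge0_le_integral => //.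
- by move=> y _; rewrite lee_fin four_ge0.
- exact: m1.
- by move=> y _; rewrite lee_fin four_ge0.
- exact: m1.
apply: filterS2 (ae_neq M n0 x) (ae_neq M n0 (s x)) => y xy sxy _; rewrite lee_fin.
have four0 : f x * f y = 0 -> f x * f (s y) = 0 -> f (s x) * f y = 0 ->
    f (s x) * f (s y) = 0 -> four f x y <= four (pol f) x y.
  move=> h1 h2 h3 h4; apply: (@le_trans _ _ 0); last exact: four_ge0.
  by rewrite (null_terms (kK x y) (kK x (s y)) (kK (s x) y) (kK (s x) (s y)) h1 h2 h3 h4).
have [Px|Px] := pselect (P x); last first.
  by apply: four0; rewrite ?(fP x Px) ?(fP (s x) (reflection_out Px)) mul0r.
have [Py|Py] := pselect (P y); last first.
  by apply: four0; rewrite ?(fP y Py) ?(fP (s y) (reflection_out Py)) mulr0.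
exact: four_pol.
Qed.

End polarization.

Lemma small_measure d (T : measurableType d) (R : realType)
    (nu : {measure set T -> \bar R}) (A : nat -> set T) (e : R) :
  (forall k, measurable (A k)) -> (forall i j, (i <= j)%N -> A j `<=` A i) ->
  (nu (A 0%N) < +oo)%E -> nu (\bigcap_k A k) = 0%E -> 0 < e ->
  exists k, (nu (A k) <= e%:E)%E.
Proof.
move=> mA dA A0 AI e0.
have := nonincreasing_cvg_mu A0 mA (bigcap_measurable (ex_intro _ 0%N I) (fun k _ => mA k)).
rewrite AI => /(_ _)/fine_cvgP[].
  by move=> i j ij; apply/subsetPset; exact: dA.
move=> fin cv; move/cvgr0Pnorm_lt: cv => /(_ _ e0) small.
have [k [fk]] := filter_ex (filterI fin small).
move: fk => /= fk h; exists k; rewrite -(fineK fk) lee_fin.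
exact: le_trans (ler_norm _) (ltW h).
Qed.

(** * Energy on sets of small measure *)

Section small_sets.
Context {R : realType} (M : space_form) {n : nat} (K : R -> R).
Local Notation T := 'rV[R]_n.+1.
Local Notation P := (@space_points R M n).
Local Notation d := (@gdist R M n).
Local Notation mu := (@riemM R M n).
Local Notation kK := (@kern R M n K).
Implicit Types (x y z w p : T) (f g h : T -> R).

Hypotheses (n0 : (0 < n)%N) (K_pos : forall t, 0 < t -> 0 < K t)
  (K_noninc : forall s t, 0 < s -> s <= t -> K t <= K s)
  (K_locint : forall x, P x -> glocally_integrable M (fun y => K (d x y))).
Let mk := @measurable_kern R M n K K_noninc.
Let k0 := @kern_ge0 R M n K K_pos.

(** The balls about [p] shrink to a null set, so their measure with density [kern p] tends to 0;
    homogeneity carries the bound from [p] to every centre. *)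
Lemma integral_kern_gball_small p (e : R) : P p -> 0 < e -> exists2 t : R, 0 < t &
  forall x, P x -> (\int[mu]_(y in gball M x t) (kK x y)%:E <= e%:E)%E.
Proof.
move=> Pp e0; have [r0 r00 int] := K_locint Pp Pp.
have mw : measurable_fun [set: T] (fun y => (kK p y)%:E).
  by apply/measurable_EFinP; exact: measurable_kern1.
have w0 y : (0 <= (kK p y)%:E)%E by rewrite lee_fin k0.
pose A k := gball M p (r0 / k.+1%:R).
have mA k : measurable (A k) by exact: measurable_gball.
have [k Ak] : exists k, (density_measure mu mw w0 (A k) <= e%:E)%E.
  apply: small_measure => //.
  - move=> i j ij; apply: gball_sub.
    by rewrite ler_pM2l// lef_pV2 ?posrE// ler_nat.
  - rewrite /density_measure /A divr1; have /integrableP[mK] := int; apply: le_lt_trans.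
    apply: ge0_le_integral => //; [exact: measurable_gball|exact: measurable_funTS| |].
      exact: measurableT_comp.
    move=> y [Py _]; rewrite /= lee_fin; have [<-|/eqP py] := eqVneq p y.
      by rewrite /kern clamped_distE// gdistxx// ltxx.
    by rewrite kernE// ler_norm.
  - rewrite (_ : \bigcap_k A k = [set p]); last first.
      apply/seteqP; split => [z zA|_ -> k _]; last first.
        by split => //; rewrite gdistxx// divr_gt0.
      have [Pz _] := zA 0%N I.
      apply/eqP; apply: contrapT => /negP/eqP zp.
      have dz := gdist_gt0 Pz Pp zp.
      have [_] := zA (Num.truncn (r0 / d z p)) I.
      rewrite ltNge => /negP; apply; rewrite ler_pdivrMr//.
      by rewrite mulrC -ler_pdivrMr//; apply: ltW; exact: truncnS_gt.
    by rewrite /density_measure; apply: null_set_integral => //;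
      [exact: measurable_rV_set1|exact: measurable_funTS|exact: riemM_set1].
exists (r0 / k.+1%:R); first by rewrite divr_gt0.
by move=> x Px; rewrite (integral_kern_gball K_pos K_noninc _ Px Pp).
Qed.

(** The part of the kernel at distances below [t]. It has small row integrals, and the remainder is
    bounded by [K t]. *)
Let near_kern (t : R) x y : R := kK x y * (clamped_dist M x y < t)%R%:R.

Let near_kern_ge0 t x y : 0 <= near_kern t x y.
Proof. by rewrite mulr_ge0. Qed.

Let near_kernC t x y : near_kern t x y = near_kern t y x.
Proof. by rewrite /near_kern kernC /clamped_dist formC. Qed.

Let measurable_near_kern t : measurable_fun [set: T * T] (fun q => near_kern t q.1 q.2).
Proof.
apply: measurable_funM; first exact: mk.
rewrite (_ : (fun q => _) = (fun q : T * T => if clamped_dist M q.1 q.2 < t then 1 else 0)).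
  apply: measurable_fun_ifT => //; apply: measurable_fun_ltr => //.
  exact: measurable_clamped_dist.
by apply/funext => q; case: ifP.
Qed.

(** With [h] the part of [f] outside [B], the loss of energy is at most twice [energy f h]. The near
    part of the kernel is controlled by the Schur test, the far part by [K t] times the integrals of
    [f] and [h]. Since [eps] depends on [f] only through the bounds 1 and [V], the estimate survives
    polarization. *)
Lemma energy_small p r (V : R) (e : R) : P p -> 0 <= V -> 0 < e -> exists2 eps : R, 0 < eps &
  forall f (S B : set T), measurable S -> measurable B -> S `<=` gball M p r ->
    measurable_fun [set: T] f -> (forall x, 0 <= f x) -> (forall x, ~ S x -> f x = 0) ->
    (\int[mu]_x (f x ^+ 2)%:E <= 1)%E -> (mu S <= V%:E)%E -> (mu (S `\` B) <= eps%:E)%E ->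
    (energy mu kK f f <=
     energy mu kK (fun x => f x * \1_B x)%R (fun x => f x * \1_B x)%R + e%:E)%E.
Proof.
move=> Pp V0 e0; have e8 : 0 < e / 8 by rewrite divr_gt0.
have [t t0 kt] := integral_kern_gball_small Pp e8.
(* With [c * th = e / 8], the far part is at most [K t * (1 + V) * 2 * th = e / 4]; the near part is
   [e / 8] times at most 2. Together [e / 2], counted twice. *)
pose c := K t * (1 + V); have c0 : 0 < c by rewrite mulr_gt0 ?K_pos// ltr_pwDl.
pose th := e / (8 * c); have th0 : 0 < th by rewrite divr_gt0// mulr_gt0.
exists (th ^+ 2); first exact: exprn_gt0.
move=> f S B mS mB SD mf f0 fS f1 SV SBe.
have mD := measurable_gball r Pp.
pose g x : R := f x * \1_B x; pose h x : R := f x * \1_(~` B) x.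
have m1 (A : set T) : measurable A -> measurable_fun [set: T] (\1_A : T -> R).
  by move=> mA; exact: measurable_indic.
have i0 (A : set T) x : 0 <= \1_A x :> R by rewrite indicE.
have mg : measurable_fun [set: T] g by apply: measurable_funM => //; exact: m1.
have mh : measurable_fun [set: T] h.
  by apply: measurable_funM => //; apply: m1; exact: measurableC.
have g0 x : 0 <= g x by rewrite mulr_ge0.
have h0 x : 0 <= h x by rewrite mulr_ge0.
have fgh x : f x = g x + h x.
  rewrite /g /h -mulrDr !indicE in_setC.
  by case: (_ \in _); rewrite ?addr0 ?add0r mulr1.
have hf x : h x <= f x by rewrite fgh lerDr.
have fout x : ~ gball M p r x -> f x = 0 by move=> xD; apply: fS => /SD.
have hout x : ~ gball M p r x -> h x = 0 by move=> xD; rewrite /h fout// mul0r.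
have h1 : (\int[mu]_x (h x ^+ 2)%:E <= 1)%E.
  apply: le_trans f1; apply: ge0_le_integral => //.
  - by move=> x _; rewrite lee_fin sqr_ge0.
  - by apply/measurable_EFinP; exact: measurable_funX.
  - by apply/measurable_EFinP; exact: measurable_funX.
  - by move=> x _; rewrite lee_fin lerXn2r// nnegrE.
have nearE : (energy mu (near_kern t) f h <= (e / 4)%:E)%E.
  have kU x : gball M p r x ->
      (\int[mu]_(y in gball M p r) (near_kern t x y)%:E <= (e / 8)%:E)%E.
    move=> [Px _]; apply: le_trans (kt x Px).
    rewrite [leLHS]integral_mkcond [leRHS]integral_mkcond.
    have mN : measurable_fun [set: T] (fun y => (near_kern t x y)%:E).
      apply/measurable_EFinP.
      exact: (measurableT_comp (measurable_near_kern t) (pair1_measurable x)).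
    apply: ge0_le_integral => //.
    - by move=> y _; rewrite patchE; case: ifP => // _; rewrite lee_fin.
    - by apply/(measurable_restrict _ _) => //; rewrite setTI; exact: measurable_funTS.
    - apply/(measurable_restrict _ _) => //; first exact: measurable_gball.
      rewrite setTI; apply: measurable_funTS; apply/measurable_EFinP; exact: measurable_kern1.
    move=> y _; rewrite !patchE; case: ifPn => [/set_mem[Py _]|_]; last first.
      by case: ifP => // _; rewrite lee_fin.
    rewrite /= /near_kern clamped_distE//; case: (ltP (d x y) t) => xy.
      by rewrite mulr1 mem_set//; split => //; rewrite gdistC.
    by rewrite mulr0; case: ifP => // _; rewrite lee_fin.
  have := schur_test (measurable_near_kern t) (near_kern_ge0 t) (near_kernC t) mD (ltW e8) kU
    mf mh fout hout.
  rewrite (_ : (fun x => `|f x|) = f); last by apply/funext => x; rewrite ger0_norm.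
  rewrite (_ : (fun x => `|h x|) = h); last by apply/funext => x; rewrite ger0_norm.
  move=> /le_trans; apply; apply: (@le_trans _ _ ((e / 8)%:E * (1 + 1))%E).
    by rewrite lee_pmul2l ?lte_fin//; exact: leeD.
  by rewrite -EFinD -EFinM lee_fin; lra.
have intf : (\int[mu]_x (f x)%:E <= (1 + V)%:E)%E.
  (* [f <= f ^+ 2 + 1] on [S]. *)
  apply: (@le_trans _ _ (\int[mu]_x ((f x ^+ 2)%:E + (\1_S x)%:E))%E).
    apply: ge0_le_integral => //.
    - by move=> x _; rewrite lee_fin.
    - exact/measurable_EFinP.
    - by apply: emeasurable_funD; apply/measurable_EFinP; [exact: measurable_funX|exact: m1].
    move=> x _; rewrite -EFinD lee_fin indicE.
    have [Sx|Sx] := pselect (S x); last by rewrite fS// addr_ge0// sqr_ge0.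
    by rewrite mem_set//=; have := sqr_ge0 (f x - 1); have := f0 x; rewrite !expr2; lra.
  rewrite ge0_integralD; [|exact: measurableT|by move=> x _; rewrite lee_fin sqr_ge0|
    by apply/measurable_EFinP; exact: measurable_funX|
    by move=> x _; rewrite lee_fin|
    by apply/measurable_EFinP; exact: m1].
  by rewrite EFinD; apply: leeD => //; rewrite integral_indic// setIT.
have inth : (\int[mu]_x (h x)%:E <= (th + th)%:E)%E.
  have mSB : measurable (S `\` B) by exact: measurableD.
  (* [2 * f <= th * f ^+ 2 + 1 / th]; since the measure of the set is at most [th ^+ 2], both terms
     integrate to at most [th]. *)
  apply: (@le_trans _ _ (\int[mu]_x (th%:E * (f x ^+ 2)%:E + th^-1%:E * (\1_(S `\` B) x)%:E))%E).
    apply: ge0_le_integral => //.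
    - by move=> x _; rewrite lee_fin.
    - exact/measurable_EFinP.
    - by apply: emeasurable_funD; apply: measurable_funeM; apply/measurable_EFinP;
        [exact: measurable_funX|exact: m1].
    move=> x _; rewrite -!EFinM -EFinD lee_fin /h !indicE.
    have [Sx|Sx] := pselect (S x); last first.
      by rewrite fS// mul0r addr_ge0// mulr_ge0// ?invr_ge0 ltW.
    have [Bx|Bx] := pselect (B x).
      rewrite in_setC mem_set//= mulr0 addr_ge0// mulr_ge0//.
      - exact: ltW.
      - exact: sqr_ge0.
      - by rewrite invr_ge0 ltW.
    rewrite in_setC memNset//= mulr1 mem_set// mulr1.
    have : 0 <= th^-1 * (th * f x - 1) ^+ 2 by rewrite mulr_ge0 ?sqr_ge0// invr_ge0 ltW.
    have -> : th^-1 * (th * f x - 1) ^+ 2 = th * f x ^+ 2 - 2 * f x + th^-1.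
      by field; rewrite gt_eqF.
    by have := f0 x; lra.
  rewrite ge0_integralD; [|exact: measurableT|by move=> x _; rewrite -EFinM lee_fin mulr_ge0 ?sqr_ge0// ltW|
    by apply: measurable_funeM; apply/measurable_EFinP; exact: measurable_funX|
    by move=> x _; rewrite -EFinM lee_fin mulr_ge0// invr_ge0 ltW|
    by apply: measurable_funeM; apply/measurable_EFinP; exact: m1].
  have thi : 0 < th^-1 by rewrite invr_gt0.
  rewrite ge0_integralZl; [|exact: measurableT|by apply/measurable_EFinP; exact: measurable_funX|
    by move=> x _; rewrite lee_fin sqr_ge0|by rewrite lee_fin ltW].
  rewrite ge0_integralZl; [|exact: measurableT|by apply/measurable_EFinP; exact: m1|
    by move=> x _; rewrite lee_fin|by rewrite lee_fin ltW].
  rewrite integral_indic// setIT EFinD; apply: leeD.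
    by rewrite -[leRHS]mule1 lee_pmul2l// lte_fin.
  rewrite -[X in (_ <= X%:E)%E](_ : th^-1 * th ^+ 2 = th); last by rewrite expr2 mulKf// gt_eqF.
  by rewrite EFinM lee_pmul2l// lte_fin.
have ff0 (u v : T -> R) : (forall x, 0 <= u x) -> (forall x, 0 <= v x) ->
  forall x y, 0 <= u x * v y by move=> u0 v0 x y; exact: mulr_ge0.
have fhE : (energy mu kK f h <= (e / 2)%:E)%E.
  have Kt := K_pos t0.
  apply: (@le_trans _ _ (energy mu (near_kern t) f h +
      (K t)%:E * (\int[mu]_x (f x)%:E * \int[mu]_y (h y)%:E))%E); last first.
    have -> : e / 2 = e / 4 + K t * ((1 + V) * (th + th)).
      have -> : K t * ((1 + V) * (th + th)) = 2 * (c * th) by rewrite /c; ring.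
      by rewrite /th; field; rewrite gt_eqF.
    rewrite EFinD; apply: leeD => //; rewrite !EFinM lee_pmul2l ?lte_fin//.
    by apply: lee_pmul => //; apply: integral_ge0 => x _; rewrite lee_fin.
  have -> : ((K t)%:E * (\int[mu]_x (f x)%:E * \int[mu]_y (h y)%:E) =
      \int[mu]_x \int[mu]_y (K t * (f x * h y))%:E)%E.
    rewrite -ge0_integralZr; [|exact: measurableT|exact/measurable_EFinP|
      by move=> x _; rewrite lee_fin|
      by apply: integral_ge0 => x _; rewrite lee_fin].
    rewrite -ge0_integralZl; [|exact: measurableT|by apply: emeasurable_funM => //; exact/measurable_EFinP|
      by move=> x _; apply: mule_ge0; rewrite ?lee_fin//; apply: integral_ge0 => y _; rewrite lee_fin|
      by rewrite lee_fin ltW].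
    apply: eq_integral => x _; rewrite muleA -EFinM -ge0_integralZl; [|exact: measurableT|exact/measurable_EFinP|
      by move=> y _; rewrite lee_fin|by rewrite lee_fin mulr_ge0// ltW].
    by apply: eq_integral => y _; rewrite -EFinM mulrA.
  have mc : measurable_fun [set: T * T] (fun q => K t) by [].
  have Kt0 x y : 0 <= (fun _ _ : T => K t) x y by exact: ltW.
  rewrite -/(energy mu (fun _ _ => K t) f h).
  rewrite /energy -ge0_integralD; [|exact: measurableT|by move=> x _; apply: integral_ge0 => y _; rewrite lee_fin mulr_ge0 ?k0 ?ff0//|
    exact: (measurable_kernel_integral mu (measurable_near_kern t) (near_kern_ge0 t) mf mh (ff0 _ _ f0 h0))|
    by move=> x _; apply: integral_ge0 => y _; rewrite lee_fin mulr_ge0 ?ff0// ltW|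
    exact: (measurable_kernel_integral mu mc Kt0 mf mh (ff0 _ _ f0 h0))].
  apply: ge0_le_integral => //.
  - by move=> x _; apply: integral_ge0 => y _; rewrite lee_fin mulr_ge0 ?k0 ?ff0//.
  - exact: (measurable_kernel_integral mu mk k0 mf mh (ff0 _ _ f0 h0)).
  - apply: emeasurable_funD.
      exact: (measurable_kernel_integral mu (measurable_near_kern t) (near_kern_ge0 t) mf mh (ff0 _ _ f0 h0)).
    exact: (measurable_kernel_integral mu mc Kt0 mf mh (ff0 _ _ f0 h0)).
  move=> x _.
  have mS2 (k : T -> T -> R) : measurable_fun [set: T * T] (fun q => k q.1 q.2) ->
      measurable_fun [set: T] (fun y => (k x y * (f x * h y))%:E).
    move=> mk'; apply/measurable_EFinP; apply: measurable_funM.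
      exact: (measurableT_comp mk' (pair1_measurable x)).
    exact: measurable_funM.
  rewrite -ge0_integralD; [|exact: measurableT|by move=> y _; rewrite lee_fin mulr_ge0 ?k0 ?ff0//|
    exact: mS2 (measurable_near_kern t)|
    by move=> y _; rewrite lee_fin mulr_ge0 ?ff0// ltW|
    exact: mS2 mc].
  apply: ge0_le_integral => //.
  - by move=> y _; rewrite lee_fin mulr_ge0 ?k0 ?ff0//.
  - exact: mS2 mk.
  - by apply: emeasurable_funD; [exact: mS2 (measurable_near_kern t)|exact: mS2 mc].
  move=> y _; rewrite -EFinD lee_fin -mulrDl.
  have [[Px _]|xD] := pselect (gball M p r x); last by rewrite fout// mul0r !mulr0.
  have [[Py _]|yD] := pselect (gball M p r y); last by rewrite hout// !mulr0.
  rewrite ler_wpM2r// ?mulr_ge0// /near_kern clamped_distE//.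
  case: (ltP (d x y) t) => xy; first by rewrite mulr1 lerDl ltW.
  rewrite mulr0 add0r kernE ?K_noninc// => xy'.
  by move: xy; rewrite xy' gdistxx// leNgt t0.
have ge0K (u v : T -> R) : (forall x, 0 <= u x) -> (forall x, 0 <= v x) ->
    forall x, (0 <= \int[mu]_y (kK x y * (u x * v y))%:E)%E.
  by move=> u0 v0 x; apply: integral_ge0 => y _; rewrite lee_fin mulr_ge0 ?k0 ?ff0//.
have mK (u v : T -> R) : measurable_fun [set: T] u -> measurable_fun [set: T] v ->
    (forall x, 0 <= u x) -> (forall x, 0 <= v x) ->
    measurable_fun [set: T] (fun x => \int[mu]_y (kK x y * (u x * v y))%:E)%E.
  move=> mu' mv u0 v0.
  exact: (measurable_kernel_integral mu mk k0 mu' mv (ff0 _ _ u0 v0)).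
(* With [f = g + h], the product [f x * f y] is at most [g x * g y + f x * h y + h x * f y], the
   excess being [h x * h y]. *)
apply: (@le_trans _ _ (energy mu kK g g + (energy mu kK f h + energy mu kK h f))%E); last first.
  rewrite (energyC mu mk k0 (kernC M K) mh mf (ff0 _ _ h0 f0)) leeD2l//.
  have -> : e%:E = ((e / 2)%:E + (e / 2)%:E)%E by rewrite -EFinD; congr EFin; lra.
  exact: leeD.
rewrite /energy.
rewrite -(ge0_integralD mu measurableT (fun x _ => ge0K _ _ f0 h0 x) (mK _ _ mf mh f0 h0)
  (fun x _ => ge0K _ _ h0 f0 x) (mK _ _ mh mf h0 f0)).
have sum0 x : (0 <= \int[mu]_y (kK x y * (f x * h y))%:E + \int[mu]_y (kK x y * (h x * f y))%:E)%E.
  by apply: adde_ge0; exact: ge0K.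
have msum : measurable_fun [set: T] (fun x => \int[mu]_y (kK x y * (f x * h y))%:E +
    \int[mu]_y (kK x y * (h x * f y))%:E)%E.
  by apply: emeasurable_funD; exact: mK.
rewrite -[leRHS](ge0_integralD mu measurableT (fun x _ => ge0K _ _ g0 g0 x)
  (mK _ _ mg mg g0 g0) (fun x _ => sum0 x) msum).
apply: ge0_le_integral => //.
- by move=> x _; exact: ge0K.
- exact: mK.
- by apply: emeasurable_funD => //; exact: mK.
move=> x _.
have mS2 (u v : T -> R) : measurable_fun [set: T] v ->
    measurable_fun [set: T] (fun y => (kK x y * (u x * v y))%:E).
  move=> mv; apply/measurable_EFinP; apply: measurable_funM; last exact: measurable_funM.
  exact: measurable_kern1.
have S0 (u v : T -> R) : (forall x, 0 <= u x) -> (forall x, 0 <= v x) ->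
    forall y, [set: T] y -> (0 <= (kK x y * (u x * v y))%:E)%E.
  by move=> u0 v0 y _; rewrite lee_fin mulr_ge0 ?k0 ?ff0//.
have -> := esym (ge0_integralD mu measurableT
  (S0 _ _ f0 h0) (mS2 f h mh) (S0 _ _ h0 f0) (mS2 h f mf)).
rewrite -ge0_integralD; [|exact: measurableT|exact: S0|
  exact: (mS2 g g mg)|
  by move=> y _; apply: adde_ge0; exact: S0|
  by apply: emeasurable_funD; [exact: (mS2 f h mh)|exact: (mS2 h f mf)]].
apply: ge0_le_integral => //.
- exact: S0.
- exact: (mS2 f f mf).
- by apply: emeasurable_funD; [exact: (mS2 g g mg)|apply: emeasurable_funD;
    [exact: (mS2 f h mh)|exact: (mS2 h f mf)]].
move=> y _; rewrite -!EFinD lee_fin -!mulrDr ler_wpM2l//.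
have := fgh x; have := fgh y; have := g0 x; have := g0 y; have := h0 x; have := h0 y.
generalize (f x) (f y) (g x) (g y) (h x) (h y) => a b a1 b1 a2 b2 b2p a2p _ _ -> ->.
by have := mulr_ge0 a2p b2p; lra.
Qed.

End small_sets.

(** * Moving the support into the ball *)

Section rearrangement.
Context {R : realType} (M : space_form) {n : nat} (K : R -> R).
Local Notation T := 'rV[R]_n.+1.
Local Notation P := (@space_points R M n).
Local Notation d := (@gdist R M n).
Local Notation mu := (@riemM R M n).
Local Notation kK := (@kern R M n K).
Implicit Types (x y z w : T) (f phi : T -> R).

Hypotheses (n0 : (0 < n)%N) (K_pos : forall t, 0 < t -> 0 < K t)
  (K_noninc : forall s t, 0 < s -> s <= t -> K t <= K s).
Variables (x0 : T) (r r0 lam eps delta : R).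
Hypotheses (Px0 : P x0) (r_gt0 : 0 < r) (eps_gt0 : 0 < eps) (delta_gt0 : 0 < delta).

(* [phi] is a height function of the support of [f]: it is 0 outside, 3 in the
   interior, and in between only on a set of small measure. *)
Record admissible f phi : Prop := Admissible {
  adm_measurable : measurable_fun [set: T] f ;
  adm_ge0 : forall z, 0 <= f z ;
  adm_norm : (\int[mu]_z (f z ^+ 2)%:E <= 1)%E ;
  adm_energy : (lam%:E <= energy mu kK f f)%E ;
  adm_hmeasurable : measurable_fun [set: T] phi ;
  adm_height : forall z, 0 <= phi z <= 3 ;
  adm_support : forall z, phi z = 0 -> f z = 0 ;
  adm_bounded : forall z, 0 < phi z -> gball M x0 r0 z ;
  adm_volume : (mu [set z | (0 < phi z)%R] <= mu (gball M x0 r))%E ;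
  adm_layer : (mu [set z | (0 < phi z < 3)%R] <= eps%:E)%E ;
  adm_slow : forall z w, P z -> P w -> d z w < delta -> `|phi z - phi w| <= 1 }.

Lemma adm_out f phi z : admissible f phi -> ~ P z -> phi z = 0.
Proof.
move=> A Pz; have /andP[+ _] := adm_height A z.
by rewrite le_eqVlt => /predU1P[//|/(adm_bounded A)[]].
Qed.

Lemma measurable_superlevel phi (a : R) : measurable_fun [set: T] phi ->
  measurable [set z | a < phi z].
Proof.
move=> mphi; rewrite (_ : [set z | _] = phi @^-1` `]a, +oo[%classic).
  by rewrite -[X in measurable X]setTI; exact: mphi.
by apply/seteqP; split => z /=; rewrite in_itv/= andbT.
Qed.

Lemma measurable_layer phi : measurable_fun [set: T] phi ->
  measurable [set z | 0 < phi z < 3].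
Proof.
move=> mphi; rewrite (_ : [set z | _] = phi @^-1` `]0, 3[%classic).
  by rewrite -[X in measurable X]setTI; exact: mphi.
by apply/seteqP; split => z /=; rewrite in_itv/=.
Qed.

Lemma riemM_pol s H (B : set R) phi : is_reflection M s H -> measurable B ->
  measurable_fun [set: T] phi ->
  mu [set z | B (pol s H phi z)] = mu [set z | B (phi z)].
Proof.
move=> rs mB mphi; have mp := measurable_pol rs mphi.
have m g : measurable_fun [set: T] g -> measurable [set z | B (g z)].
  by move=> mg; rewrite -[X in measurable X]setTI; exact: mg.
have E g : measurable_fun [set: T] g -> mu [set z | B (g z)] = (\int[mu]_z (\1_B (g z))%:E)%E.
  move=> mg; rewrite (eq_integral (fun z => (\1_[set z | B (g z)] z)%:E)).
    by rewrite integral_indic ?setIT//; exact: m.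
  move=> z _; rewrite !indicE.
  by have -> : (g z \in B) = (z \in [set z | B (g z)]) by apply/idP/idP => /set_mem h; exact/mem_set.
rewrite !E// (ge0_integral_pol rs (G := fun t => (\1_B t)%:E))//.
by apply/measurable_EFinP; exact: measurable_indic.
Qed.

(** Conditions on the distribution survive because values are only permuted within pairs.
    Confinement to the ball about [x0] uses [H x0]: a value is moved into [H] only, hence closer to
    [x0]. Polarizing [f] and [phi] by the same reflection keeps [f] supported where [phi] is
    positive. *)
Lemma adm_pol s H f phi : is_reflection M s H -> H x0 ->
  admissible f phi -> admissible (pol s H f) (pol s H phi).
Proof.
move=> rs Hx0 [mf f0 f1 fl mphi hphi sphi bphi vphi lphi dphi].
have A : admissible f phi by split.
have sK := reflectionK rs.
have fP z : ~ P z -> f z = 0 by move=> /(adm_out A); exact: sphi.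
have phi0 z : 0 <= phi z by have /andP[] := hphi z.
split.
- exact: (measurable_pol rs).
- exact: (pol_ge0 rs).
- rewrite (ge0_integral_pol rs (G := fun t => (t ^+ 2)%:E))//.
    by apply/measurable_EFinP; exact: measurable_funX.
  by move=> t; rewrite lee_fin sqr_ge0.
- exact: le_trans fl (energy_pol rs n0 K_pos K_noninc mf f0 fP).
- exact: (measurable_pol rs).
- by move=> z; have [[-> _]|[-> _]] := pol_pair rs phi z.
- move=> z; rewrite /pol; case: ifP => _.
    move/eqP; rewrite eq_le ge_max => /andP[/andP[h1 h2] _].
    rewrite sphi ?sphi ?maxxx//; apply/eqP; rewrite eq_le ?h1 ?h2 ?phi0//.
  case: (leP (phi z) (phi (s z))) => _ /sphi ->.
    by rewrite min_l.
  by rewrite min_r.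
- move=> z; rewrite /pol; case: ifPn => Hz; last first.
    by rewrite lt_min => /andP[/bphi].
  rewrite lt_max => /orP[/bphi//|/bphi[Psz szr]].
  have Pz : P z by rewrite -(sK z); exact: (reflection_points rs).
  split => //; rewrite gdistC; apply: le_lt_trans szr; rewrite [leRHS]gdistC.
  exact: (side_closer rs).
- have E (g : T -> R) : [set z | 0 < g z] = [set z | `]0, +oo[%classic (g z : R)].
    by apply/seteqP; split => z /=; rewrite in_itv/= andbT.
  by move: vphi; rewrite (E phi) (E (pol s H phi)) riemM_pol.
- have E (g : T -> R) : [set z | 0 < g z < 3] = [set z | `]0, 3[%classic (g z : R)].
    by apply/seteqP; split => z /=; rewrite in_itv/=.
  by move: lphi; rewrite (E phi) (E (pol s H phi)) riemM_pol.
move=> z w Pz Pw zw.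
have [Psz Psw] := (reflection_points rs Pz, reflection_points rs Pw).
have D1 : `|phi z - phi w| <= 1 by exact: dphi.
have D2 : `|phi (s z) - phi (s w)| <= 1 by apply: dphi => //; rewrite (reflection_gdist rs).
(* For points on opposite sides the maximum at one may have to be compared with the minimum at the
   other across the mirror; reflecting one of them does not increase the distance, so the bound on
   [phi] applies to the crossed pairs too. *)
have D34 : H z <> H w -> `|phi z - phi (s w)| <= 1 /\ `|phi (s z) - phi w| <= 1.
  move=> Hzw.
  have zsw : d z (s w) < delta.
    apply: le_lt_trans zw; have := side_reflection rs z; have := side_reflection rs w.
    case: (boolP (H z)) Hzw => Hz; case: (boolP (H w)) => //= Hw _ Hsw Hsz.
      by rewrite -{2}(sK w); exact: (side_closer rs).
    rewrite -(reflection_gdist rs) sK -[leRHS](reflection_gdist rs).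
    exact: (side_closer rs).
  split; apply: dphi => //.
  by rewrite -(sK w) (reflection_gdist rs).
move: D1 D2 D34; rewrite /pol !ler_norml.
case: (H z); case: (H w) => /andP[a1 a2] /andP[b1 b2] c.
- by case: (leP (phi z) (phi (s z))) => h1; case: (leP (phi w) (phi (s w))) => h2; lra.
- have [//|/andP[c1 c2] /andP[c3 c4]] := c.
  by case: (leP (phi z) (phi (s z))) => h1; case: (leP (phi w) (phi (s w))) => h2; lra.
- have [//|/andP[c1 c2] /andP[c3 c4]] := c.
  by case: (leP (phi z) (phi (s z))) => h1; case: (leP (phi w) (phi (s w))) => h2; lra.
- by case: (leP (phi z) (phi (s z))) => h1; case: (leP (phi w) (phi (s w))) => h2; lra.
Qed.

Definition potential phi : \bar R :=
  (\int[mu]_z (phi z * clamped_dist M x0 z)%:E)%E.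

Let dist_ge0 z : 0 <= clamped_dist M x0 z.
Proof. by apply: angle_ge0; exact: clamp_range. Qed.

Let measurable_dist : measurable_fun [set: T] (clamped_dist M x0).
Proof. exact: (measurableT_comp (measurable_clamped_dist M) (pair1_measurable x0)). Qed.

Lemma potential_fin f phi : admissible f phi ->
  (0 <= potential phi)%E /\ (potential phi < +oo)%E.
Proof.
move=> A; have h z := andP (adm_height A z).
have mphi := adm_hmeasurable A.
split; first by apply: integral_ge0 => z _; rewrite lee_fin mulr_ge0//; have [] := h z.
have mB := measurable_gball r0 Px0.
apply: (@le_lt_trans _ _ (\int[mu]_z ((3 * `|r0|)%:E * (\1_(gball M x0 r0) z)%:E))%E).
  apply: ge0_le_integral => //.
  - by move=> z _; rewrite lee_fin mulr_ge0//; have [] := h z.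
  - by apply/measurable_EFinP; exact: measurable_funM.
  - by apply: measurable_funeM; apply/measurable_EFinP; exact: measurable_indic.
  move=> z _; rewrite -EFinM lee_fin; have [h1 h2] := h z.
  move: h1; rewrite le_eqVlt => /predU1P[<-|/(adm_bounded A) zB].
    by rewrite mul0r !mulr_ge0.
  have [Pz zr] := zB; rewrite indicE mem_set// mulr1 clamped_distE//.
  rewrite ler_pM//; first by have [] := h z.
    by rewrite gdist_ge0.
  by rewrite gdistC; apply: le_trans (ltW zr) (ler_norm _).
rewrite ge0_integralZl; [|exact: measurableT|by apply/measurable_EFinP; exact: measurable_indic|
  by move=> z _; rewrite lee_fin|by rewrite lee_fin mulr_ge0].
rewrite integral_indic// setIT lte_mul_pinfty ?lee_fin ?mulr_ge0//.
exact: riemM_gball_finite.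
Qed.

(* Swapping a low point x near [x0] with a high point y farther away lowers the
   potential by an amount independent of [phi]. *)
Lemma potential_drop f phi x y (r1 rho : R) : admissible f phi -> P x -> P y ->
  phi x = 0 -> phi y = 3 -> d x0 x < r1 -> r <= d x0 y -> 0 < rho ->
  rho <= delta -> rho <= (r - r1) / 4 ->
  exists phi' f', admissible f' phi' /\
    (potential phi' + potential phi' + ((r - r1) / 2)%:E * mu (gball M x0 rho) <=
     potential phi + potential phi)%E.
Proof.
move=> A Px Py phix phiy xr1 yr rho0 rhod rhor.
have xy : x <> y by move=> E; move: phix; rewrite E phiy => /eqP; rewrite pnatr_eq0.
have [s [H [rs sxy Hleft]]] := swap_reflection Px Py xy.
have sK := reflectionK rs.
have dxy : r - r1 < d x y.
  have := gdist_triangle Px0 Px Py; lra.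
(* [x] is closer to [x0] than [y], so the reflection fixes the side of the centre. *)
have Hx0 : H x0 by apply: Hleft => //; lra.
exists (pol s H phi), (pol s H f); split; first exact: adm_pol.
set psi := pol s H phi.
have h z := andP (adm_height A z).
have phi0 z : 0 <= phi z by have [] := h z.
have psi0 z : 0 <= psi z by exact: (pol_ge0 rs).
have mphi := adm_hmeasurable A; have mpsi : measurable_fun [set: T] psi by exact: (measurable_pol rs).
have mB := measurable_gball rho Px.
have ms := measurable_reflection rs.
have mw (u : T -> R) : measurable_fun [set: T] u ->
    measurable_fun [set: T] (fun z => (u z * clamped_dist M x0 z)%:E).
  by move=> mu'; apply/measurable_EFinP; exact: measurable_funM.
have w0 (u : T -> R) : (forall z, 0 <= u z) -> forall z, (0 <= (u z * clamped_dist M x0 z)%:E)%E.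
  by move=> u0 z; rewrite lee_fin mulr_ge0.
rewrite /potential.
rewrite (integral_reflection_pair rs (mw _ mphi) (w0 _ phi0)).
rewrite (integral_reflection_pair rs (mw _ mpsi) (w0 _ psi0)).
have g0 : 0 <= (r - r1) / 2 by lra.
have m1 : measurable_fun [set: T] (fun z => (((r - r1) / 2)%:E * (\1_(gball M x rho) z)%:E)%E).
  by apply: measurable_funeM; apply/measurable_EFinP; exact: measurable_indic.
have -> : (((r - r1) / 2)%:E * mu (gball M x0 rho) =
    \int[mu]_z (((r - r1) / 2)%:E * (\1_(gball M x rho) z)%:E))%E.
  rewrite ge0_integralZl; [|exact: measurableT|by apply/measurable_EFinP; exact: measurable_indic|
    by move=> z _; rewrite lee_fin|by rewrite lee_fin].
  by rewrite integral_indic// setIT (riemM_gball_eq rho Px0 Px).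
have mpair (u : T -> R) : measurable_fun [set: T] u -> measurable_fun [set: T]
    (fun z => (u z * clamped_dist M x0 z)%:E + (u (s z) * clamped_dist M x0 (s z))%:E)%E.
  move=> mu'; apply: emeasurable_funD; first exact: mw.
  exact: (measurableT_comp (mw _ mu')).
have pair0 (u : T -> R) : (forall z, 0 <= u z) -> forall z, [set: T] z ->
    (0 <= (u z * clamped_dist M x0 z)%:E + (u (s z) * clamped_dist M x0 (s z))%:E)%E.
  by move=> u0 z _; apply: adde_ge0; exact: w0.
have i0 z : [set: T] z -> (0 <= ((r - r1) / 2)%:E * (\1_(gball M x rho) z)%:E)%E.
  by move=> _; rewrite mule_ge0// lee_fin.
rewrite -(ge0_integralD mu measurableT (pair0 _ psi0) (mpair _ mpsi) i0 m1).
apply: ge0_le_integral => //.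
- by move=> z Tz; apply: adde_ge0; [exact: pair0|exact: i0].
- by apply: emeasurable_funD => //; exact: mpair.
- exact: mpair.
move=> z _; rewrite -EFinM -!EFinD lee_fin.
have [Pz|Pz] := pselect (P z); last first.
  have Psz := reflection_out rs Pz.
  have zx : ~ gball M x rho z by case.
  rewrite (adm_out A Pz) (adm_out A Psz) indicE memNset// mulr0 addr0.
  by rewrite /psi (pol_out rs) ?(pol_out rs) ?mul0r// => z'; exact: adm_out A.
have Psz := reflection_points rs Pz.
rewrite !clamped_distE//.
have dle : H z -> d x0 z <= d x0 (s z) by move=> Hz; exact: (side_closer rs).
have dge : ~~ H z -> d x0 (s z) <= d x0 z.
  move=> Hz; rewrite -{2}(sK z); apply: (side_closer rs) => //.
  by have := side_reflection rs z; rewrite (negbTE Hz).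
have := pol_order rs phi z; have := pol_pair rs phi z; rewrite -/psi.
rewrite indicE; case: (boolP (z \in _)) => [/set_mem[_ zx]|_]; last first.
  rewrite mulr0 addr0; move: dle dge; case: (H z) => /= dle dge.
    have := dle isT; move=> ? [[-> ->]|[-> ->]] ?; nra.
  have := dge isT; move=> ? [[-> ->]|[-> ->]] ?; nra.
(* [x] and [y] are more than [4 * rho] apart, so the ball about [x] lies on the side of [x]; its
   mirror image is the ball about [y]. *)
have Hz : H z.
  by apply: Hleft => //; have := gdist_triangle Px Pz Py; rewrite (gdistC M x z); lra.
have szy : d (s z) y = d z x by rewrite -sxy (reflection_gdist rs).
(* On this ball [phi z <= 1] and [phi (s z) >= 2], so an exchange moves at least 1 unit of height
   inwards, over a distance of at least [r - rho - (r1 + rho) >= (r - r1) / 2]. *)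
have := adm_slow A Pz Px; rewrite phix subr0 => /(_ (lt_le_trans zx rhod)).
have := adm_slow A Psz Py; rewrite phiy szy => /(_ (lt_le_trans zx rhod)).
rewrite !ler_norml Hz mulr1 => /andP[s1 _] /andP[_ s2].
have q1 : d x0 z <= r1 + rho.
  by have := gdist_triangle Px0 Px Pz; rewrite (gdistC M x z); lra.
have q2 : r - rho <= d x0 (s z).
  by have := gdist_triangle Px0 Psz Py; rewrite szy; lra.
have q3 : (r - r1) / 2 <= d x0 (s z) - d x0 z by lra.
(* The values cannot have been kept, since the larger one must be on the side of [H]. *)
move=> [[-> ->]|[-> ->]] o; first by lra.
have : 0 <= (phi (s z) - phi z - 1) * (d x0 (s z) - d x0 z).
  by rewrite mulr_ge0//; lra.
lra.
Qed.

(** No minimizer of the potential is needed: the gain of one swap is fixed by [r], [r1] and [rho]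
    before the pair is chosen, so a pair within a third of it from the infimum cannot be
    improved. *)
Lemma adm_concentrated f0 phi0 : admissible f0 phi0 -> exists f phi,
  admissible f phi /\ (mu ([set z | (0 < phi z)%R] `\` gball M x0 r) <= (2 * eps)%:E)%E.
Proof.
move=> A0.
have mB t := measurable_gball t Px0.
pose V := mu (gball M x0 r); have Vfin : (V < +oo)%E := riemM_gball_finite r Px0.
(* Shells inside the boundary of the ball. One of measure at most [eps / 2] fixes [r1], and with it
   a gap between the low point, sought within [r1], and the high point, sought beyond [r]. *)
pose D k := gball M x0 r `\` gball M x0 (r - r / k.+1%:R).
have [k Dk] : exists k, (mu (D k) <= (eps / 2)%:E)%E.
  apply: small_measure.
  - by move=> k; exact: measurableD.
  - move=> i j ij z [zr zj]; split => // zi; apply: zj; apply: gball_sub zi.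
    by rewrite lerD2l lerN2 ler_pM2l// lef_pV2 ?posrE// ler_nat.
  - apply: le_lt_trans Vfin; apply: le_measure; rewrite ?inE//.
    exact: measurableD.
    by move=> z [].
  - rewrite (_ : \bigcap_k D k = set0) ?measure0//.
    apply/seteqP; split => // z zD; have [[Pz zr] _] := zD 0%N I.
    have dz : 0 < r - d z x0 by rewrite subr_gt0.
    have [_ []] := zD (Num.truncn (r / (r - d z x0))) I; split => //.
    rewrite ltrBrDl -ltrBrDr ltr_pdivrMr// mulrC -ltr_pdivrMr//.
    exact: truncnS_gt.
  - by rewrite divr_gt0.
set r1 := r - r / k.+1%:R in Dk.
have r1r : r1 < r by rewrite /r1 ltrBlDr ltrDl divr_gt0.
pose rho := Num.min delta ((r - r1) / 4).
have rho0 : 0 < rho by rewrite lt_min delta_gt0/= divr_gt0// subr_gt0.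
have [rd rr] : rho <= delta /\ rho <= (r - r1) / 4.
  by rewrite /rho; split; rewrite ge_min lexx ?orbT.
have gB : (mu (gball M x0 rho) < +oo)%E := riemM_gball_finite rho Px0.
have gB0 := riemM_gball_gt0 Px0 rho0.
pose gain := (r - r1) / 2 * fine (mu (gball M x0 rho)).
have gain0 : 0 < gain.
  by rewrite mulr_gt0// ?fine_gt0 ?gB0// divr_gt0// subr_gt0.
pose S : set R := [set t | exists f phi, admissible f phi /\ potential phi = t%:E].
have pot f phi : admissible f phi -> potential phi = (fine (potential phi))%:E.
  by move=> A; have [p0 pf] := potential_fin A; rewrite fineK// ge0_fin_numE.
have infS : has_inf S.
  split; first by exists (fine (potential phi0)), f0, phi0; split => //; exact: pot A0.
  exists 0 => t [f [phi [A E]]]; have [p0 _] := potential_fin A.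
  by rewrite -lee_fin -E.
(* A swap would give [2 * inf + gain <= 2 * potential < 2 * inf + 2 * gain / 3]. *)
have [t [f [phi [A E]]] tlt] := inf_adherent (divr_gt0 gain0 (ltr0Sn R 3)) infS.
exists f, phi; split => //; rewrite leNgt; apply/negP => big.
have mphi := adm_hmeasurable A.
have mS := measurable_superlevel 0 mphi; have mL := measurable_layer mphi.
have mSB : measurable ([set z | 0 < phi z] `\` gball M x0 r) by exact: measurableD.
(* The part of the support outside the ball has measure above [2 * eps], the layer of intermediate
   heights at most [eps]. *)
have [y [Py yB phiy]] : exists y, [/\ P y, ~ gball M x0 r y & phi y = 3].
  apply: contrapT => none.
  suff : (mu ([set z | (0 < phi z)%R] `\` gball M x0 r) <= eps%:E)%E.
    by move=> /(lt_le_trans big); rewrite lte_fin => h; move: eps_gt0; lra.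
  apply: le_trans (adm_layer A); apply: le_measure; rewrite ?inE//.
  move=> z [/= z0 zB]; rewrite z0/= lt_neqAle; have /andP[_ ->] := adm_height A z.
  rewrite andbT; apply/eqP => z3; apply: none; exists z; split => //.
  by have [] := adm_bounded A z0.
(* Were [phi] positive on the whole smaller ball, the support would have at least [V - eps / 2]
   inside the ball and more than [2 * eps] outside, exceeding the volume [V]. *)
have [x [[Px xr1] phix]] : exists x, gball M x0 r1 x /\ phi x = 0.
  apply: contrapT => none.
  have sub : gball M x0 r1 `<=` [set z | 0 < phi z] `&` gball M x0 r.
    move=> z zr1; split; last by apply: gball_sub zr1; exact: ltW.
    rewrite /= lt_neqAle; have /andP[-> _] := adm_height A z.
    by rewrite andbT; apply/eqP => z0; apply: none; exists z.
  have mI : measurable ([set z | 0 < phi z] `&` gball M x0 r) by exact: measurableI.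
  have VE : (V <= mu (gball M x0 r1) + (eps / 2)%:E)%E.
    apply: (@le_trans _ _ (mu (gball M x0 r1) + mu (D k))%E); last by rewrite leeD2l.
    apply: le_trans (measureU2 _ _ _) => //; last exact: measurableD.
    apply: le_measure; rewrite ?inE//.
      by apply: measurableU => //; exact: measurableD.
    by move=> z zr; have [?|?] := pselect (gball M x0 r1 z); [left|right].
  have SE : mu [set z | 0 < phi z] = (mu ([set z | (0 < phi z)%R] `&` gball M x0 r) +
      mu ([set z | (0 < phi z)%R] `\` gball M x0 r))%E.
    by rewrite addeC -measureDI.
  have := adm_volume A; rewrite -/V => /le_trans /(_ VE).
  apply/negP; rewrite -ltNge SE.
  have r1fin : mu (gball M x0 r1) \is a fin_num.
    by rewrite ge0_fin_numE//; exact: riemM_gball_finite.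
  apply: lee_ltD => //; first by apply: le_measure; rewrite ?inE//; exact: mB.
  by apply: lt_trans big; rewrite lte_fin; move: eps_gt0; lra.
have [phi' [f' [A' drop]]] : exists phi' f', admissible f' phi' /\
    (potential phi' + potential phi' + gain%:E <= potential phi + potential phi)%E.
  have yr : r <= d x0 y by rewrite leNgt gdistC; apply/negP => h; apply: yB.
  have [|phi' [f' [A' h]]] := potential_drop A Px Py phix phiy _ yr rho0 rd rr.
    by rewrite gdistC.
  exists phi', f'; split => //; apply: le_trans h.
  by rewrite leeD2l// /gain EFinM fineK// ge0_fin_numE.
have : S (fine (potential phi')) by exists f', phi'; split => //; exact: pot A'.
move=> /(inf_lbound infS.2) h.
move: drop; rewrite E (pot _ _ A') -!EFinD lee_fin.
by move: tlt h gain0; move: (inf S) (fine _) gain => i p g; lra.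
Qed.

End rearrangement.

(** * Comparison of the open set with the ball *)

Section comparison.
Context {R : realType} (M : space_form) {n : nat} (K : R -> R).
Local Notation T := 'rV[R]_n.+1.
Local Notation P := (@space_points R M n).
Local Notation d := (@gdist R M n).
Local Notation mu := (@riemM R M n).
Local Notation kK := (@kern R M n K).
Implicit Types (x y z w : T) (f phi : T -> R).

Hypotheses (n0 : (0 < n)%N) (K_pos : forall t, 0 < t -> 0 < K t)
  (K_noninc : forall s t, 0 < s -> s <= t -> K t <= K s)
  (K_locint : forall x, P x -> glocally_integrable M (fun y => K (d x y))).

(** The erosion of [U]: points at depth at least [t]. It depends on depth in a 1-Lipschitz way
    ([inner_near]), so erosions at spaced depths yield a slowly varying height function. *)
Definition inner (U : set T) (t : R) : set T :=
  [set z | P z /\ gball M z t `<=` U].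

Lemma innerS (U : set T) s t : s <= t -> inner U t `<=` inner U s.
Proof. by move=> st z [Pz zU]; split => // w /(gball_sub st)/zU. Qed.

Lemma inner_sub (U : set T) t : 0 < t -> inner U t `<=` U.
Proof. by move=> t0 z [Pz zU]; apply: zU; exact: gball_center. Qed.

Lemma inner_near (U : set T) s t z w : P w -> d z w < t ->
  inner U (s + t) z -> inner U s w.
Proof.
move=> Pw zw [Pz zU]; split => // v [Pv vw]; apply: zU; split => //.
by apply: le_lt_trans (gdist_triangle Pv Pw Pz) _; rewrite (gdistC M w z) ltrD.
Qed.

Lemma measurable_inner (U : set T) t : measurable (inner U t).
Proof.
pose O : set T := [set z | P z /\ exists w, [/\ P w, ~ U w & d w z < t]].
have Oo : gopen M O.
  split => [z []//|z [Pz [w [Pw Uw wz]]]].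
  exists (t - d w z); first by rewrite subr_gt0.
  move=> v [Pv vz]; split => //; exists w; split => //.
  by apply: le_lt_trans (gdist_triangle Pw Pz Pv) _; rewrite (gdistC M z v) -ltrBrDl.
rewrite (_ : inner U t = P `\` O).
  by apply: measurableD; [exact: measurable_points|exact: measurable_gopen Oo].
apply/seteqP; split => z [Pz zU]; split => //.
  by move=> [_ [w [Pw Uw wz]]]; apply: Uw; exact: zU.
move=> w [Pw wz]; apply: contrapT => Uw; apply: zU; split => //.
by exists w.
Qed.

(** A nearly extremal function is truncated to an erosion of [U], moved with its height function by
    polarizations, and truncated to the ball; both truncations lose little energy by the same choice
    of [eps]. *)
Lemma extremal_energy_le_gball (U : set T) x0 r (l l' : R) : gbounded M U -> gopen M U ->
  P x0 -> mu (gball M x0 r) = mu U -> 0 < r -> 0 < l' ->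
  (forall e, 0 < e -> exists f, [/\ L2_on mu U f, forall x, 0 <= f x,
    (\int[mu]_x (f x ^+ 2)%:E <= 1)%E & ((l - e)%:E < energy mu kK f f)%E]) ->
  (forall f, L2_on mu (gball M x0 r) f -> (forall x, 0 <= f x) ->
    (energy mu kK f f <= l'%:E * \int[mu]_x (f x ^+ 2)%:E)%E) -> l <= l'.
Proof.
move=> [p [rU [Pp Ur]]] Uo Px0 UB r0 l'0 lsup l'le.
rewrite leNgt; apply/negP => ll'.
have UP : U `<=` P by case: Uo.
have mU := measurable_gopen Uo.
have mB t := measurable_gball t Px0.
(* Three losses of [e] occur: the choice of [f] and two truncations. They give [l - l' <= 3 * e], a
   contradiction. *)
pose e := (l - l') / 5; have e0 : 0 < e by rewrite divr_gt0// subr_gt0.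
have [f [Lf f0 f1 fe]] := lsup e e0; have [mf _ fU] := Lf.
pose rD := rU + d p x0.
have UD : U `<=` gball M x0 rD.
  move=> z /Ur[Pz zp]; split => //; apply: le_lt_trans (gdist_triangle Pz Pp Px0) _.
  by rewrite ltrD2r.
have Vfin : (mu U < +oo)%E by rewrite -UB; exact: riemM_gball_finite.
have V0 : 0 <= fine (mu U) by exact: fine_ge0.
have VE : (fine (mu U))%:E = mu U by rewrite fineK// ge0_fin_numE.
have [eps1 eps10 small] := energy_small n0 K_pos K_noninc K_locint rD Px0 V0 e0.
(* The concentrated support sticks out of the ball by measure [2 * eps]. *)
pose eps := eps1 / 2; have eps0 : 0 < eps by rewrite divr_gt0.
have mI t : measurable (inner U t) by exact: measurable_inner.
(* [U] is open, so its erosions exhaust it as the depth tends to 0. *)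
have [k Ak] : exists k, (mu (U `\` inner U k.+1%:R^-1) <= eps%:E)%E.
  pose D k := U `\` inner U k.+1%:R^-1.
  have mD k : measurable (D k) by exact: measurableD.
  suff [k Dk] : exists k, (mu (D k) <= eps%:E)%E by exists k.
  apply: small_measure => [//||||//].
  - move=> i j ij z [Uz zj]; split => // zi; apply: zj; apply: innerS zi.
    by rewrite lef_pV2 ?posrE// ler_nat.
  - apply: le_lt_trans Vfin; apply: le_measure; rewrite ?inE//.
    by move=> z [].
  - rewrite (_ : \bigcap_k D k = set0) ?measure0//.
    apply/seteqP; split => // z zA; have [Uz _] := zA 0%N I.
    have [rho rho0 zU] := Uo.2 z Uz.
    have [_ []] := zA (Num.truncn rho^-1) I; split; first exact: UP.
    apply: subset_trans zU; apply: gball_sub.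
    rewrite -[leRHS]invrK lef_pV2 ?posrE ?invr_gt0//.
    by apply: ltW; exact: truncnS_gt.
set t : R := k.+1%:R^-1 in Ak; have t0 : 0 < t by rewrite invr_gt0.
pose dl := t / 3; have dl0 : 0 < dl by rewrite divr_gt0.
have dl3 : dl + dl + dl = t by rewrite /dl; lra.
pose g x : R := f x * \1_(inner U t) x.
have i01 (A : set T) z : 0 <= \1_A z :> R /\ \1_A z <= 1 :> R.
  by rewrite indicE; case: (_ \in _).
have i_le (A A' : set T) z z' : (A z -> A' z') -> \1_A z <= \1_A' z' :> R.
  move=> AA'; rewrite !indicE; case: (boolP (z \in A)) => [/set_mem/AA' h|_]; last exact: ler0n.
  by rewrite mem_set.
(* Counts the erosions containing [z], at depths [dl], [2 * dl] and [t = 3 * dl]. A move shorter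
   than [dl] changes the count by at most 1, and [g] lives where it is 3. *)
pose phi z : R := \1_(inner U dl) z + \1_(inner U (dl + dl)) z + \1_(inner U t) z.
have m1 (A : set T) : measurable A -> measurable_fun [set: T] (\1_A : T -> R).
  by move=> mA; exact: measurable_indic.
have mg : measurable_fun [set: T] g by apply: measurable_funM => //; exact: m1.
have mphi : measurable_fun [set: T] phi.
  by apply: measurable_funD; [apply: measurable_funD|]; exact: m1.
have sqr_indic_le (h : T -> R) (A : set T) : measurable A -> measurable_fun [set: T] h ->
    (\int[mu]_x (h x ^+ 2)%:E <= 1)%E -> (\int[mu]_x ((h x * \1_A x) ^+ 2)%:E <= 1)%E.
  move=> mA mh; apply: le_trans; apply: ge0_le_integral => //.
  - by move=> x _; rewrite lee_fin sqr_ge0.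
  - by apply/measurable_EFinP; apply: measurable_funX; apply: measurable_funM => //; exact: m1.
  - by apply/measurable_EFinP; exact: measurable_funX.
  move=> x _; rewrite lee_fin indicE; case: (_ \in _); first by rewrite mulr1.
  by rewrite mulr0 expr0n sqr_ge0.
have phiU z : 0 < phi z -> U z.
  move=> z0; apply: contrapT => Uz.
  have out s : 0 < s -> \1_(inner U s) z = 0 :> R.
    by move=> s0; rewrite indicE memNset// => /(inner_sub s0).
  by move: z0; rewrite /phi (out dl dl0) (out _ (addr_gt0 dl0 dl0)) (out t t0) !addr0 ltxx.
have adm : admissible M K x0 r rD (l - 2 * e) eps dl g phi.
  split => //.
  - by move=> z; rewrite mulr_ge0//; have [] := i01 (inner U t) z.
  - exact: sqr_indic_le.
  - have := small f U (inner U t) mU (mI t) UD mf f0 fU f1.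
    rewrite VE lexx => /(_ isT) h.
    have {}h := h (le_trans Ak _).
    have {}h : (energy mu kK f f <= energy mu kK g g + e%:E)%E.
      by apply: h; rewrite lee_fin /eps; lra.
    have := le_trans (ltW fe) h; have -> : l - e = l - 2 * e + e by lra.
    by rewrite EFinD leeD2rE.
  - move=> z; have [a1 a2] := i01 (inner U dl) z; have [b1 b2] := i01 (inner U (dl + dl)) z.
    have [c1 c2] := i01 (inner U t) z.
    by rewrite /phi; apply/andP; split; lra.
  - move=> z z0; have [a1 a2] := i01 (inner U dl) z; have [b1 b2] := i01 (inner U (dl + dl)) z.
    have [c1 c2] := i01 (inner U t) z.
    by rewrite /g; have -> : \1_(inner U t) z = 0 :> R; [move: z0; rewrite /phi; lra|rewrite mulr0].
  - by move=> z /phiU/UD.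
  - rewrite UB; apply: le_measure; rewrite ?inE//; first exact: measurable_superlevel.
  - apply: le_trans Ak; apply: le_measure; rewrite ?inE//.
    + exact: measurable_layer.
    + exact: measurableD.
    move=> z /= /andP[z0 z3]; split; first exact: phiU.
    move=> zt; move: z3; rewrite /phi !indicE !mem_set//.
    * by rewrite /=; lra.
    * by apply: innerS zt; lra.
    * by apply: innerS zt; lra.
  - move=> z w Pz Pw zw.
    have step z' w' : P w' -> d z' w' < dl -> phi z' <= phi w' + 1.
      move=> Pw' zw'.
      have [a1 a2] := i01 (inner U dl) z'; have [c1 c2] := i01 (inner U t) w'.
      have s1 : \1_(inner U (dl + dl)) z' <= \1_(inner U dl) w' :> R.
        by apply: i_le; exact: inner_near.
      have s2 : \1_(inner U t) z' <= \1_(inner U (dl + dl)) w' :> R.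
        by apply: i_le; rewrite -dl3; exact: inner_near.
      by rewrite /phi; lra.
    have := step z w Pw zw; have := step w z Pz.
    rewrite gdistC => /(_ zw); rewrite ler_norml => h1 h2.
    by apply/andP; split; lra.
have [h [psi [A Aout]]] := adm_concentrated n0 K_pos K_noninc Px0 r0 eps0 dl0 adm.
have mh := adm_measurable A; have h0 := adm_ge0 A.
have mS := measurable_superlevel 0 (adm_hmeasurable A).
have hS x : ~ [set z | 0 < psi z] x -> h x = 0.
  move=> /= /negP; rewrite -leNgt => x0'; apply: (adm_support A); apply/eqP.
  by rewrite eq_le x0'; have /andP[] := adm_height A x.
have := small h [set z | 0 < psi z] (gball M x0 r) mS (mB r) (fun z => @adm_bounded _ _ _ _ _ _ _ _ _ _ _ _ A z)
  mh h0 hS (adm_norm A).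
rewrite VE -UB => /(_ (adm_volume A)) {}small.
have {}small := small (le_trans Aout _).
have {}small : (energy mu kK h h <= energy mu kK (fun x => h x * \1_(gball M x0 r) x)%R
    (fun x => h x * \1_(gball M x0 r) x)%R + e%:E)%E.
  by apply: small; rewrite lee_fin /eps; lra.
pose hB x : R := h x * \1_(gball M x0 r) x.
have hB1 : (\int[mu]_x (hB x ^+ 2)%:E <= 1)%E.
  by apply: sqr_indic_le => //; exact: adm_norm A.
have LhB : L2_on mu (gball M x0 r) hB.
  split; first by apply: measurable_funM => //; apply: m1.
    by apply: le_lt_trans hB1 _; rewrite ltry.
  by move=> x xB; rewrite /hB indicE memNset// mulr0.
have hB0 x : 0 <= hB x by rewrite mulr_ge0//; have [] := i01 (gball M x0 r) x.
have hBle : (energy mu kK hB hB <= l'%:E)%E.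
  apply: le_trans (l'le hB LhB hB0) _.
  by rewrite -[leRHS]mule1 lee_pmul2l// lte_fin.
have := le_trans (adm_energy A) (le_trans small (leeD hBle (lexx e%:E))).
by rewrite -EFinD lee_fin /e; lra.
Qed.

End comparison.

Theorem theorem2p1 (R : realType) (M : space_form) (n : nat) (K : R -> R)
    (hn : (2 <= n)%N)
    (K_pos : forall t : R, 0 < t -> 0 < K t)
    (K_noninc : forall s t : R, 0 < s -> s <= t -> K t <= K s)
    (K_locint : forall x : 'rV[R]_n.+1, space_points M x ->
      glocally_integrable M (fun y => K (gdist M x y)))
    (K_compact : forall O : set 'rV[R]_n.+1,
      O !=set0 -> gbounded M O -> gopen M O ->
      compact_operator (riemannian_measure M) O (kernel_operator M K O)) :
  forall O : set 'rV[R]_n.+1, O !=set0 -> gbounded M O -> gopen M O ->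
  forall (x0 : 'rV[R]_n.+1) (r : R), space_points M x0 -> 0 < r ->
  riemannian_measure M (gball M x0 r) = riemannian_measure M O ->
  let is_lambda1 (U : set 'rV[R]_n.+1) (l : R) :=
    largest_eigenvalue (riemannian_measure M) U (kernel_operator M K U) l in
  [/\ exists l, is_lambda1 O l,
      exists l', is_lambda1 (gball M x0 r) l' &
      forall l l', is_lambda1 O l -> is_lambda1 (gball M x0 r) l' ->
        0 < l <= l'].
Proof.
move=> U U0 Ub Uo x0 r Px0 r0 UB is_lambda1.
have n0 : (0 < n)%N by exact: leq_trans hn.
have B0 : gball M x0 r !=set0 by exists x0; exact: gball_center.
have Bb : gbounded M (gball M x0 r) by exists x0, r; split.
have Bo : gopen M (gball M x0 r) by exact: gopen_gball.
have [l [l0 lP lle lsup]] :=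
  largest_eigenvalue_energy n0 K_pos K_noninc K_locint U0 Ub Uo (K_compact _ U0 Ub Uo).
have [l' [l'0 l'P l'le _]] :=
  largest_eigenvalue_energy n0 K_pos K_noninc K_locint B0 Bb Bo (K_compact _ B0 Bb Bo).
split; [by exists l; apply/lP|by exists l'; apply/l'P|].
move=> _ _ /lP -> /l'P ->; rewrite l0/=.
exact: (extremal_energy_le_gball n0 K_pos K_noninc K_locint Ub Uo Px0 UB r0 l'0 lsup l'le).
Qed.
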